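(* Let $N\in\mathbb{N}$ and let $\mathcal{M}_1\subset\mathcal{M}_2\subset H^2\otimes\mathbb{C}^N$ be two invariant subspaces of the $\mathbb{C}^N$-valued symmetric Fock space in two variables such that $\dim\mathcal{M}_1/I\mathcal{M}_1<\infty$ and $\dim\mathcal{M}_2/I\mathcal{M}_2<\infty$, where $I=(z,w)\subset\mathbb{C}[z,w]$. Then $$e(I,\mathcal{M}_1)\le e(I,\mathcal{M}_2).$$ In particular, for any invariant subspace $\mathcal{M}\subset H^2\otimes\mathbb{C}^N$ with $\dim\mathcal{M}/I\mathcal{M}<\infty$, one has $e(I,\mathcal{M})\le N$.
   Context: $H^2$ denotes the symmetric Fock space in two variables: the Hilbert space of holomorphic functions on the open unit ball $B_2\subset\mathbb{C}^2$ with reproducing kernel $\frac{1}{1-z\bar\zeta-w\bar\eta}$; $H^2\otimes\mathbb{C}^N$ is the space of $\mathbb{C}^N$-valued functions with entries in $H^2$. An invariant subspace is a closed subspace invariant under multiplication by the coordinate functions $z$ and $w$; it is thus a module over $\mathbb{C}[z,w]$. For an invariant subspace $\mathcal{M}$ with $\dim\mathcal{M}/I\mathcal{M}<\infty$, the Samuel multiplicity is $e(I,\mathcal{M})=2!\lim_{k\to\infty}\frac{\dim\mathcal{M}/I^k\mathcal{M}}{k^2}$. *)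

(* Defs.v *)
From HB Require Import structures.
From mathcomp Require Export all_boot all_order all_algebra.
From mathcomp Require Export all_classical all_reals all_analysis.
From mathcomp Require Export complex.
Export numFieldNormedType.Exports.
Export Order.TTheory GRing.Theory Num.Theory.

Set Implicit Arguments.
Unset Strict Implicit.
Unset Printing Implicit Defensive.

Local Open Scope classical_set_scope.
Local Open Scope complex_scope.
Local Open Scope ring_scope.

Section linear_algebra.

(* [b] induces a basis of the vector space M/L; meant for linear subspaces
   L `<=` M. *)
Definition quotient_basis (K : fieldType) (V : lmodType K) (M L : set V)
    (n : nat) (b : 'I_n -> V) : Prop :=
  [/\ forall i, M (b i),
      forall v, M v -> exists c : 'I_n -> K, L (v - \sum_(i < n) c i *: b i)
    & forall c : 'I_n -> K,
        L (\sum_(i < n) c i *: b i) -> forall i, c i = 0].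

(* The infimum is over a set with at most one element, empty (infimum +oo)
   when M/L is infinite dimensional. *)
Definition quotient_dim (R : realType) (K : fieldType) (V : lmodType K)
    (M L : set V) : \bar R :=
  ereal_inf [set n%:R%:E | n in
    [set n : nat | exists b : 'I_n -> V, quotient_basis M L b]].

Definition subspace (K : fieldType) (V : lmodType K) (M : set V) : Prop :=
  M 0 /\ forall (a : K) (u v : V), M u -> M v -> M (a *: u + v).

End linear_algebra.

Section ideals.

Variable A : comNzRingType.

Definition ideal_mul (I J : set A) : set A :=
  [set p | exists (n : nat) (a b : 'I_n -> A),
    [/\ forall i, I (a i), forall i, J (b i)
      & p = \sum_(i < n) a i * b i]].

Definition ideal_exp (I : set A) (k : nat) : set A :=
  iter k (ideal_mul I) setT.

(* I M for an ideal I and a subset M of a module with scalar action [act]. *)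
Definition ideal_act (V : zmodType) (act : A -> V -> V)
    (I : set A) (M : set V) : set V :=
  [set v | exists (n : nat) (a : 'I_n -> A) (m : 'I_n -> V),
    [/\ forall i, I (a i), forall i, M (m i)
      & v = \sum_(i < n) act (a i) (m i)]].

End ideals.

Section hilbert_function_spaces.

Variables (R : realType) (X : Type).

(* A Hilbert space of functions X -> C with reproducing kernel k.  The inner
   product is linear in its first argument and only meaningful on [hfs_set].
   Such a space is determined by k. *)
Record hilbert_function_space (k : X -> X -> R[i]) : Type := {
  hfs_set : set (X -> (R[i])^o) ;
  hfs_ip : (X -> (R[i])^o) -> (X -> (R[i])^o) -> R[i] ;
  hfs_norm : (X -> (R[i])^o) -> R :=
    fun f => Num.sqrt (complex.Re (hfs_ip f f)) ;
  hfs_subspace : subspace hfs_set ;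
  hfs_ip_linear : forall (a : R[i]) f g h,
    hfs_set f -> hfs_set g -> hfs_set h ->
    hfs_ip (a *: f + g) h = a * hfs_ip f h + hfs_ip g h ;
  hfs_ip_conj : forall f g, hfs_set f -> hfs_set g ->
    hfs_ip g f = Num.conj (hfs_ip f g) ;
  hfs_ip_ge0 : forall f, hfs_set f -> 0 <= hfs_ip f f ;
  hfs_ip_eq0 : forall f, hfs_set f -> hfs_ip f f = 0 -> f = 0 ;
  hfs_complete : forall u : nat -> X -> (R[i])^o,
    (forall n, hfs_set (u n)) ->
    (forall e : R, 0 < e -> exists n0 : nat, forall m n : nat,
      (n0 <= m)%N -> (n0 <= n)%N -> hfs_norm (u m - u n) < e) ->
    exists2 f, hfs_set f & (fun n => hfs_norm (u n - f)) @ \oo --> (0 : R) ;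
  hfs_kernel : forall y, hfs_set (fun x => k x y) ;
  hfs_reproducing : forall f y, hfs_set f -> f y = hfs_ip f (fun x => k x y)
}.

End hilbert_function_spaces.

Section symmetric_fock_space.

Variable R : realType.

Definition ball2 : Type :=
  {x : R[i] * R[i] | `|x.1| ^+ 2 + `|x.2| ^+ 2 < 1}.

(* Complex differentiability at every point of the ball; the ball being open,
   the extension by 0 to C^2 is immaterial. *)
Definition holomorphic (f : ball2 -> (R[i])^o) : Prop :=
  forall x : ball2,
    differentiable
      (fun y : (R[i])^o * (R[i])^o => oapp f 0 (insub y : option ball2))
      (val x : (R[i])^o * (R[i])^o).

Definition fock_kernel (x y : ball2) : R[i] :=
  1 / (1 - (val x).1 * Num.conj (val y).1 - (val x).2 * Num.conj (val y).2).

Record symmetric_fock : Type := {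
  fock_hfs :> hilbert_function_space fock_kernel ;
  fock_holomorphic : forall f, hfs_set fock_hfs f -> holomorphic f
}.

Variables (H : symmetric_fock) (N : nat).

Definition entry (i : 'I_N) (F : ball2 -> 'rV[R[i]]_N) : ball2 -> (R[i])^o :=
  fun x => F x 0 i.

Definition vfock : set (ball2 -> 'rV[R[i]]_N) :=
  [set F | forall i, hfs_set H (entry i F)].

Definition vfock_norm (F : ball2 -> 'rV[R[i]]_N) : R :=
  Num.sqrt (\sum_(i < N) hfs_norm H (entry i F) ^+ 2).

(* C[z,w] is {poly {poly C}} with z = 'X and w = 'Y := 'X%:P; p.[a, b]
   substitutes a for 'X and b for 'Y. *)
Definition poly_act (p : {poly {poly R[i]}}) (F : ball2 -> 'rV[R[i]]_N) :
    ball2 -> 'rV[R[i]]_N :=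
  fun x => p.[(val x).1, (val x).2] *: F x.

Record invariant_subspace (M : set (ball2 -> 'rV[R[i]]_N)) : Prop := {
  inv_sub : M `<=` vfock ;
  inv_subspace : subspace M ;
  inv_closed : forall (u : nat -> ball2 -> 'rV[R[i]]_N) F,
    (forall n, M (u n)) -> vfock F ->
    (fun n => vfock_norm (u n - F)) @ \oo --> (0 : R) -> M F ;
  inv_mulz : forall F, M F -> M (poly_act 'X F) ;
  inv_mulw : forall F, M F -> M (poly_act 'Y F)
}.

Definition maxideal : set {poly {poly R[i]}} :=
  [set p | exists a b : {poly {poly R[i]}}, p = a * 'X + b * 'Y].

(* dim M/IM, with IM the algebraic product, without closure. *)
Definition codim_ideal (I : set {poly {poly R[i]}})
    (M : set (ball2 -> 'rV[R[i]]_N)) : \bar R :=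
  quotient_dim R M (ideal_act poly_act I M).

Definition samuel_multiplicity (I : set {poly {poly R[i]}})
    (M : set (ball2 -> 'rV[R[i]]_N)) : \bar R :=
  ((2`!)%:R%:E *
   limn (fun k : nat => codim_ideal (ideal_exp I k) M * ((k%:R ^+ 2)^-1)%:E))%E.

End symmetric_fock_space.

Arguments maxideal R : clear implicits.

(* Main.v *)
Require Import Defs.
From mathcomp Require Import ring lra zify.

(** The Samuel multiplicity of M equals its fiber rank r, the largest dimension
    of a fiber {F x | F in M} over the points x of the ball; this rank is
    monotone in M and at most N.

    For K in M representing F |-> <F x, c>, the function
    phi = (1 - <., x>) K is a multiplier from the Fock space H into M: since
    K is an eigenvector of the adjoints of z and w,
      |t phi + z U + w W|^2 <= D |t|^2 + |U|^2 + |W|^2   for U, W in M,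
    and decomposing a polynomial as t + z a + w b gives |h phi|^2 <= D |h|^2.
    Choose r such columns phi_j, independent at some point, and let delta be
    the square of a nonzero r x r minor.  By Cramer's rule
    delta F = \sum_j (D_j F) phi_j for F in M, where D_j : M -> H is a module
    map with D_j phi_i = delta [i = j].  Let s be the order of delta at 0.

    Lower bound: the z^a w^b phi_j with a + b < k - s are independent modulo
    I^k M, because D_j maps I^k M into I^k H.  Upper bound: I^k M has finite
    codimension, hence is closed (Baire), so that delta acts on M / I^k M as
    its Taylor polynomial; hence M is spanned modulo I^k M by the z^a w^b phi_j
    with a + b < k and by O(k) further elements. *)

Set Implicit Arguments.
Unset Strict Implicit.
Unset Printing Implicit Defensive.

Local Open Scope classical_set_scope.
Local Open Scope complex_scope.
Local Open Scope ring_scope.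

(** H is given only by its kernel k, so its whole structure is drawn from k(x,y) = 1 + <x,y> k(x,y):
    the row (z, w) is contractive, homogeneous parts of different degrees are orthogonal, and each f
    in H is f(0) + z a + w b with a, b in H.

    Two obstacles shape the proof. A general F in M does not multiply H into M, so copies of H
    inside M have to be produced from representers of point evaluations. And delta is not a
    polynomial, while I^k M is an algebraic product: replacing delta by its Taylor polynomial P is
    clear only on the dense span of the functions k_x phi, and passing to all of M requires I^k M to
    be closed.

    The O(k) term: polynomials modulo I^k and multiples of P have dimension at most k(k+1)/2 -
    (k-s)(k-s+1)/2, linear in k, and this is paid once for each of the n generators of M modulo I M.
    Both bounds are thus r k^2 / 2 + O(k), and the factor 2! turns the limit into r. *)

Lemma sqr_leW (R : realDomainType) (x y : R) : 0 <= y -> x ^+ 2 <= y ^+ 2 -> x <= y.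
Proof. by move=> y0 h; case: (lerP x y) => // hxy; nra. Qed.

Lemma zmod_cancel1 (U : zmodType) (a x v v' : U) :
  a + x - v - (x - v') = a - (- v' + v).
Proof. by rewrite addrAC opprB [v' - x]addrC addrA addrK -addrA opprD opprK. Qed.

Lemma zmod_cancel2 (U : zmodType) (l s c t : U) :
  c - s = - (l + (s + t) - c) + (l + t).
Proof.
by rewrite opprB [s + t]addrC [l + (t + s)]addrA opprD (addrA c) addrAC subrK.
Qed.

Lemma zmod_cancel3 (U : zmodType) (x s t v : U) :
  x + s + (v - (x + t)) = v - (t - s).
Proof. by rewrite opprB addrCA opprD addrACA subrr add0r. Qed.

(** * Squared modulus of complex numbers *)

Section sqmod.
Variable R : realType.
Implicit Types z w : R[i].

Definition sqmod z : R := complex.Re z ^+ 2 + complex.Im z ^+ 2.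

Lemma ReD z w : complex.Re (z + w) = complex.Re z + complex.Re w.
Proof. by case: z w => [a b] [c d]. Qed.

Lemma ImD z w : complex.Im (z + w) = complex.Im z + complex.Im w.
Proof. by case: z w => [a b] [c d]. Qed.

Lemma ReN z : complex.Re (- z) = - complex.Re z.
Proof. by case: z. Qed.

Lemma ImN z : complex.Im (- z) = - complex.Im z.
Proof. by case: z. Qed.

Lemma ReM z w : complex.Re (z * w) =
  complex.Re z * complex.Re w - complex.Im z * complex.Im w.
Proof. by case: z w => [a b] [c d]. Qed.

Lemma ImM z w : complex.Im (z * w) =
  complex.Re z * complex.Im w + complex.Im z * complex.Re w.
Proof. by case: z w => [a b] [c d]. Qed.

Lemma ReJ z : complex.Re (Num.conj z) = complex.Re z.
Proof. by case: z. Qed.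

Lemma ImJ z : complex.Im (Num.conj z) = - complex.Im z.
Proof. by case: z. Qed.

Lemma ReC (x : R) : complex.Re x%:C = x. Proof. by []. Qed.
Lemma ImC (x : R) : complex.Im x%:C = 0. Proof. by []. Qed.

Lemma Rei : complex.Re ('i : R[i]) = 0. Proof. by []. Qed.
Lemma Imi : complex.Im ('i : R[i]) = 1. Proof. by []. Qed.

Definition ReImE :=
  (ReD, ImD, ReN, ImN, ReM, ImM, ReJ, ImJ, ReC, ImC, Rei, Imi).

Lemma complex_ext z w : complex.Re z = complex.Re w ->
  complex.Im z = complex.Im w -> z = w.
Proof. by case: z w => [a b] [c d] /= -> ->. Qed.

Lemma sqmod_ge0 z : 0 <= sqmod z.
Proof. by rewrite addr_ge0 // sqr_ge0. Qed.

Lemma conj_real (x : R) : Num.conj x%:C = x%:C.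
Proof. by apply: complex_ext; rewrite !ReImE ?oppr0. Qed.

Lemma conj_realM (x : R) z : Num.conj (x%:C * z) = x%:C * Num.conj z.
Proof. by apply: complex_ext; rewrite !ReImE; ring. Qed.

Lemma conjM z w : Num.conj (z * w) = Num.conj z * Num.conj w.
Proof. by apply: complex_ext; rewrite !ReImE; ring. Qed.

Lemma conjD z w : Num.conj (z + w) = Num.conj z + Num.conj w.
Proof. by apply: complex_ext; rewrite !ReImE; ring. Qed.

Lemma conj_sum (I : Type) (r : seq I) (F : I -> R[i]) :
  Num.conj (\sum_(i <- r) F i) = \sum_(i <- r) Num.conj (F i).
Proof.
elim: r => [|i r IH]; last by rewrite !big_cons conjD IH.
by rewrite !big_nil; apply: complex_ext; rewrite ?ReJ ?ImJ //= oppr0.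
Qed.

Lemma sqmodM z w : sqmod (z * w) = sqmod z * sqmod w.
Proof. by rewrite /sqmod !ReImE; ring. Qed.

Lemma sqmodC (x : R) : sqmod x%:C = x ^+ 2.
Proof. by rewrite /sqmod !ReImE; ring. Qed.

Lemma sqmodN z : sqmod (- z) = sqmod z.
Proof. by rewrite /sqmod !ReImE; ring. Qed.

Lemma sqmodJ z : sqmod (Num.conj z) = sqmod z.
Proof. by rewrite /sqmod !ReImE; ring. Qed.

Lemma sqmod0 : sqmod 0 = 0.
Proof. by rewrite /sqmod /=; ring. Qed.

Lemma sqmod1 : sqmod 1 = 1.
Proof. by rewrite /sqmod /=; ring. Qed.

Lemma sqmod_eq0 z : sqmod z <= 0 -> z = 0.
Proof.
move=> h; have h0 : sqmod z == 0 by rewrite eq_le h sqmod_ge0.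
move: h0; rewrite paddr_eq0 ?sqr_ge0 // !sqrf_eq0 => /andP[/eqP a /eqP b].
exact: complex_ext.
Qed.

Lemma sqmodD z w : sqmod (z + w) <= 2 * sqmod z + 2 * sqmod w.
Proof.
have := sqmod_ge0 (z - w); rewrite /sqmod !ReImE => h.
by nra.
Qed.

Lemma mulJ_sqmod z : z * Num.conj z = (sqmod z)%:C.
Proof. by apply: complex_ext; rewrite !ReImE /sqmod; ring. Qed.

Lemma normc_sqmod z : `|z| ^+ 2 = (sqmod z)%:C.
Proof. by rewrite -add_Re2_Im2. Qed.

End sqmod.

Section subspaces.
Variables (K : fieldType) (V : lmodType K) (M : set V).
Hypothesis HM : subspace M.

Lemma subspace0 : M 0. Proof. by case: HM. Qed.
Lemma subspaceP (a : K) u v : M u -> M v -> M (a *: u + v).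
Proof. by case: HM => _; apply. Qed.
Lemma subspaceZ (a : K) u : M u -> M (a *: u).
Proof. by move=> Mu; rewrite -[_ *: _]addr0; apply: subspaceP => //; apply: subspace0. Qed.
Lemma subspaceD u v : M u -> M v -> M (u + v).
Proof. by move=> Mu Mv; rewrite -[u]scale1r; apply: subspaceP. Qed.
Lemma subspaceN u : M u -> M (- u).
Proof. by move=> Mu; rewrite -scaleN1r; apply: subspaceZ. Qed.
Lemma subspaceB u v : M u -> M v -> M (u - v).
Proof. by move=> Mu Mv; apply: subspaceD => //; apply: subspaceN. Qed.
Lemma subspace_sum (I : Type) (r : seq I) (P : pred I) (F : I -> V) :
  (forall i, P i -> M (F i)) -> M (\sum_(i <- r | P i) F i).
Proof.
by move=> h; apply: big_ind => //; [apply: subspace0|move=> *; apply: subspaceD].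
Qed.
End subspaces.

(** * Hilbert spaces *)

Section hilbert_def.
Variable R : realType.

(** As in [hilbert_function_space], the space is a subset of an ambient module. The scalar field, H
    and its vector-valued version are all treated as instances. *)
Record hilbert (V : lmodType R[i]) := Hilbert {
  hset : set V ;
  hip : V -> V -> R[i] ;
  hsub : subspace hset ;
  hip_linear : forall (a : R[i]) f g h, hset f -> hset g -> hset h ->
    hip (a *: f + g) h = a * hip f h + hip g h ;
  hip_conj : forall f g, hset f -> hset g -> hip g f = Num.conj (hip f g) ;
  hip_ge0 : forall f, hset f -> 0 <= hip f f ;
  hip_eq0 : forall f, hset f -> hip f f = 0 -> f = 0 ;
  hip_complete : forall u : nat -> V, (forall n, hset (u n)) ->
    (forall e : R, 0 < e -> exists n0 : nat, forall m n : nat,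
      (n0 <= m)%N -> (n0 <= n)%N ->
      Num.sqrt (complex.Re (hip (u m - u n) (u m - u n))) < e) ->
    exists2 f, hset f & forall e : R, 0 < e -> exists n0 : nat, forall n : nat,
      (n0 <= n)%N -> Num.sqrt (complex.Re (hip (u n - f) (u n - f))) < e }.

End hilbert_def.

Section hilbert_closure.
Variables (R : realType) (V : lmodType R[i]) (H : hilbert V).

Lemma hset0 : hset H 0. Proof. exact: subspace0 (hsub H). Qed.
Lemma hsetZ (a : R[i]) f : hset H f -> hset H (a *: f).
Proof. exact: subspaceZ (hsub H) _ _. Qed.
Lemma hsetD f g : hset H f -> hset H g -> hset H (f + g).
Proof. exact: subspaceD (hsub H) _ _. Qed.
Lemma hsetN f : hset H f -> hset H (- f).
Proof. exact: subspaceN (hsub H) _. Qed.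

Lemma hsetB f g : hset H f -> hset H g -> hset H (f - g).
Proof. exact: subspaceB (hsub H) _ _. Qed.

End hilbert_closure.

#[local] Hint Extern 0 (hset _ _) =>
  solve [repeat first [assumption
    | match goal with h : forall n, hset _ (@?f n) |- _ => solve [apply: h] end
    | apply: hset0 | apply: hsetD
    | apply: hsetN | apply: hsetZ]] : core.

Section hilbert.
Variables (R : realType) (V : lmodType R[i]) (H : hilbert V).
Local Notation S := (hset H).
Local Notation ip := (hip H).
Implicit Types f g h : V.

Definition hnsq f := complex.Re (ip f f).
Definition hnrm f := Num.sqrt (hnsq f).

Lemma ipDl f g h : S f -> S g -> S h -> ip (f + g) h = ip f h + ip g h.
Proof. by move=> *; rewrite -{1}[f]scale1r hip_linear // mul1r. Qed.

Lemma ip0l h : S h -> ip 0 h = 0.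
Proof.
move=> Sh; have := @ipDl 0 0 h (hset0 H) (hset0 H) Sh; rewrite addr0 => /esym/eqP.
by rewrite -subr_eq0 addrK => /eqP.
Qed.

Lemma ipZl a f h : S f -> S h -> ip (a *: f) h = a * ip f h.
Proof. by move=> Sf Sh; rewrite -[a *: f]addr0 hip_linear // ip0l // addr0. Qed.

Lemma ipNl f h : S f -> S h -> ip (- f) h = - ip f h.
Proof. by move=> Sf Sh; rewrite -scaleN1r ipZl // mulN1r. Qed.

Lemma ipDr f g h : S f -> S g -> S h -> ip h (f + g) = ip h f + ip h g.
Proof.
move=> Sf Sg Sh; rewrite (hip_conj (hsetD Sf Sg) Sh) ipDl // (hip_conj Sf Sh).
by rewrite (hip_conj Sg Sh) rmorphD.
Qed.

Lemma ipZr a f h : S f -> S h -> ip h (a *: f) = Num.conj a * ip h f.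
Proof.
move=> Sf Sh; rewrite (hip_conj (hsetZ a Sf) Sh) ipZl // (hip_conj Sf Sh).
by rewrite rmorphM.
Qed.

Lemma ip0r h : S h -> ip h 0 = 0.
Proof. by move=> Sh; rewrite hip_conj // ip0l // rmorph0. Qed.

Lemma ipNr f h : S f -> S h -> ip h (- f) = - ip h f.
Proof.
move=> Sf Sh; rewrite (hip_conj (hsetN Sf) Sh) ipNl // (hip_conj Sf Sh).
by rewrite rmorphN.
Qed.

Lemma ipBr f g h : S f -> S g -> S h -> ip h (f - g) = ip h f - ip h g.
Proof. by move=> Sf Sg Sh; rewrite ipDr ?ipNr //. Qed.

Lemma ip_suml (I : Type) (r : seq I) (F : I -> V) h :
  (forall i, S (F i)) -> S h ->
  ip (\sum_(i <- r) F i) h = \sum_(i <- r) ip (F i) h.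
Proof.
move=> SF Sh; elim: r => [|i r IH]; first by rewrite !big_nil ip0l.
by rewrite !big_cons ipDl ?IH //; apply: (subspace_sum (hsub H)).
Qed.

Lemma ip_sumr (I : Type) (r : seq I) (F : I -> V) h :
  (forall i, S (F i)) -> S h ->
  ip h (\sum_(i <- r) F i) = \sum_(i <- r) ip h (F i).
Proof.
move=> SF Sh; elim: r => [|i r IH]; first by rewrite !big_nil ip0r.
by rewrite !big_cons ipDr ?IH //; apply: (subspace_sum (hsub H)).
Qed.

Lemma ip_nsq f : S f -> ip f f = (hnsq f)%:C.
Proof.
by move=> Sf; apply: complex_ext; rewrite ?ReImE // ger0_Im // hip_ge0.
Qed.

Lemma nsq_ge0 f : S f -> 0 <= hnsq f.
Proof. by move=> Sf; rewrite -ler0c -ip_nsq // hip_ge0. Qed.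

Lemma nsq_eq0 f : S f -> hnsq f <= 0 -> f = 0.
Proof.
move=> Sf h; apply: (@hip_eq0 _ _ H) => //; rewrite ip_nsq //.
by have -> : hnsq f = 0 by apply/eqP; rewrite eq_le h nsq_ge0.
Qed.

Lemma nsq0 : hnsq 0 = 0. Proof. by rewrite /hnsq ip0l. Qed.

Lemma nsqD f g : S f -> S g ->
  hnsq (f + g) = hnsq f + hnsq g + 2 * complex.Re (ip f g).
Proof.
move=> Sf Sg; rewrite /hnsq (ipDl Sf Sg (hsetD Sf Sg)) (ipDr Sf Sg Sf).
by rewrite (ipDr Sf Sg Sg) (hip_conj Sf Sg) !ReImE; ring.
Qed.

Lemma nsqZ a f : S f -> hnsq (a *: f) = sqmod a * hnsq f.
Proof.
move=> Sf; rewrite /hnsq (ipZl _ Sf (hsetZ a Sf)) (ipZr _ Sf Sf) mulrA mulJ_sqmod.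
by rewrite !ReImE; ring.
Qed.

Lemma nsqN f : S f -> hnsq (- f) = hnsq f.
Proof. by move=> Sf; rewrite -scaleN1r nsqZ // sqmodN sqmod1 mul1r. Qed.

Lemma nsqB f g : S f -> S g ->
  hnsq (f - g) = hnsq f + hnsq g - 2 * complex.Re (ip f g).
Proof.
by move=> Sf Sg; rewrite nsqD // nsqN // ipNr // !ReImE mulrN.
Qed.

Lemma cauchy_schwarz f g : S f -> S g ->
  sqmod (ip f g) <= hnsq f * hnsq g.
Proof.
move=> Sf Sg; set c := ip f g.
(* Expand |f - t c g|^2 for real t; t = 1 / |g|^2 is optimal, and if |g| = 0 a large t forces c =
   0. *)
have key (t : R) : 0 <= hnsq f - 2 * t * sqmod c + t ^+ 2 * sqmod c * hnsq g.
  have := nsq_ge0 (hsetB Sf (hsetZ (t%:C * c) Sg)).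
  rewrite nsqB // nsqZ // ipZr // sqmodM sqmodC -/c rmorphM.
  suff -> : complex.Re (Num.conj (t%:C) * Num.conj c * c) = t * sqmod c.
    by move=> h; apply: (le_trans h); rewrite le_eqVlt; apply/orP; left;
      apply/eqP; ring.
  by rewrite /sqmod !ReImE; ring.
have f0 := nsq_ge0 Sf; have g0 := nsq_ge0 Sg; have c0 := sqmod_ge0 c.
have [gz|gn] := eqVneq (hnsq g) 0.
  rewrite gz mulr0; have [->//|cn] := eqVneq (sqmod c) 0.
  have := key ((hnsq f + 1) / (2 * sqmod c)); rewrite gz mulr0 addr0.
  have -> : 2 * ((hnsq f + 1) / (2 * sqmod c)) * sqmod c = hnsq f + 1 by field.
  lra.
have := key (hnsq g)^-1.
have -> : hnsq f - 2 * (hnsq g)^-1 * sqmod c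
   + (hnsq g)^-1 ^+ 2 * sqmod c * hnsq g =
   (hnsq f * hnsq g - sqmod c) / hnsq g by field.
by rewrite pmulr_lge0 ?invr_gt0 ?lt_def ?gn // subr_ge0.
Qed.

Lemma nrm_ge0 f : 0 <= hnrm f. Proof. exact: sqrtr_ge0. Qed.

Lemma nrm_sqr f : S f -> hnrm f ^+ 2 = hnsq f.
Proof. by move=> Sf; rewrite sqr_sqrtr // nsq_ge0. Qed.

Lemma rip_le f g : S f -> S g -> complex.Re (ip f g) <= hnrm f * hnrm g.
Proof.
move=> Sf Sg; have cs := cauchy_schwarz Sf Sg.
rewrite -sqrtrM ?nsq_ge0 //; apply: le_trans (ler_norm _) _.
rewrite -sqrtr_sqr; apply: ler_wsqrtr; apply: le_trans cs.
by rewrite lerDl sqr_ge0.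
Qed.

Lemma nrmD f g : S f -> S g -> hnrm (f + g) <= hnrm f + hnrm g.
Proof.
move=> Sf Sg; rewrite -(@ler_pXn2r _ 2) ?nnegrE ?nrm_ge0 ?addr_ge0 ?nrm_ge0 //.
rewrite nrm_sqr // nsqD // sqrrD !nrm_sqr //.
by have := rip_le Sf Sg; lra.
Qed.

Lemma nrmN f : S f -> hnrm (- f) = hnrm f.
Proof. by move=> Sf; rewrite /hnrm nsqN. Qed.

Lemma nrmB f g : S f -> S g -> hnrm (f - g) <= hnrm f + hnrm g.
Proof. by move=> Sf Sg; rewrite -[hnrm g]nrmN // nrmD. Qed.

Lemma nrm_distC f g : S f -> S g -> hnrm (f - g) = hnrm (g - f).
Proof. by move=> Sf Sg; rewrite -[g - f]opprB nrmN // -opprB opprK. Qed.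

Lemma nrm_triangle f g h : S f -> S g -> S h ->
  hnrm (f - h) <= hnrm (f - g) + hnrm (g - h).
Proof.
move=> Sf Sg Sh; have -> : f - h = (f - g) + (g - h) by rewrite addrA subrK.
by rewrite nrmD.
Qed.

Lemma nrm0 : hnrm 0 = 0. Proof. by rewrite /hnrm nsq0 sqrtr0. Qed.

Lemma nrmZ (t : R) f : 0 <= t -> S f -> hnrm (t%:C *: f) = t * hnrm f.
Proof.
move=> t0 Sf; rewrite /hnrm nsqZ // sqmodC sqrtrM ?sqr_ge0 //.
by rewrite sqrtr_sqr ger0_norm.
Qed.

Lemma nrm_lt f (e : R) : S f -> 0 < e -> (hnrm f < e) = (hnsq f < e ^+ 2).
Proof.
move=> Sf e0; rewrite -nrm_sqr // ltr_pXn2r // nnegrE ?nrm_ge0 //.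
exact: ltW.
Qed.

Definition hcl (A : set V) : set V :=
  [set f | S f /\ forall e : R, 0 < e -> exists2 a, A a & hnrm (f - a) < e].

Definition hcvg (u : nat -> V) f := forall e : R, 0 < e ->
  exists n0 : nat, forall n : nat, (n0 <= n)%N -> hnrm (u n - f) < e.

Definition hcauchy (u : nat -> V) := forall e : R, 0 < e ->
  exists n0 : nat, forall m n : nat, (n0 <= m)%N -> (n0 <= n)%N ->
  hnrm (u m - u n) < e.

Lemma hcauchy_cvg u : (forall n, S (u n)) -> hcauchy u ->
  exists2 f, S f & hcvg u f.
Proof. exact: (@hip_complete _ _ H). Qed.

Lemma hcvg_cl A u f : (forall n, A (u n)) -> S f -> A `<=` S ->
  hcvg u f -> hcl A f.
Proof.
move=> Au Sf AS cu; split=> // e e0; have [n0 /(_ n0 (leqnn _)) h] := cu e e0.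
by exists (u n0) => //; rewrite nrm_distC //; apply: AS.
Qed.

Lemma hcl_cvg A f : A `<=` S -> hcl A f ->
  exists2 u, (forall n, A (u n)) & hcvg u f.
Proof.
move=> AS [Sf cf].
have h n : {a | A a /\ hnrm (f - a) < n.+1%:R^-1}.
  apply: cid; have [|a Aa ha] := cf n.+1%:R^-1; first by rewrite invr_gt0.
  by exists a.
exists (fun n => sval (h n)); first by move=> n; case: (svalP (h n)).
move=> e e0; exists (Num.bound e^-1) => n hn.
case: (svalP (h n)) => An hfn; rewrite nrm_distC //; last exact: AS.
apply: lt_le_trans hfn _.
rewrite invf_ple ?posrE //; apply: le_trans (ltW (archi_boundP _)) _.
  by rewrite invr_ge0 ltW.
by rewrite ler_nat; apply: leq_trans hn _.
Qed.

Lemma hcl_sub A : hcl A `<=` S.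
Proof. by move=> f []. Qed.

Lemma hcl_mono A B : A `<=` B -> hcl A `<=` hcl B.
Proof.
move=> AB f [Sf cf]; split=> // e e0.
by have [a Aa] := cf e e0; exists a => //; apply: AB.
Qed.

End hilbert.

(** * Riesz representation and density by orthogonality *)

Section riesz.
Variables (R : realType) (V : lmodType R[i]) (H : hilbert V).
Local Notation S := (hset H).
Local Notation ip := (hip H).
Variables (P : lmodType R[i]) (SP : set P) (io : P -> V) (L : P -> R[i]) (C : R).
Hypotheses (sSP : subspace SP) (ioS : forall p, SP p -> S (io p)).
Hypothesis ioL : forall a p q, SP p -> SP q -> io (a *: p + q) = a *: io p + io q.
Hypothesis LL : forall a p q, SP p -> SP q -> L (a *: p + q) = a * L p + L q.
Hypotheses (C0 : 0 <= C) (LC : forall p, SP p -> sqmod (L p) <= C * hnsq H (io p)).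

Let J p := hnsq H (io p) - 2 * complex.Re (L p).

Let JP a p q : SP p -> SP q -> J (a *: p + q) = sqmod a * hnsq H (io p) +
   hnsq H (io q) + 2 * complex.Re (a * ip (io p) (io q))
   - 2 * complex.Re (a * L p) - 2 * complex.Re (L q).
Proof.
move=> Sp Sq; have Ip := ioS Sp; have Iq := ioS Sq.
rewrite /J ioL // LL // nsqD // nsqZ // ipZl // [complex.Re (_ + _)]ReD; lra.
Qed.

Let Jlb p : SP p -> - C <= J p.
Proof.
move=> Sp; have := LC Sp; have := nsq_ge0 (ioS Sp); rewrite /J /sqmod.
move: (hnsq H _) (complex.Re _) (complex.Im _) => n x y n0 h.
have y2 := sqr_ge0 y; case: (lerP (- C) (n - 2 * x)) => // h2.
have h3 : n + C < 2 * x by lra.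
have h4 : 0 <= n + C by rewrite addr_ge0.
have : (n + C) ^+ 2 < (2 * x) ^+ 2.
  by rewrite ltr_pXn2r ?nnegrE //; apply: ltW; apply: le_lt_trans h3.
have := sqr_ge0 (n - C); nra.
Qed.

Let E := [set J p | p in SP].
Let m := inf E.

Let Ehas : has_inf E.
Proof.
split; first by exists (J 0), 0 => //; apply: subspace0.
by exists (- C) => _ [p Sp <-]; apply: Jlb.
Qed.

Let mJ p : SP p -> m <= J p.
Proof. by move=> Sp; apply: ge_inf; [case: Ehas|exists p]. Qed.

(** Parallelogram law at the midpoint of p and q, where J is at least m; it makes minimizing
    sequences Cauchy. *)
Let par p q : SP p -> SP q ->
  hnsq H (io p - io q) <= 2 * (J p - m) + 2 * (J q - m).
Proof.
move=> Sp Sq; have Ip := ioS Sp; have Iq := ioS Sq.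
have hh : SP (2^-1%:C *: p + 2^-1%:C *: q).
  by apply: subspaceP => //; apply: subspaceZ.
have := mJ hh; rewrite JP //; last exact: subspaceZ.
have h0 : SP 0 by apply: subspace0.
have i0 : io 0 = 0.
  have := ioL 0 h0 h0; rewrite !scale0r !addr0 => e.
  have := ioL 1 h0 h0; rewrite !scale1r !addr0 => /esym/eqP.
  by rewrite -subr_eq0 addrK => /eqP.
have L0 : L 0 = 0.
  have := LL 1 h0 h0; rewrite scale1r addr0 mul1r => /esym/eqP.
  by rewrite -subr_eq0 addrK => /eqP.
have ioh : io (2^-1%:C *: q) = 2^-1%:C *: io q.
  by rewrite -[_ *: q]addr0 ioL // i0 addr0.
have Lh : L (2^-1%:C *: q) = 2^-1%:C * L q.
  by rewrite -[_ *: q]addr0 LL // L0 addr0.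
rewrite ioh Lh nsqZ // ipZr // nsqB // sqmodC /J !ReImE /=; nra.
Qed.

(** The functional lives on a space P mapped to V by [io], because in [row_contraction] it is not
    known beforehand that L depends on [io p] alone; the bound by C implies it. The vector f0 is the
    limit of a sequence minimizing J(p) = |io p|^2 - 2 Re L p, which turns out to be |io p - f0|^2 -
    |f0|^2. *)
Lemma riesz : exists f0, [/\ hcl H (io @` SP) f0, hnsq H f0 <= C &
  forall p, SP p -> L p = ip (io p) f0].
Proof.
have hseq n : {p | SP p /\ J p < m + n.+1%:R^-1}.
  apply: cid; have [|x [p Sp <-] hx] := @inf_adherent _ E n.+1%:R^-1 _ Ehas.
    by rewrite invr_gt0.
  by exists p.
pose p n := sval (hseq n).
have Sp n : SP (p n) by case: (svalP (hseq n)).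
have Jp n : J (p n) - m < n.+1%:R^-1.
  by case: (svalP (hseq n)) => _ h; rewrite ltrBlDl.
have inv_small (e : R) : 0 < e -> exists n0 : nat, forall n, (n0 <= n)%N ->
    n.+1%:R^-1 < e.
  move=> e0; exists (Num.bound e^-1) => n hn.
  rewrite invf_plt ?posrE //; apply: lt_le_trans (archi_boundP _) _.
    by rewrite invr_ge0 ltW.
  by rewrite ler_nat; apply: leq_trans hn _.
have Iu n : S (io (p n)) by apply: ioS.
have [f0 Sf0 cf0] : exists2 f, S f & hcvg H (fun n => io (p n)) f.
  apply: hcauchy_cvg => // e e0.
  have e4 : 0 < e ^+ 2 / 4 by rewrite divr_gt0 // exprn_gt0.
  have [n0 hn0] := inv_small _ e4.
  exists n0 => a b ha hb; rewrite nrm_lt //.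
  move: (par (Sp a) (Sp b)) (Jp a) (Jp b) (hn0 _ ha) (hn0 _ hb).
  move: (J _) (J _) (hnsq H _) m (_.+1%:R^-1) (_.+1%:R^-1) => x y z k u v; lra.
have cl0 : hcl H (io @` SP) f0.
  apply: (hcvg_cl _ Sf0 _ cf0); first by move=> n; exists (p n).
  by move=> _ [q Sq <-]; apply: ioS.
have Lre q : SP q -> complex.Re (L q) = complex.Re (ip (io q) f0).
  move=> Sq; have Iq := ioS Sq.
  set d := complex.Re (ip (io q) f0) - complex.Re (L q).
  (* First variation: J(t q + p_n) is at least m while J(p_n) tends to m. A nonnegative quadratic in
     t without constant term has zero linear coefficient d. *)
  have key (t : R) : 0 <= t ^+ 2 * hnsq H (io q) + 2 * t * d.
    apply/ler_addgt0Pr => e e0.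
    have [n1 hn1] := inv_small (e / 2) ltac:(by rewrite divr_gt0).
    pose c := 4 * `|t| * (hnrm H (io q) + 1).
    have c0 : 0 <= c by rewrite !mulr_ge0 // addr_ge0 // nrm_ge0.
    have [n2 hn2] := cf0 (e / 2 / (c + 1)) ltac:(by rewrite !divr_gt0 // ltr_wpDl).
    pose n := maxn n1 n2.
    have h1 := hn1 n (leq_maxl _ _); have h2 := hn2 n (leq_maxr _ _).
    have := mJ (subspaceP sSP t%:C Sq (Sp n)); rewrite JP // sqmodC => h3.
    have h4 := Jp n.
    have rc : 2 * t * (complex.Re (ip (io q) (io (p n))) -
        complex.Re (ip (io q) f0)) <= e / 2.
      rewrite -ReN -ReD -ipBr //.
      apply: le_trans (ler_norm _) _; rewrite !normrM ger0_norm //.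
      have := cauchy_schwarz Iq (hsetB (Iu n) Sf0).
      rewrite -!nrm_sqr // => cs.
      have cs2 : `|complex.Re (ip (io q) (io (p n) - f0))| <=
         hnrm H (io q) * hnrm H (io (p n) - f0).
        apply: sqr_leW; first by rewrite mulr_ge0 ?nrm_ge0.
        by rewrite exprMn real_normK ?num_real //; apply: le_trans cs; rewrite lerDl sqr_ge0.
      have h5 : hnrm H (io (p n) - f0) * (c + 1) <= e / 2.
        by rewrite -ler_pdivlMr ?ltW // ltr_wpDl.
      have := nrm_ge0 H (io q); have := nrm_ge0 H (io (p n) - f0).
      have := normr_ge0 t; move: cs2 h5; rewrite /c.
      move: `|t| `|complex.Re _| (hnrm H (io q)) (hnrm H (io (p n) - f0)) => T X A B cs2 h5 T0 B0 A0.
      apply: le_trans (_ : 2 * T * (A * B) <= _); first by nra.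
      have p1 : 0 <= T * A * B by rewrite !mulr_ge0.
      have p2 : 0 <= T * B by rewrite mulr_ge0.
      by apply: le_trans h5; nra.
    have e1 : complex.Re (t%:C * ip (io q) (io (p n))) =
      t * complex.Re (ip (io q) (io (p n))) by rewrite !ReImE; ring.
    have e2 : complex.Re (t%:C * L q) = t * complex.Re (L q) by rewrite !ReImE; ring.
    rewrite e1 e2 in h3; rewrite /d; move: h1 h3 h4 rc; rewrite /J.
    by move: m (n.+1%:R^-1) => m0 v; lra.
  have n0 := nsq_ge0 Iq.
  suff : d = 0 by rewrite /d => /eqP; rewrite subr_eq0 => /eqP.
  (* The + 1 keeps the quotient meaningful when [io q] is 0. *)
  have := key (- d / (hnsq H (io q) + 1)).
  set N := hnsq H (io q) in n0 *.
  have N1 : N + 1 != 0 by apply: lt0r_neq0; rewrite ltr_wpDl.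
  have -> : (- d / (N + 1)) ^+ 2 * N + 2 * (- d / (N + 1)) * d =
     - ((d / (N + 1)) ^+ 2 * (N + 2)) by field.
  rewrite oppr_ge0 => h; apply/eqP.
  have : (d / (N + 1)) ^+ 2 * (N + 2) == 0.
    by rewrite eq_le h mulr_ge0 ?sqr_ge0 // addr_ge0.
  rewrite mulf_eq0 sqrf_eq0 mulf_eq0 invr_eq0 (negPf N1) orbF => /orP[//|/eqP]; lra.
have Lf q : SP q -> L q = ip (io q) f0.
  move=> Sq; have Iq := ioS Sq; apply: complex_ext; first exact: Lre.
  have h0 : SP 0 by apply: subspace0.
  have := Lre ('i *: q) (subspaceZ sSP _ Sq).
  rewrite -[_ *: q]addr0 ioL // LL //.
  have i0 : io 0 = 0.
    have := ioL 1 h0 h0; rewrite !scale1r !addr0 => /esym/eqP.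
    by rewrite -subr_eq0 addrK => /eqP.
  have L0 : L 0 = 0.
    have := LL 1 h0 h0; rewrite scale1r addr0 mul1r => /esym/eqP.
    by rewrite -subr_eq0 addrK => /eqP.
  rewrite i0 L0 !addr0 ipZl // !ReImE; lra.
exists f0; split=> //.
apply/ler_addgt0Pr => e e0.
have e1 : 0 < Num.sqrt e by rewrite sqrtr_gt0.
have [_ /(_ _ e1)[_ [q Sq <-] hq]] := cl0; have Iq := ioS Sq.
(* Now J(q) = |f0 - io q|^2 - |f0|^2, so J(q) >= -C bounds |f0|^2 by C + e. *)
have := Jlb Sq; rewrite /J Lf //.
move: hq; rewrite (nrm_lt (hsetB Sf0 Iq) e1) sqr_sqrtr; last exact: ltW.
rewrite (nsqB Sf0 Iq).
by rewrite [ip f0 (io q)](hip_conj Iq Sf0) ReJ; lra.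
Qed.

End riesz.

Section orthogonal.
Variables (R : realType) (V : lmodType R[i]) (H : hilbert V).

(** The vector f0 representing <., v> on A is the orthogonal projection of v to the closure of A; v
    - f0 lies in B and is orthogonal to A. *)
Lemma dense_orthogonal (A B : set V) : subspace A -> A `<=` B ->
  B `<=` hset H -> subspace B -> hcl H B `<=` B ->
  (forall g, B g -> (forall f, A f -> hip H f g = 0) -> g = 0) ->
  B `<=` hcl H A.
Proof.
move=> sA AB BS sB Bcl h v Bv; have Sv := BS _ Bv.
have AS : A `<=` hset H by move=> f /AB /BS.
have [||||f0 [cl0 _ hf0]] := @riesz _ _ H V A id (fun f => hip H f v) (hnsq H v) sA AS.
- by [].
- by move=> a p q Ap Aq; have Sp := AS _ Ap; have Sq := AS _ Aq; rewrite ipDl // ipZl.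
- exact: nsq_ge0.
- by move=> p Ap; rewrite mulrC; apply: cauchy_schwarz => //; apply: AS.
rewrite image_id in cl0.
have Bf0 : B f0 by apply: Bcl; apply: hcl_mono cl0.
have Sf0 := BS _ Bf0.
have : v - f0 = 0.
  apply: h; first exact: subspaceB.
  by move=> f Af; have Sf := AS _ Af; rewrite ipBr // hf0 // subrr.
by move=> /eqP; rewrite subr_eq0 => /eqP ->.
Qed.

End orthogonal.

Section complex_hilbert.
Variable R : realType.

Lemma real_complete (u : nat -> R) :
  (forall e : R, 0 < e -> exists n0 : nat, forall m n : nat,
     (n0 <= m)%N -> (n0 <= n)%N -> `|u m - u n| < e) ->
  exists l, forall e : R, 0 < e -> exists n0 : nat, forall n : nat,
     (n0 <= n)%N -> `|u n - l| < e.
Proof.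
move=> h.
have : cvg (u n @[n --> \oo]).
  apply/cauchy_cvgP/cauchy_exP => e e0.
  have [n0 hn0] := h e e0; exists (u n0).
  by exists n0 => // n /= hn; apply: hn0.
move=> /cvg_ex[l /cvgrPdist_lt hl]; exists l => e e0.
have [n0 _ hn0] := hl e e0; exists n0 => n hn.
by rewrite distrC; apply: hn0.
Qed.

Local Notation C := (R[i]^o).
Local Notation cip := (fun f g : C => f * Num.conj g : R[i]).

Let setT_subspace : subspace [set: C]. Proof. by []. Qed.

Let cip_linear (a : R[i]) (f g h : C) : [set: C] f -> [set: C] g -> [set: C] h ->
  cip (a *: f + g) h = a * cip f h + cip g h.
Proof. by move=> _ _ _ /=; rewrite mulrDl -scalerAl. Qed.

Let cip_conj (f g : C) : [set: C] f -> [set: C] g ->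
  cip g f = Num.conj (cip f g).
Proof. by move=> _ _; rewrite /= rmorphM /= conjCK mulrC. Qed.

Let cip_ge0 (f : C) : [set: C] f -> 0 <= cip f f.
Proof. by move=> _; apply: mul_conjC_ge0. Qed.

Let cip_eq0 (f : C) : [set: C] f -> cip f f = 0 -> f = 0.
Proof. by move=> _ /eqP; rewrite mul_conjC_eq0 => /eqP. Qed.

Let cip_complete (u : nat -> C) : (forall n, [set: C] (u n)) ->
    (forall e : R, 0 < e -> exists n0 : nat, forall m n : nat,
      (n0 <= m)%N -> (n0 <= n)%N ->
      Num.sqrt (complex.Re (cip (u m - u n) (u m - u n))) < e) ->
    exists2 f, [set: C] f & forall e : R, 0 < e -> exists n0 : nat, forall n : nat,
      (n0 <= n)%N -> Num.sqrt (complex.Re (cip (u n - f) (u n - f))) < e.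
Proof.
move=> _ h.
have E (z : C) : complex.Re (cip z z) = complex.Re z ^+ 2 + complex.Im z ^+ 2.
  by rewrite /= mulJ_sqmod.
have [a ha] : exists a, forall e : R, 0 < e -> exists n0 : nat, forall n : nat,
     (n0 <= n)%N -> `|complex.Re (u n) - a| < e.
  apply: real_complete => e e0; have [n0 hn0] := h e e0; exists n0 => m n hm hn.
  apply: le_lt_trans (hn0 m n hm hn).
  rewrite E -ReN -ReD -sqrtr_sqr; apply: ler_wsqrtr.
  by rewrite lerDl sqr_ge0.
have [b hb] : exists b, forall e : R, 0 < e -> exists n0 : nat, forall n : nat,
     (n0 <= n)%N -> `|complex.Im (u n) - b| < e.
  apply: real_complete => e e0; have [n0 hn0] := h e e0; exists n0 => m n hm hn.
  apply: le_lt_trans (hn0 m n hm hn).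
  rewrite E -ImN -ImD -sqrtr_sqr; apply: ler_wsqrtr.
  by rewrite lerDr sqr_ge0.
exists (a +i* b) => // e e0.
have [n1 hn1] := ha (e / 2) ltac:(by rewrite divr_gt0).
have [n2 hn2] := hb (e / 2) ltac:(by rewrite divr_gt0).
exists (maxn n1 n2) => n; rewrite geq_max => /andP[/hn1 h1 /hn2 h2].
rewrite E ReD ReN ImD ImN /=.
have e2 : 0 < e ^+ 2 by rewrite exprn_gt0.
rewrite -[ltRHS]ger0_norm ?(ltW e0) // -[ltRHS]sqrtr_sqr ltr_sqrt //.
move: h1 h2; rewrite !ltr_norml => /andP[h1 h1'] /andP[h2 h2'].
by move: (complex.Re _ - a) (complex.Im _ - b) h1 h1' h2 h2' => x y; nra.
Qed.

(** With C as a Hilbert space, [geometric_cvg] also serves for the scalar coefficients in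
    [closed_range]. *)
Definition complex_hilbert : hilbert C :=
  Hilbert setT_subspace cip_linear cip_conj cip_ge0 cip_eq0 cip_complete.

Lemma complex_hilbert_set z : hset complex_hilbert z.
Proof. by []. Qed.

Lemma complex_hilbert_nsq (z : C) : hnsq complex_hilbert z = sqmod z.
Proof. by rewrite /hnsq /= mulJ_sqmod. Qed.

End complex_hilbert.

#[local] Hint Resolve complex_hilbert_set : core.

(** * Baire category and closed ranges of finite codimension *)

Section geometric.
Variables (R : realType) (V : lmodType R[i]) (H : hilbert V) (M : set V).
Hypotheses (MS : M `<=` hset H) (Mcl : hcl H M `<=` M).

Lemma pow2_small (K e : R) : 0 <= K -> 0 < e -> exists n0 : nat,
  forall n, (n0 <= n)%N -> K / 2 ^+ n < e.
Proof.
move=> K0 e0; exists (Num.bound (K / e)) => n hn.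
rewrite ltr_pdivrMr ?exprn_gt0 // mulrC -ltr_pdivrMr //.
apply: lt_le_trans (archi_boundP _) _; first by rewrite divr_ge0 // ltW.
rewrite -natrX ler_nat; apply: leq_trans hn (ltnW _).
by rewrite ltn_expl.
Qed.

Lemma geometric_cvg (u : nat -> V) (K : R) : (forall n, M (u n)) -> 0 <= K ->
  (forall n, hnrm H (u n.+1 - u n) <= K / 2 ^+ n) ->
  exists2 F, M F & forall n, hnrm H (F - u n) <= 2 * K / 2 ^+ n.
Proof.
move=> Mu K0 h; have Su n : hset H (u n) by apply: MS.
have p2 n : 0 < (2 : R) ^+ n by rewrite exprn_gt0.
have hd n d : hnrm H (u (n + d)%N - u n) <= 2 * K / 2 ^+ n - 2 * K / 2 ^+ (n + d).
  elim: d => [|d IH]; first by rewrite addn0 !subrr nrm0.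
  rewrite addnS; apply: le_trans (nrm_triangle (Su _) (Su (n + d)%N) (Su _)) _.
  apply: le_trans (lerD (h _) IH) _; rewrite le_eqVlt; apply/orP; left.
  apply/eqP; rewrite exprS; field; by rewrite !lt0r_neq0.
have hd2 n m : (n <= m)%N -> hnrm H (u m - u n) <= 2 * K / 2 ^+ n.
  move=> nm; rewrite -(subnKC nm); apply: le_trans (hd _ _) _.
  by rewrite gerBl divr_ge0 // ?mulr_ge0 // ltW.
have [F SF cF] : exists2 F, hset H F & hcvg H u F.
  apply: hcauchy_cvg => // e e0.
  have [n0 hn0] := @pow2_small (2 * K) (e / 2) ltac:(by rewrite mulr_ge0)
    ltac:(by rewrite divr_gt0).
  exists n0 => m n hm hn; apply: le_lt_trans (nrm_triangle (Su _) (Su n0) (Su _)) _.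
  rewrite (nrm_distC (Su n0)) // [e]splitr; apply: ltrD.
    by apply: le_lt_trans (hd2 _ _ hm) _; apply: hn0.
  by apply: le_lt_trans (hd2 _ _ hn) _; apply: hn0.
exists F; first by apply: Mcl; apply: hcvg_cl cF.
move=> n; apply/ler_addgt0Pr => e e0; have [n0 hn0] := cF e e0.
have hn := hn0 (maxn n n0) (leq_maxr _ _).
apply: le_trans (nrm_triangle SF (Su (maxn n n0)) (Su n)) _.
rewrite addrC; apply: lerD; first by apply: hd2; apply: leq_maxl.
by rewrite nrm_distC // ltW.
Qed.

End geometric.

Section closed_range.
Variables (R : realType) (V : lmodType R[i]) (H : hilbert V) (M : set V).
Hypotheses (MS : M `<=` hset H) (Mcl : hcl H M `<=` M) (sM : subspace M).
Variables (T1 T2 : V -> V) (n : nat) (b : 'I_n -> V).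
Hypotheses
  (T1l : forall (a : R[i]) f g, T1 (a *: f + g) = a *: T1 f + T1 g)
  (T2l : forall (a : R[i]) f g, T2 (a *: f + g) = a *: T2 f + T2 g)
  (T1M : forall f, M f -> M (T1 f)) (T2M : forall f, M f -> M (T2 f))
  (T1c : forall f, M f -> hnrm H (T1 f) <= hnrm H f)
  (T2c : forall f, M f -> hnrm H (T2 f) <= hnrm H f).
Let L := [set v | exists f g, [/\ M f, M g & v = T1 f + T2 g]].
Hypothesis bL : quotient_basis M L b.
Local Notation CH := (complex_hilbert R).

(** A map from C^n x M x M onto M, since b spans M modulo L. Its openness is what makes L closed. *)
Let val (t : ('I_n -> R[i]^o) * V * V) : V :=
  \sum_(i < n) t.1.1 i *: b i + (T1 t.1.2 + T2 t.2).

Let small (r : R) (t : ('I_n -> R[i]^o) * V * V) : Prop :=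
  [/\ forall i, hnrm CH (t.1.1 i) <= r, M t.1.2, M t.2,
      hnrm H t.1.2 <= r & hnrm H t.2 <= r].

Let lin (a : R[i]) (t s : ('I_n -> R[i]^o) * V * V) : ('I_n -> R[i]^o) * V * V :=
  (fun i => a * t.1.1 i + s.1.1 i, a *: t.1.2 + s.1.2, a *: t.2 + s.2).

Let val_lin a t s : val (lin a t s) = a *: val t + val s.
Proof.
rewrite /val /lin /= T1l T2l !scalerDr scaler_sumr.
rewrite (eq_bigr (fun i => a *: (t.1.1 i *: b i) + s.1.1 i *: b i)); last first.
  by move=> i _; rewrite scalerA scalerDl.
by rewrite big_split /= (addrACA (a *: T1 _)) (addrACA (\sum_(i < n) a *: _)).
Qed.

Let nrmZD (W : lmodType R[i]) (HW : hilbert W) (a : R[i]) f g r1 r2 x :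
  hset HW f -> hset HW g -> sqmod a <= x ^+ 2 -> 0 <= x ->
  hnrm HW f <= r1 -> hnrm HW g <= r2 -> hnrm HW (a *: f + g) <= x * r1 + r2.
Proof.
move=> Sf Sg ax x0 h1 h2.
apply: le_trans (nrmD (hsetZ a Sf) Sg) _; apply: lerD => //.
have n0 := nrm_ge0 HW f; have r0 : 0 <= r1 by apply: le_trans h1.
apply: le_trans (_ : x * hnrm HW f <= _); last by rewrite ler_wpM2l.
apply: sqr_leW; first by rewrite mulr_ge0.
rewrite nrm_sqr // nsqZ // exprMn nrm_sqr //.
by apply: ler_wpM2r => //; apply: nsq_ge0.
Qed.

Let small_lin (a : R[i]) x r1 r2 t s : sqmod a <= x ^+ 2 -> 0 <= x ->
  small r1 t -> small r2 s -> small (x * r1 + r2) (lin a t s).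
Proof.
move=> ax x0 [t1 t2 t3 t4 t5] [s1 s2 s3 s4 s5]; split=> /=.
- by move=> i; apply: (@nrmZD _ CH) => //.
- exact: subspaceP.
- exact: subspaceP.
- by apply: nrmZD => //; apply: MS.
- by apply: nrmZD => //; apply: MS.
Qed.

Let bM i : M (b i). Proof. by case: bL. Qed.

Let valM r t : small r t -> M (val t).
Proof.
case=> _ Mf Mg _ _; apply: subspaceD => //.
  by apply: subspace_sum => // i _; apply: subspaceZ.
by apply: subspaceD => //; [apply: T1M|apply: T2M].
Qed.

Let A r := [set v | exists2 t, small r t & v = val t].

Let AM r : A r `<=` M.
Proof. by move=> _ [t st ->]; apply: valM st. Qed.

Let AS r : A r `<=` hset H.
Proof. by move=> v /AM /MS. Qed.

Let cover v : M v -> exists N : nat, A N%:R v.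
Proof.
move=> Mv; case: bL => _ /(_ v Mv)[c [f [g [Mf Mg e]]]] _.
pose r := \sum_(i < n) hnrm CH (c i) + hnrm H f + hnrm H g.
have s0 : 0 <= \sum_(i < n) hnrm CH (c i) by apply: sumr_ge0 => i _; apply: nrm_ge0.
have f0 := nrm_ge0 H f; have g0 := nrm_ge0 H g.
have hb : r <= (Num.bound r)%:R by apply: ltW; apply: archi_boundP; rewrite !addr_ge0.
exists (Num.bound r), (c, f, g); last first.
  by rewrite /val /= -e addrC subrK.
split=> //=; try by apply: le_trans hb; rewrite /r; lra.
move=> i; apply: le_trans hb; rewrite /r (bigD1 i) //=.
have : 0 <= \sum_(j < n | j != i) hnrm CH (c j) by apply: sumr_ge0 => j _; apply: nrm_ge0.
by lra.
Qed.

(** Otherwise nested balls could be chosen that avoid the sets A N one after another, and their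
    common point would lie in none of them, although by [cover] they exhaust M. *)
Let baire : exists (N : nat) x0 r, [/\ M x0, 0 < r &
  forall x, M x -> hnrm H (x - x0) < r -> hcl H (A N%:R) x].
Proof.
apply: contrapT => hno.
have step (N : nat) (y : V) (r : R) : M y -> 0 < r -> exists y' r',
    [/\ M y', 0 < r', r' <= r / 2, hnrm H (y' - y) + r' <= r &
     forall a, A N%:R a -> r' < hnrm H (y' - a)].
  move=> My r0; apply: contrapT => hstep; apply: hno; exists N, y, r; split=> //.
  move=> x Mx hx; split; first exact: MS.
  move=> e e0; apply: contrapT => he; apply: hstep.
  pose d := Num.min (e / 2) (Num.min (r / 2) (r - hnrm H (x - y))).
  exists x, d; split=> //.
  - by rewrite !lt_min !divr_gt0 //= subr_gt0.
  - by rewrite /d !ge_min lexx orbT.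
  - by rewrite addrC -lerBrDr /d !ge_min lexx !orbT.
  - move=> a Aa; apply: (@le_lt_trans _ _ (e / 2)); first by rewrite /d !ge_min lexx.
    apply: (@lt_le_trans _ _ e); first by lra.
    by rewrite leNgt; apply/negP => h; apply: he; exists a.
(* A state is (N, (centre, radius)), where A N is the set to be avoided next. The requirement is
   imposed only on balls of positive radius centred in M, so that every state has a successor. *)
pose P (s s' : nat * (V * R)) := s'.1 = s.1.+1 /\
  (M s.2.1 -> 0 < s.2.2 -> [/\ M s'.2.1, 0 < s'.2.2, s'.2.2 <= s.2.2 / 2,
     hnrm H (s'.2.1 - s.2.1) + s'.2.2 <= s.2.2 &
     forall a, A s.1%:R a -> s'.2.2 < hnrm H (s'.2.1 - a)]).
have tot s : {s' | P s s'}.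
  apply: cid; have [[h1 h2]|hn] := pselect (M s.2.1 /\ 0 < s.2.2).
    by have [y' [r' h]] := step s.1 _ _ h1 h2; exists (s.1.+1, (y', r')).
  by exists (s.1.+1, (0, 0)); split=> // h1 h2; case: hn.
have [F [F0 hF]] := dependent_choice tot (0%N, (0, 1)).
have F1 k : (F k).1 = k by elim: k => [|k IH]; rewrite ?F0 //; case: (hF k) => -> _; rewrite IH.
pose y k := (F k).2.1; pose r k := (F k).2.2.
have inv k : M (y k) /\ 0 < r k.
  elim: k => [|k [h1 h2]].
    by rewrite /y /r F0 /=; split=> //; apply: subspace0.
  by case: (hF k) => _ /(_ h1 h2)[].
have My k : M (y k) by case: (inv k).
have r0 k : 0 < r k by case: (inv k).
have st k : [/\ r k.+1 <= r k / 2, hnrm H (y k.+1 - y k) + r k.+1 <= r k &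
     forall a, A k%:R a -> r k.+1 < hnrm H (y k.+1 - a)].
  by case: (hF k) => _ /(_ (My k) (r0 k))[_ _]; rewrite F1.
have rk k : r k <= 1 / 2 ^+ k.
  elim: k => [|k IH]; first by rewrite /r F0 expr0 divr1.
  case: (st k) => h _ _; apply: le_trans h _; rewrite exprS invfM mulrCA.
  by rewrite [2^-1 * _]mulrC ler_wpM2r.
have [x Mx hx] : exists2 x, M x & forall k, hnrm H (x - y k) <= 2 * 1 / 2 ^+ k.
  apply: (geometric_cvg MS) => // k; apply: le_trans (rk k).
  by case: (st k) => _ h _; apply: le_trans h; rewrite lerDl ltW.
have Sy k : hset H (y k) by apply: MS.
have near k d : hnrm H (y (k + d)%N - y k) + r (k + d)%N <= r k.
  elim: d => [|d IH]; first by rewrite addn0 subrr nrm0 add0r.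
  rewrite addnS; case: (st (k + d)%N) => _ h _.
  by have := nrm_triangle (Sy (k + d).+1) (Sy (k + d)%N) (Sy k); lra.
have Sx := MS Mx.
have nearx k : hnrm H (x - y k) <= r k.
  apply/ler_addgt0Pr => e e0.
  have [n0 hn0] := @pow2_small _ (2 * 1) e ltac:(by []) e0.
  have h1 := hx (k + n0)%N; have h2 := hn0 (k + n0)%N (leq_addl _ _).
  have h3 := near k n0; have h4 := nrm_triangle Sx (Sy (k + n0)%N) (Sy k).
  by have := r0 (k + n0)%N; lra.
have [N AN] := cover Mx.
case: (st N) => _ _ /(_ x AN); rewrite nrm_distC //.
by rewrite ltNge nearx.
Qed.

Let almost_open : exists2 k : R, 0 <= k & forall s x, 0 < s -> M x -> hnrm H x < s ->
  forall e, 0 < e -> exists2 t, small (k * s) t & hnrm H (x - val t) < e.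
Proof.
have [N [x0 [r [Mx0 r0 hr]]]] := baire.
(* If |x| < s, then x0 and x0 + (r/s) x both lie in the ball. Their approximants come from triples
   of size N; the difference of these, scaled by s/r, approximates x. *)
exists (2 * N%:R / r); first by rewrite divr_ge0 ?mulr_ge0 // ltW.
move=> s x s0 Mx hx e e0.
have sr : 0 < r / s by rewrite divr_gt0.
have Sx0 := MS Mx0; have Sx := MS Mx.
pose e' := e * (r / s) / 2.
have e'0 : 0 < e' by rewrite divr_gt0 // mulr_gt0.
have [_ /(_ _ e'0)[_ [t st ->] ht]] : hcl H (A N%:R) ((r / s)%:C *: x + x0).
  apply: hr; first exact: subspaceP.
  rewrite addrK nrmZ ?(ltW sr) // mulrAC ltr_pdivrMr //.
  by rewrite ltr_pM2l.
have [_ /(_ _ e'0)[_ [t' st' ->] ht']] : hcl H (A N%:R) x0.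
  by apply: hr => //; rewrite subrr nrm0.
(* [lin] is a t + s; the difference t - t plays the zero triple when only scaling is wanted. *)
have zero_small : small 0 (lin (-1) t t).
  case: st => [t1 t2 t3 t4 t5]; split=> /=.
  - by move=> i; rewrite mulN1r addNr nrm0.
  - by rewrite scaleN1r addNr; apply: subspace0.
  - by rewrite scaleN1r addNr; apply: subspace0.
  - by rewrite scaleN1r addNr nrm0.
  - by rewrite scaleN1r addNr nrm0.
exists (lin (s / r)%:C (lin (-1) t' t) (lin (-1) t t)).
  have -> : 2 * N%:R / r * s = (s / r) * (1 * N%:R + N%:R) + 0.
    by field; rewrite lt0r_neq0.
  apply: small_lin => //; first by rewrite sqmodC.
    by rewrite divr_ge0 // ltW.
  by apply: small_lin => //; rewrite sqmodN sqmod1 expr1n.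
have St := AS (ex_intro2 _ _ t st erefl); have St' := AS (ex_intro2 _ _ t' st' erefl).
rewrite !val_lin !scaleN1r addNr addr0.
have sr0 : 0 < s / r by rewrite divr_gt0.
have -> : x - (s / r)%:C *: (- val t' + val t) =
   (s / r)%:C *: (((r / s)%:C *: x + x0 - val t) - (x0 - val t')).
  have -> : (r / s)%:C *: x + x0 - val t - (x0 - val t') =
     (r / s)%:C *: x - (- val t' + val t).
    exact: zmod_cancel1.
  rewrite scalerBr scalerA -rmorphM /=.
  have -> : s / r * (r / s) = 1 by field; rewrite !lt0r_neq0.
  by rewrite scale1r.
rewrite nrmZ ?(ltW sr0) //.
have h := nrmB (hsetB (hsetD (hsetZ (r / s)%:C Sx) Sx0) St) (hsetB Sx0 St').
apply: (@lt_le_trans _ _ (s / r * (e' + e'))).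
  by rewrite ltr_pM2l //; apply: le_lt_trans h _; apply: ltrD.
rewrite le_eqVlt; apply/orP; left; apply/eqP; rewrite /e'; field.
by rewrite !lt0r_neq0.
Qed.

(** The second half of the open mapping theorem: errors are corrected at the scales s / 2^j and
    completeness sums the corrections, at the price of a factor 2. *)
Let coords s x : 0 < s -> M x -> hnrm H x < s -> forall k : R, 0 <= k ->
  (forall s x, 0 < s -> M x -> hnrm H x < s ->
    forall e, 0 < e -> exists2 t, small (k * s) t & hnrm H (x - val t) < e) ->
  exists2 t, small (2 * k * s) t & x = val t.
Proof.
move=> s0 Mx hx k k0 open.
pose sj j := s / 2 ^+ j.
have p2 j : 0 < (2 : R) ^+ j by rewrite exprn_gt0.
have sj0 j : 0 < sj j by rewrite divr_gt0.
have [F hF] : exists F : nat * V -> ('I_n -> R[i]^o) * V * V, forall jy,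
    M jy.2 -> hnrm H jy.2 < sj jy.1 -> small (k * sj jy.1) (F jy) /\
      hnrm H (jy.2 - val (F jy)) < sj jy.1.+1.
  suff /choice[F hF] : forall jy : nat * V, exists t,
      M jy.2 -> hnrm H jy.2 < sj jy.1 -> small (k * sj jy.1) t /\
      hnrm H (jy.2 - val t) < sj jy.1.+1 by exists F.
  move=> [j y] /=; have [[h1 h2]|hn] := pselect (M y /\ hnrm H y < sj j).
    by have [t t1 t2] := open _ _ (sj0 j) h1 h2 _ (sj0 j.+1); exists t.
  by exists (fun=> 0, 0, 0) => h1 h2; case: hn.
(* y j is what remains of x after j corrections; [part j] below is the sum of these corrections. *)
pose y := fix y j := if j is j'.+1 then y j' - val (F (j', y j')) else x.
have inv j : M (y j) /\ hnrm H (y j) < sj j.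
  elim: j => [|j [h1 h2]] /=; first by rewrite /sj expr0 divr1.
  have [h3 h4] := hF (j, y j) h1 h2; split=> //.
  by apply: subspaceB => //; apply: valM h3.
pose f j := F (j, y j).
have sf j : small (k * sj j) (f j) by case: (inv j) => h1 h2; case: (hF (j, y j) h1 h2).
pose part := fix part j : ('I_n -> R[i]^o) * V * V :=
  if j is j'.+1 then lin 1 (f j') (part j') else (fun=> 0, 0, 0).
have xpart j : x = y j + val (part j).
  elim: j => [|j IH] /=.
    rewrite /val big1 ?add0r; last by move=> i _; rewrite scale0r.
    have T10 : T1 0 = 0.
      have := T1l 1 0 0; rewrite !scale1r !addr0 => /esym/eqP.
      by rewrite -subr_eq0 addrK => /eqP.
    have T20 : T2 0 = 0.
      have := T2l 1 0 0; rewrite !scale1r !addr0 => /esym/eqP.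
      by rewrite -subr_eq0 addrK => /eqP.
    by rewrite T10 T20 !addr0.
  by rewrite val_lin scale1r addrA -/(f j) subrK.
have K0 : 0 <= k * s by rewrite mulr_ge0 // ltW.
have partM j : M (part j).1.2 /\ M (part j).2.
  elim: j => [|j [h1 h2]] /=; first by split; apply: subspace0.
  by case: (sf j) => _ m1 m2 _ _; split; apply: subspaceP.
have [G1 MG1 hG1] : exists2 F, M F & forall j, hnrm H (F - (part j).1.2) <= 2 * (k * s) / 2 ^+ j.
  apply: (geometric_cvg MS Mcl) => // [j|j]; first by case: (partM j).
  by rewrite /= scale1r addrK; case: (sf j) => _ _ _ h _; rewrite -mulrA.
have [G2 MG2 hG2] : exists2 F, M F & forall j, hnrm H (F - (part j).2) <= 2 * (k * s) / 2 ^+ j.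
  apply: (geometric_cvg MS Mcl) => // [j|j]; first by case: (partM j).
  by rewrite /= scale1r addrK; case: (sf j) => _ _ _ _ h; rewrite -mulrA.
have /choice[c hc] : forall i, exists c : R[i]^o, forall j,
    hnrm CH (c - (part j).1.1 i) <= 2 * (k * s) / 2 ^+ j.
  move=> i; have hstep j : hnrm CH ((part j.+1).1.1 i - (part j).1.1 i) <= k * s / 2 ^+ j.
    by rewrite /= mul1r addrK; case: (sf j) => h _ _ _ _; rewrite -mulrA.
  have [F0 _ hF0] := @geometric_cvg _ _ CH setT (fun _ _ => I) (fun _ _ => I)
    (fun j => (part j).1.1 i) (k * s) (fun=> I) K0 hstep.
  by exists F0.
have sm0 : small (2 * k * s) (c, G1, G2).
  split=> //=.
  - by move=> i; have := hc i 0%N; rewrite /= subr0 expr0 divr1 mulrA.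
  - by have := hG1 0%N; rewrite /= subr0 expr0 divr1 mulrA.
  - by have := hG2 0%N; rewrite /= subr0 expr0 divr1 mulrA.
exists (c, G1, G2) => //; apply/eqP; rewrite -subr_eq0; apply/eqP.
have Md : M (x - val (c, G1, G2)) by apply: subspaceB => //; apply: valM sm0.
apply: (nsq_eq0 (MS Md)); rewrite -nrm_sqr; last exact: MS.
suff : hnrm H (x - val (c, G1, G2)) <= 0.
  by have := nrm_ge0 H (x - val (c, G1, G2)); nra.
apply/ler_addgt0Pr => e e0; rewrite add0r.
(* At stage j the error is a remainder below s / 2^j plus the image of the three tails, each at most
   2 k s / 2^j: the coefficients contribute the factor sum |b_i|, and the contractions T1 and T2 the
   factor 2. *)
pose B := s + 2 * (k * s) * (\sum_(i < n) hnrm H (b i) + 2).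
have B0 : 0 <= B.
  have sb0 : 0 <= \sum_(i < n) hnrm H (b i) by apply: sumr_ge0 => i _; apply: nrm_ge0.
  apply: addr_ge0; first exact: ltW.
  by apply: mulr_ge0; [rewrite mulr_ge0|rewrite addr_ge0].
have [j0 hj0] := pow2_small B0 e0.
have [j hj] : exists j, j = j0 by exists j0.
apply: le_trans (ltW (hj0 j _)); last by rewrite hj.
have -> : x - val (c, G1, G2) = y j + val (lin (-1) (c, G1, G2) (part j)).
  by rewrite val_lin scaleN1r {1}(xpart j) addrAC -addrA.
case: (inv j) => My hy.
set q := lin _ _ _.
have hq1 i : hnrm CH (q.1.1 i) <= 2 * (k * s) / 2 ^+ j.
  by rewrite /= mulN1r addrC nrm_distC.
have [P1 P2] := partM j.
have hq2 : hnrm H q.1.2 <= 2 * (k * s) / 2 ^+ j.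
  rewrite /= scaleN1r addrC nrm_distC; [exact: hG1|exact: MS|exact: MS].
have hq3 : hnrm H q.2 <= 2 * (k * s) / 2 ^+ j.
  rewrite /= scaleN1r addrC nrm_distC; [exact: hG2|exact: MS|exact: MS].
have Mq1 : M q.1.2 by rewrite /=; apply: subspaceP.
have Mq2 : M q.2 by rewrite /=; apply: subspaceP.
clearbody q.
have Sb i : hset H (b i) by apply: MS; apply: bM.
have St1 := MS (T1M Mq1); have St2 := MS (T2M Mq2).
set E := 2 * (k * s) / 2 ^+ j in hq1 hq2 hq3.
have E0 : 0 <= E by rewrite /E divr_ge0 ?mulr_ge0 // ltW.
have hsum : hnrm H (\sum_(i < n) q.1.1 i *: b i) <= E * \sum_(i < n) hnrm H (b i).
  rewrite mulr_sumr.
  apply: (@big_ind2 _ _ (fun v r => hset H v /\ hnrm H v <= r)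
    0 +%R 0 +%R _ _ _ _ _ _ _ _).2 => //.
  - by rewrite nrm0.
  - move=> u r u' r' [Su hu] [Su' hu']; split=> //.
    by apply: le_trans (nrmD Su Su') _; apply: lerD.
  - move=> i _; split=> //.
    apply: sqr_leW; first by rewrite mulr_ge0 ?nrm_ge0.
    rewrite nrm_sqr // nsqZ // exprMn nrm_sqr //.
    apply: ler_wpM2r; first exact: nsq_ge0.
    rewrite -complex_hilbert_nsq -nrm_sqr //.
    by have := hq1 i; have := nrm_ge0 CH (q.1.1 i); nra.
have Ssum : hset H (\sum_(i < n) q.1.1 i *: b i).
  by apply: (subspace_sum (hsub H)) => i _.
have h1 := T1c Mq1; have h2 := T2c Mq2.
have h3 := nrmD (MS My) (hsetD Ssum (hsetD St1 St2)).
have h4 := nrmD Ssum (hsetD St1 St2).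
have h5 := nrmD St1 St2.
have -> : B / 2 ^+ j = sj j + E * (\sum_(i < n) hnrm H (b i)) + E + E.
  by rewrite /B /sj /E; field; rewrite lt0r_neq0.
rewrite /val; lra.
Qed.

(** If l in L is close to v, openness writes v - l with small coordinates on b. Since b is
    independent modulo L, these are the coordinates of v itself, which are therefore 0. *)
Lemma closed_range : hcl H L `<=` L.
Proof.
move=> v [Sv clv].
have sT (T : V -> V) : (forall (a : R[i]) f g, T (a *: f + g) = a *: T f + T g) -> T 0 = 0.
  move=> Tl; have := Tl 1 0 0; rewrite !scale1r !addr0 => /esym/eqP.
  by rewrite -subr_eq0 addrK => /eqP.
have LM : L `<=` M.
  by move=> _ [f [g [Mf Mg ->]]]; apply: subspaceD => //; [apply: T1M|apply: T2M].
have Mv : M v.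
  apply: Mcl; split=> // e e0; have [a La ha] := clv e e0.
  by exists a => //; apply: LM.
have sL : subspace L.
  split; first by exists 0, 0; split; rewrite ?(sT T1 T1l) ?(sT T2 T2l) ?addr0 //; apply: subspace0.
  move=> a _ _ [f [g [Mf Mg ->]]] [f' [g' [Mf' Mg' ->]]].
  exists (a *: f + f'), (a *: g + g'); split; try exact: subspaceP.
  by rewrite T1l T2l scalerDr addrACA.
have [k k0 open] := almost_open.
case: bL => _ /(_ v Mv)[c hc] uniq.
suff c0 : forall i, c i = 0.
  by move: hc; rewrite big1 ?subr0 // => i _; rewrite c0 scale0r.
move=> i; apply: sqmod_eq0.
rewrite -complex_hilbert_nsq -nrm_sqr //.
suff : hnrm CH (c i : R[i]^o) <= 0 by have := nrm_ge0 CH (c i : R[i]^o); nra.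
apply/ler_addgt0Pr => e e0; rewrite add0r.
(* Chosen so that 2 k s <= e; the + 1 covers k = 0. *)
pose s := e / (2 * k + 1).
have k1 : 0 < 2 * k + 1 by rewrite ltr_wpDl // mulr_ge0.
have s0 : 0 < s by rewrite divr_gt0.
have [l Ll hl] := clv s s0.
have [t st xt] := coords s0 (subspaceB sM Mv (LM _ Ll)) hl k0 open.
have ct : c i = t.1.1 i.
  apply/eqP; rewrite -subr_eq0; apply/eqP.
  apply: (uniq (fun i => c i - t.1.1 i)).
  under eq_bigr => j _ do rewrite scalerBl.
  rewrite sumrB.
  have -> : \sum_(j < n) c j *: b j - \sum_(j < n) t.1.1 j *: b j =
     - (v - \sum_(j < n) c j *: b j) + (l + (T1 t.1.2 + T2 t.2)).
    have -> : v = l + val t by rewrite -xt addrCA subrr addr0.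
    exact: zmod_cancel2.
  apply: subspaceD => //; first exact: subspaceN.
  apply: subspaceD => //; case: st => _ m1 m2 _ _.
  by exists t.1.2, t.2.
rewrite ct; case: st => h _ _ _ _; apply: le_trans (h i) _.
have es : e = s * (2 * k + 1) by rewrite /s divfK // lt0r_neq0.
by rewrite es; nra.
Qed.

End closed_range.

(** * Dimensions of quotients *)

Section quotient_dimension.
Variables (K : fieldType) (V : lmodType K).
Implicit Types (M L : set V) (I J : finType).

Definition spans_mod M L I (b : I -> V) :=
  forall v, M v -> exists c : I -> K, L (v - \sum_i c i *: b i).

Definition indep_mod L I (u : I -> V) :=
  forall c : I -> K, L (\sum_i c i *: u i) -> forall i, c i = 0.

Lemma spans_mod_basis M L I (b : I -> V) : subspace L ->
  (forall i, M (b i)) -> spans_mod M L b ->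
  exists n (b' : 'I_n -> V), (n <= #|I|)%N /\ quotient_basis M L b'.
Proof.
move=> sL Mb sb.
pose P n := `[< exists b' : 'I_n -> V, (forall i, M (b' i)) /\ spans_mod M L b' >].
have PI : P #|I|.
  apply/asboolP; exists (fun i => b (enum_val i)); split=> // v Mv.
  have [c hc] := sb v Mv; exists (fun i => c (enum_val i)).
  suff <- : \sum_i c i *: b i =
    \sum_(i < #|I|) c (enum_val i) *: b (enum_val i) by [].
  by rewrite -(big_enum_val (A := I) (fun i => c i *: b i)).
have exP : exists n, P n by exists #|I|.
have [n /asboolP[b' [Mb' sb']] nmin] := ex_minnP exP.
exists n, b'; split; first exact: nmin.
split=> // c Lc i0; apply: contrapT => /eqP ci0.
case: n => [|n] in b' Mb' sb' nmin c Lc i0 ci0 *; first by case: i0 ci0.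
suff /nmin : P n by rewrite ltnn.
apply/asboolP; exists (fun j => b' (lift i0 j)); split=> // v Mv.
have [d hd] := sb' v Mv.
(* Subtracting d i0 / c i0 times the relation c eliminates b' i0. *)
exists (fun j => d (lift i0 j) - d i0 / c i0 * c (lift i0 j)).
have := subspaceP sL (d i0 / c i0) Lc hd.
rewrite !(bigD1_ord i0) //= scalerDr scalerA divfK // scaler_sumr.
under [X in _ -> L (v - X)]eq_bigr => j _ do rewrite scalerBl -scalerA.
by rewrite sumrB zmod_cancel3.
Qed.

Lemma quotient_basis_max M L n (b : 'I_n -> V) J (u : J -> V) : subspace L ->
  quotient_basis M L b -> (forall j, M (u j)) -> indep_mod L u -> (#|J| <= n)%N.
Proof.
move=> sL [Mb sb _] Mu iu; rewrite leqNgt; apply/negP => hn.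
have /choice[c hc] : forall j, exists c : 'I_n -> K, L (u j - \sum_(i < n) c i *: b i).
  by move=> j; apply: sb.
pose A : 'M[K]_(#|J|, n) := \matrix_(j, i) c (enum_val j) i.
have : kermx A != 0.
  rewrite kermx_eq0 /row_free neq_ltn; apply/orP; left.
  by apply: leq_ltn_trans (rank_leq_col A) hn.
case/rowV0Pn => v /sub_kermxP vA; case/negP.
apply/eqP/rowP => k; rewrite mxE.
have := iu (fun j => v 0 (enum_rank j)) _ (enum_val k).
rewrite enum_valK; apply.
have -> : \sum_j v 0 (enum_rank j) *: u j =
    \sum_j v 0 (enum_rank j) *: (u j - \sum_(i < n) c j i *: b i).
  under [RHS]eq_bigr => j _ do rewrite scalerBr scaler_sumr.
  rewrite sumrB exchange_big /= [X in _ - X]big1 ?subr0 // => i _.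
  under eq_bigr => j _ do rewrite scalerA.
  rewrite -scaler_suml.
  have := congr1 (fun m : 'rV_n => m 0 i) vA; rewrite !mxE.
  rewrite (reindex_onto (@enum_rank J) enum_val) /=; last by move=> k' _; rewrite enum_valK.
  under eq_bigl => j do rewrite enum_rankK eqxx.
  under eq_bigr => j _ do rewrite mxE enum_rankK.
  by move=> ->; rewrite scale0r.
by apply: subspace_sum => // j _; apply: subspaceZ.
Qed.

(** A basis of M modulo L + span u is, together with u, independent modulo L, so the two sizes add
    up to at most the dimension of M modulo L. *)
Lemma steinitz M L I J (b : I -> V) (u : J -> V) : subspace L ->
  (forall i, M (b i)) -> spans_mod M L b ->
  (forall j, M (u j)) -> indep_mod L u ->
  exists n (b' : 'I_n -> V), [/\ (n + #|J| <= #|I|)%N, forall i, M (b' i) &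
    forall v, M v -> exists (c : 'I_n -> K) (d : J -> K),
      L (v - \sum_i c i *: b' i - \sum_j d j *: u j)].
Proof.
move=> sL Mb sb Mu iu.
pose L' := [set v | exists d : J -> K, L (v - \sum_j d j *: u j)].
have LL' v : L v -> L' v.
  by move=> Lv; exists (fun=> 0); rewrite big1 ?subr0 // => j _; rewrite scale0r.
have sL' : subspace L'.
  split; first by apply: LL'; apply: subspace0 sL.
  move=> a v w [d hd] [d' hd']; exists (fun j => a * d j + d' j).
  under eq_bigr => j _ do rewrite scalerDl -scalerA.
  rewrite big_split /= -scaler_sumr opprD addrACA -scalerBr.
  exact: subspaceP.
have sb2 : spans_mod M L' b by move=> v /sb[c hc]; exists c; apply: LL'.
have [n [b' [_ [Mb' sb' ib']]]] := spans_mod_basis sL' Mb sb2.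
exists n, b'; split=> //.
have [n0 [b0 [hn0 bb0]]] := spans_mod_basis sL Mb sb.
apply: leq_trans hn0.
pose w (x : 'I_n + J) := match x with inl i => b' i | inr j => u j end.
have -> : (n + #|J|)%N = #|{: 'I_n + J}| by rewrite card_sum card_ord.
apply: (@quotient_basis_max M L n0 b0 _ w) => //; first by case.
move=> c; rewrite big_sumType /= => hc.
have ci i : c (inl i) = 0.
  apply: (ib' (fun i => c (inl i))); exists (fun j => - c (inr j)).
  by under [X in _ - X]eq_bigr => j _ do rewrite scaleNr; rewrite sumrN opprK.
have cj j : c (inr j) = 0.
  apply: (iu (fun j => c (inr j))).
  by move: hc; rewrite big1 ?add0r // => i _; rewrite ci scale0r.
by case.
Qed.

End quotient_dimension.

Section quotient_dim.
Variables (R : realType) (K : fieldType) (V : lmodType K).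

Lemma quotient_dim_basis (M L : set V) n (b : 'I_n -> V) : subspace L ->
  quotient_basis M L b -> quotient_dim R M L = n%:R%:E.
Proof.
move=> sL bb; rewrite /quotient_dim.
suff -> : [set n : nat | exists b : 'I_n -> V, quotient_basis M L b] = [set n].
  by rewrite image_set1 ereal_inf1.
apply/seteqP; split=> [m [b' bb']|_ ->] /=; last by exists b.
have h1 : (m <= n)%N.
  rewrite -[m]card_ord; case: (bb') => Mb' _ ib'.
  exact: (quotient_basis_max sL bb Mb').
have h2 : (n <= m)%N.
  rewrite -[n]card_ord; case: (bb) => Mb _ ib.
  exact: (quotient_basis_max sL bb' Mb).
by apply/eqP; rewrite eqn_leq h1.
Qed.

Lemma quotient_dim_fin (M L : set V) : (quotient_dim R M L < +oo)%E ->
  exists n (b : 'I_n -> V), quotient_basis M L b.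
Proof.
move=> h; apply: contrapT => hn.
move: h; rewrite /quotient_dim.
suff -> : [set n : nat | exists b : 'I_n -> V, quotient_basis M L b] = set0.
  by rewrite image_set0 ereal_inf0 ltxx.
by rewrite -subset0 => n [b hb]; apply: hn; exists n, b.
Qed.

End quotient_dim.

(** * Order of vanishing of bivariate polynomials *)

Section order_poly.

Definition vanish_poly (A : nzRingType) (k : nat) (P : {poly A}) : Prop :=
  forall m, (m < k)%N -> P`_m = 0.

(** Lowest coefficients multiply over a domain: once P has no terms below degree m, the coefficient
    of degree m + s in P Q is P_m Q_s. *)
Lemma vanish_polyM (A : idomainType) (k s : nat) (P Q : {poly A}) :
  vanish_poly s Q -> Q`_s != 0 -> vanish_poly k (P * Q) ->
  vanish_poly (k - s) P.
Proof.
move=> vQ Qs vPQ; elim/ltn_ind => m IH hm.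
have hms : (m + s < k)%N by lia.
have := vPQ _ hms; rewrite coefM.
have hm1 : (m < (m + s).+1)%N by lia.
rewrite (bigD1 (Ordinal hm1)) //= addKn big1 ?addr0; last first.
  move=> i; rewrite -val_eqE /= => im.
  have [lim|] := ltnP i m; first by rewrite IH ?mul0r //; lia.
  move=> mi; rewrite vQ ?mulr0 //; have := ltn_ord i; lia.
by move=> /eqP; rewrite mulf_eq0 (negPf Qs) orbF => /eqP.
Qed.

End order_poly.

Section bivariate.
Variable K : fieldType.
Local Notation P := {poly {poly K}}.
Implicit Types (p q : P) (r : {poly K}).

Definition blowup_coef (q : {poly K}) : P :=
  (map_poly (polyC \o polyC) q).['X * 'Y].

(* [blowup p] is p(z, zu), a polynomial in z over K[u]; its order in z is the
   order of vanishing of p at the origin. *)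
Definition blowup p : P := (map_poly
  (horner_eval ('X * 'Y : P) \o map_poly (polyC \o (@polyC K))) p).['X].

Lemma blowupD p q : blowup (p + q) = blowup p + blowup q.
Proof. by rewrite /blowup rmorphD hornerD. Qed.

Lemma blowupM p q : blowup (p * q) = blowup p * blowup q.
Proof. by rewrite /blowup rmorphM hornerM. Qed.

Lemma blowupX : blowup 'X = 'X.
Proof. by rewrite /blowup map_polyX hornerX. Qed.

Lemma blowupC r : blowup r%:P = blowup_coef r.
Proof. by rewrite /blowup map_polyC hornerC. Qed.

Lemma blowup_coefD r r' : blowup_coef (r + r') = blowup_coef r + blowup_coef r'.
Proof. by rewrite /blowup_coef rmorphD hornerD. Qed.

Lemma blowup_coefMX r : blowup_coef (r * 'X) = blowup_coef r * ('X * 'Y).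
Proof. by rewrite /blowup_coef rmorphM hornerM /= map_polyX hornerX. Qed.

Lemma blowup_coefC c : blowup_coef c%:P = c%:P%:P.
Proof. by rewrite /blowup_coef map_polyC hornerC. Qed.

Lemma blowup_coef0 : blowup_coef 0 = 0.
Proof. by rewrite /blowup_coef rmorph0 horner0. Qed.

Lemma blowup0 : blowup 0 = 0.
Proof. by rewrite /blowup rmorph0 horner0. Qed.

Lemma blowup_horner p (t u : K) : (blowup p).[t, u] = p.[t, t * u].
Proof.
have h r : (blowup_coef r).[t, u] = r.[t * u].
  elim/poly_ind: r => [|r c IH]; first by rewrite blowup_coef0 !horner0.
  rewrite blowup_coefD blowup_coefMX blowup_coefC !hornerD !hornerM IH.
  by rewrite !(hornerC, hornerX).
elim/poly_ind: p => [|p c IH]; first by rewrite blowup0 !horner0.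
rewrite blowupD blowupM blowupC blowupX !hornerD !hornerM IH h.
by rewrite !(hornerC, hornerX).
Qed.

Lemma coef_blowup p m j :
  (blowup p)`_m`_j = if (j <= m)%N then p`_(m - j)`_j else 0.
Proof.
have h r m' j' : (blowup_coef r)`_m'`_j' = if j' == m' then r`_j' else 0.
  elim/poly_ind: r m' j' => [|r c IH] m' j'.
    by rewrite blowup_coef0 !coef0 if_same.
  rewrite blowup_coefD blowup_coefMX blowup_coefC !coefD mulrA coefMC coefMX.
  rewrite coefMX coefC coefMX coefC.
  case: m' => [|m']; case: j' => [|j'] /=; rewrite ?coefC ?coef0 /= ?add0r ?addr0 ?IH ?eqSS ?if_same //.
elim/poly_ind: p m j => [|p c IH] m j.
  by rewrite blowup0 !coef0 if_same.
rewrite blowupD blowupM blowupC blowupX !coefD coefMX h.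
rewrite [in RHS]coefMX coefC.
case: m => [|m] /=.
  by rewrite coef0 leqn0 !add0r; case: eqP => // _; rewrite ?coef0.
rewrite IH; have [jm|] := leqP j m.
  rewrite (leqW jm) subSn // /= [in X in _ + X]ifN; last by lia.
  by rewrite coef0.
move=> jm; have [->|jm2] := eqVneq j m.+1.
  by rewrite leqnn subnn eqxx coef0 !add0r.
by rewrite [in RHS]ifN ?addr0 //; lia.
Qed.

Definition mono (a b : nat) : P := 'X ^+ a * ('X ^+ b)%:P.

Lemma coef_mono a b i j : (mono a b)`_i`_j = ((i == a) && (j == b))%:R.
Proof.
rewrite /mono coefMC coefXn; case: eqP => _; last by rewrite mul0r coef0.
by rewrite mul1r coefXn.
Qed.

Definition jet0 k p : Prop := forall i j, (i + j < k)%N -> p`_i`_j = 0.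

(** The coefficient of z^m in p(z, zu) is the homogeneous part of degree m evaluated at (1, u).
    Total degree thus becomes the degree in one variable over the domain K[u], where orders add
    under products. *)
Lemma jet0_blowup k p : jet0 k p <-> vanish_poly k (blowup p).
Proof.
split=> [h m mk|h i j ijk].
  apply/polyP => j; rewrite coef_blowup coef0; case: leqP => // jm.
  by apply: h; lia.
have := h _ ijk => /(congr1 (fun q : {poly K} => q`_j)).
by rewrite coef_blowup coef0 leq_addl addnK.
Qed.

(** The terms divisible by z go to a; those in w alone have no constant term and go to b. *)
Lemma jet0_step k p : jet0 k.+1 p ->
  exists a b, [/\ jet0 k a, jet0 k b & p = a * 'X + b * 'Y].
Proof.
elim/poly_ind: p => [|p c _] h.
  by exists 0, 0; split; rewrite ?mul0r ?addr0 // => i j _; rewrite !coef0.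
have [c' [d ec]] : exists c' d, c = c' * 'X + d%:P.
  elim/poly_ind: c {h} => [|c' d _]; last by exists c', d.
  by exists 0, 0; rewrite mul0r add0r.
have hc i j : (p * 'X + c%:P)`_i.+1`_j = p`_i`_j.
  by rewrite coefD coefMX coefC /= addr0.
have h0 j : (p * 'X + c%:P)`_0`_j = c`_j.
  by rewrite coefD coefMX coefC /= add0r.
exists p, c'%:P; split.
- by move=> i j hij; rewrite -hc; apply: h.
- move=> [|i] j hij; rewrite coefC /= ?coef0 //.
  have := h 0%N j.+1 ltac:(by lia).
  by rewrite h0 ec coefD coefMX coefC /= addr0.
- have := h 0%N 0%N ltac:(by []).
  rewrite h0 ec coefD coefMX coefC /= add0r => ->.
  by rewrite addr0 polyCM.
Qed.

(** Exponents of the monomials of degree below k, which form a basis of K[z,w] / I^k. *)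
Definition tri k := {x : 'I_k * 'I_k | (x.1 + x.2 < k)%N}.

Definition mono_of k (x : tri k) : P := mono (val x).1 (val x).2.

Lemma coef_sum_mono k (c : tri k -> K) (x : tri k) :
  (\sum_y (c y)%:P%:P * mono_of y)`_(val x).1`_(val x).2 = c x.
Proof.
rewrite !coef_sum (bigD1 x) //= !coefCM coef_mono !eqxx mulr1 big1 ?addr0 //.
move=> y yx; rewrite !coefCM coef_mono.
case: eqP => e1; case: eqP => e2; rewrite ?mulr0 //.
case/eqP: yx; apply: val_inj; rewrite [LHS]surjective_pairing [RHS]surjective_pairing.
by rewrite (val_inj e1) (val_inj e2).
Qed.

Lemma jet0_trunc k p : exists c : tri k -> K,
  jet0 k (p - \sum_y (c y)%:P%:P * mono_of y).
Proof.
exists (fun y : tri k => p`_(val y).1`_(val y).2) => i j ijk.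
have hi : (i < k)%N by lia.
have hj : (j < k)%N by lia.
pose x : tri k := exist _ (Ordinal hi, Ordinal hj) ijk.
by rewrite !coefB (coef_sum_mono _ x) subrr.
Qed.

Lemma card_tri k : (2 * #|{: tri k}| = k * k.+1)%N.
Proof.
rewrite card_sig -sum1_card.
rewrite -(pair_big_dep xpredT (fun i j : 'I_k => i + j < k)%N (fun _ _ => 1%N)) /=.
have -> : (\sum_(i < k) \sum_(j < k | i + j < k) 1 = \sum_(i < k) (k - i))%N.
  apply: eq_bigr => i _.
  rewrite -[RHS]card_ord -sum1_card (big_ord_widen k (fun=> 1%N)) ?leq_subr //.
  by apply: eq_bigl => j; rewrite ltn_subRL.
elim: k => [|k IH]; first by rewrite big_ord0.
by rewrite big_ord_recl subn0 mulnDr /=; under eq_bigr do rewrite subSS; rewrite IH; lia.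
Qed.

End bivariate.

(** * The symmetric Fock space *)

Section fock_hilbert.
Variables (R : realType) (H : symmetric_fock R).

Lemma cvg0P (u : nat -> R) : (u @ \oo --> (0 : R)) <->
  forall e : R, 0 < e -> exists n0 : nat, forall n, (n0 <= n)%N -> `|u n| < e.
Proof.
split=> [/cvgrPdist_lt h e e0|h].
  have [n0 _ hn0] := h e e0; exists n0 => n hn.
  by have := hn0 n hn; rewrite sub0r normrN.
apply/cvgrPdist_lt => e e0; have [n0 hn0] := h e e0.
by exists n0 => // n /= hn; rewrite sub0r normrN; apply: hn0.
Qed.

Let fock_complete (u : nat -> ball2 R -> (R[i])^o) :
    (forall n, hfs_set H (u n)) ->
    (forall e : R, 0 < e -> exists n0 : nat, forall m n : nat,
      (n0 <= m)%N -> (n0 <= n)%N ->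
      Num.sqrt (complex.Re (hfs_ip H (u m - u n) (u m - u n))) < e) ->
    exists2 f, hfs_set H f & forall e : R, 0 < e -> exists n0 : nat,
      forall n : nat, (n0 <= n)%N ->
      Num.sqrt (complex.Re (hfs_ip H (u n - f) (u n - f))) < e.
Proof.
move=> Su cu; have [f Sf /cvg0P hf] := hfs_complete Su cu.
exists f => // e e0; have [n0 hn0] := hf e e0; exists n0 => n hn.
by have := hn0 n hn; rewrite ger0_norm // sqrtr_ge0.
Qed.

Definition fock_hilbert : hilbert (ball2 R -> (R[i])^o) :=
  Hilbert (hfs_subspace H) (@hfs_ip_linear _ _ _ H) (@hfs_ip_conj _ _ _ H)
    (@hfs_ip_ge0 _ _ _ H) (@hfs_ip_eq0 _ _ _ H) fock_complete.

Variable N : nat.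
Local Notation VF := (ball2 R -> 'rV[R[i]]_N).
Implicit Types F G : VF.

Definition vip F G : R[i] := \sum_(i < N) hfs_ip H (entry i F) (entry i G).

Lemma entry_lin i (a : R[i]) F G :
  entry i (a *: F + G) = a *: entry i F + entry i G.
Proof.
apply/funext => x; rewrite /entry.
by have -> : (a *: F + G) x = a *: F x + G x by []; rewrite !mxE.
Qed.

Lemma entryB i F G : entry i (F - G) = entry i F - entry i G.
Proof. by rewrite addrC -scaleN1r entry_lin scaleN1r addrC. Qed.

Lemma entry0 i : entry i (0 : VF) = 0.
Proof. by apply/funext => x; rewrite /entry mxE. Qed.

Lemma vfock_subspace : subspace (vfock H (N:=N)).
Proof.
split; first by move=> i; rewrite entry0; apply: (hset0 fock_hilbert).
move=> a u v hu hv i; rewrite entry_lin.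
exact: (subspaceP (hfs_subspace H) a (hu i) (hv i)).
Qed.

Let vip_linear (a : R[i]) F G K : vfock H F -> vfock H G -> vfock H K ->
  vip (a *: F + G) K = a * vip F K + vip G K.
Proof.
move=> hF hG hK; rewrite /vip mulr_sumr -big_split /=; apply: eq_bigr => i _.
by rewrite entry_lin hfs_ip_linear.
Qed.

Let vip_conj F G : vfock H F -> vfock H G -> vip G F = Num.conj (vip F G).
Proof.
move=> hF hG; rewrite /vip rmorph_sum; apply: eq_bigr => i _.
exact: hfs_ip_conj.
Qed.

Let vip_ge0 F : vfock H F -> 0 <= vip F F.
Proof. by move=> hF; apply: sumr_ge0 => i _; apply: hfs_ip_ge0. Qed.

Let vip_eq0 F : vfock H F -> vip F F = 0 -> F = 0.
Proof.
move=> hF /eqP; rewrite psumr_eq0; last by move=> i _; apply: hfs_ip_ge0.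
move=> /allP h; apply/funext => x; apply/rowP => i; rewrite !mxE.
have := h i (mem_index_enum i) => /eqP /(hfs_ip_eq0 (hF i)).
by move=> /(congr1 (fun f => f x)).
Qed.

Lemma Re_sum (I : Type) (r : seq I) (F : I -> R[i]) :
  complex.Re (\sum_(i <- r) F i) = \sum_(i <- r) complex.Re (F i).
Proof. by elim/big_rec2: _ => // i y z _ <-; rewrite ReD. Qed.

Let vip_re F : complex.Re (vip F F) = \sum_(i < N) hnsq fock_hilbert (entry i F).
Proof. exact: Re_sum. Qed.

Let vip_complete (u : nat -> VF) : (forall n, vfock H (u n)) ->
    (forall e : R, 0 < e -> exists n0 : nat, forall m n : nat,
      (n0 <= m)%N -> (n0 <= n)%N ->
      Num.sqrt (complex.Re (vip (u m - u n) (u m - u n))) < e) ->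
    exists2 f, vfock H f & forall e : R, 0 < e -> exists n0 : nat,
      forall n : nat, (n0 <= n)%N ->
      Num.sqrt (complex.Re (vip (u n - f) (u n - f))) < e.
Proof.
move=> Su cu.
have Se n i : hset fock_hilbert (entry i (u n)) by apply: Su.
have /choice[f hf] : forall i, exists f, hset fock_hilbert f /\
    hcvg fock_hilbert (fun n => entry i (u n)) f.
  move=> i; suff [f Sf cf] : exists2 f, hset fock_hilbert f &
    hcvg fock_hilbert (fun n => entry i (u n)) f by exists f.
  apply: hcauchy_cvg => // e e0; have [n0 hn0] := cu e e0; exists n0 => m n hm hn.
  apply: le_lt_trans (hn0 m n hm hn); apply: ler_wsqrtr.
  rewrite vip_re (bigD1 i) //= entryB lerDl.
  apply: sumr_ge0 => j _; rewrite entryB; apply: nsq_ge0.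
  exact: (hsetB (H := fock_hilbert)).
pose F : VF := fun x => \row_i f i x.
have eF i : entry i F = f i by apply/funext => x; rewrite /entry mxE.
exists F; first by move=> i; rewrite eF; case: (hf i).
move=> e e0.
(* N + 1 instead of N covers N = 0 and makes N (e / (N + 1))^2 < e^2 strict. *)
have d0 : 0 < e / N.+1%:R by rewrite divr_gt0.
have /choice[m hm] : forall i, exists m : nat, forall n, (m <= n)%N ->
    hnrm fock_hilbert (entry i (u n) - f i) < e / N.+1%:R.
  by move=> i; case: (hf i) => _; apply.
exists (\max_(i < N) m i)%N => n hn.
rewrite -[ltRHS]ger0_norm ?(ltW e0) // -[ltRHS]sqrtr_sqr ltr_sqrt ?exprn_gt0 //.
rewrite vip_re; apply: (@le_lt_trans _ _ (\sum_(i < N) (e / N.+1%:R) ^+ 2)).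
  apply: ler_sum => i _; rewrite entryB eF; case: (hf i) => Sf _.
  rewrite -nrm_sqr; last exact: (hsetB (H := fock_hilbert)).
  have := hm i n (leq_trans (leq_bigmax i) hn).
  have := nrm_ge0 fock_hilbert (entry i (u n) - f i).
  by move: (hnrm _ _) d0; move: (e / _) => a b; nra.
rewrite sumr_const card_ord expr_div_n -[_ *+ N]mulr_natr mulrAC.
rewrite ltr_pdivrMr ?exprn_gt0 //.
rewrite ltr_pM2l ?exprn_gt0 // -natrX ltr_nat.
by rewrite expnS expn1; apply: (@leq_trans N.+1) => //; rewrite leq_pmulr.
Qed.

Definition vfock_hilbert : hilbert VF :=
  Hilbert vfock_subspace vip_linear vip_conj vip_ge0 vip_eq0 vip_complete.

Lemma vfock_nsq F : hnsq vfock_hilbert F =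
  \sum_(i < N) hnsq fock_hilbert (entry i F).
Proof. exact: vip_re. Qed.

Lemma vfock_normE F : vfock H F -> vfock_norm H F = hnrm vfock_hilbert F.
Proof.
move=> hF; rewrite /vfock_norm /hnrm vfock_nsq; congr (Num.sqrt _).
by apply: eq_bigr => i _; rewrite -nrm_sqr //; apply: hF.
Qed.

Lemma inv_hcl M : invariant_subspace H M -> hcl vfock_hilbert M `<=` M.
Proof.
move=> iM F cF; have MS := inv_sub iM.
have [u Mu cu] := hcl_cvg (H := vfock_hilbert) MS cF.
have SF : vfock H F by case: cF.
apply: (inv_closed iM Mu SF); apply/cvg0P => e e0.
have [n0 hn0] := cu e e0; exists n0 => n hn; rewrite ger0_norm ?sqrtr_ge0 //.
rewrite vfock_normE; first exact: hn0.
by apply: (hsetB (H := vfock_hilbert)) => //; apply: MS.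
Qed.

End fock_hilbert.

(** * The unit ball and the kernel *)

Section ball.
Variable R : realType.
Implicit Types x y : ball2 R.

Definition bnsq y : R := sqmod (val y).1 + sqmod (val y).2.

Lemma bnsq_ge0 y : 0 <= bnsq y.
Proof. by rewrite addr_ge0 // sqmod_ge0. Qed.

Lemma in_ballE (u : R[i] * R[i]) :
  (`|u.1| ^+ 2 + `|u.2| ^+ 2 < 1) = (sqmod u.1 + sqmod u.2 < 1).
Proof. by rewrite !normc_sqmod -rmorphD -[1]/(1%:C) ltcR. Qed.

Lemma bnsq_lt1 y : bnsq y < 1.
Proof. by rewrite -in_ballE (valP y). Qed.

(** Radial scaling. The default y of [insubd] would be returned only outside the ball, hence never
    for 0 <= t <= 1. *)
Definition bscale (t : R) y : ball2 R :=
  insubd y (t%:C * (val y).1, t%:C * (val y).2).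

Lemma val_bscale t y : 0 <= t <= 1 ->
  val (bscale t y) = (t%:C * (val y).1, t%:C * (val y).2).
Proof.
move=> /andP[t0 t1]; rewrite val_insubd in_ballE /= !sqmodM -mulrDr sqmodC ifT //.
by apply: le_lt_trans (bnsq_lt1 y); rewrite ler_piMl ?bnsq_ge0 // expr_le1.
Qed.

Lemma ball_origin_proof : `|(0, 0 : R[i]).1 : R[i]| ^+ 2 + `|(0 : R[i], 0 : R[i]).2| ^+ 2 < 1.
Proof. by rewrite in_ballE /= !sqmod0 addr0 ltr01. Qed.

Definition origin : ball2 R := Sub (0, 0) ball_origin_proof.

Definition ipc x y : R[i] :=
  (val x).1 * Num.conj (val y).1 + (val x).2 * Num.conj (val y).2.

Lemma ipc_xx y : ipc y y = (bnsq y)%:C.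
Proof. by rewrite /ipc !mulJ_sqmod -rmorphD. Qed.

Lemma conj_pairing (a b c d : R[i]) :
  Num.conj (a * Num.conj b + c * Num.conj d) = b * Num.conj a + d * Num.conj c.
Proof. by apply: complex_ext; rewrite !ReImE; ring. Qed.

Lemma ipcJ x y : Num.conj (ipc x y) = ipc y x.
Proof. exact: conj_pairing. Qed.

(** Cauchy-Schwarz for two summands that are known only through bounds on their moduli. *)
Lemma sqmod_add_le (A B : R[i]) (a1 a2 b1 b2 : R) :
  0 <= a1 -> 0 <= a2 -> 0 <= b1 -> 0 <= b2 ->
  sqmod A <= a1 * b1 -> sqmod B <= a2 * b2 ->
  sqmod (A + B) <= (a1 + a2) * (b1 + b2).
Proof.
move=> a10 a20 b10 b20 hA hB.
have h1 : (complex.Re A * complex.Re B + complex.Im A * complex.Im B) ^+ 2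
    <= sqmod A * sqmod B.
  have := sqr_ge0 (complex.Re A * complex.Im B - complex.Im A * complex.Re B).
  by rewrite /sqmod; nra.
have h2 : sqmod A * sqmod B <= (a1 * b1) * (a2 * b2).
  by apply: ler_pM => //; apply: sqmod_ge0.
have p1 : 0 <= a1 * b2 by rewrite mulr_ge0.
have p2 : 0 <= a2 * b1 by rewrite mulr_ge0.
have h3 : complex.Re A * complex.Re B + complex.Im A * complex.Im B
   <= (a1 * b2 + a2 * b1) / 2.
  apply: sqr_leW; first by rewrite divr_ge0 // addr_ge0.
  apply: le_trans h1 _; apply: le_trans h2 _.
  by have := sqr_ge0 (a1 * b2 - a2 * b1); nra.
have -> : sqmod (A + B) = sqmod A + sqmod B +
   2 * (complex.Re A * complex.Re B + complex.Im A * complex.Im B).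
  by rewrite /sqmod !ReImE; ring.
nra.
Qed.

Lemma ipc_lt1 x y : sqmod (ipc x y) < 1.
Proof.
apply: (@le_lt_trans _ _ (bnsq x * bnsq y)).
  by apply: sqmod_add_le; rewrite ?sqmod_ge0 // sqmodM sqmodJ.
have := bnsq_lt1 x; have := bnsq_lt1 y; have := bnsq_ge0 x; have := bnsq_ge0 y; nra.
Qed.

Lemma ipc_neq1 x y : 1 - ipc x y != 0.
Proof.
rewrite subr_eq0; apply/eqP => h; have := ipc_lt1 x y.
by rewrite -h sqmod1 ltxx.
Qed.

Lemma fock_kernelE x y : fock_kernel x y = (1 - ipc x y)^-1.
Proof.
have E (a b : R[i]) : 1 / (1 - a - b) = (1 - (a + b))^-1.
  by rewrite opprD addrA div1r.
exact: (E ((val x).1 * Num.conj (val y).1)).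
Qed.

(** The source of all norm identities in H: it says that z and w, with their adjoints, sum to the
    identity minus the projection to the constants. *)
Lemma kernel_step x y : fock_kernel x y = 1 + ipc x y * fock_kernel x y.
Proof. by rewrite fock_kernelE; field; exact: ipc_neq1. Qed.

Lemma ipc_scale x y t : 0 <= t <= 1 -> ipc x (bscale t y) = t%:C * ipc x y.
Proof.
by move=> ht; rewrite /ipc val_bscale //= !conj_realM; ring.
Qed.

Lemma ipc_scalel x y t : 0 <= t <= 1 -> ipc (bscale t x) y = t%:C * ipc x y.
Proof. by move=> ht; rewrite /ipc val_bscale //=; ring. Qed.

Lemma ipc_originl y : ipc origin y = 0.
Proof. by rewrite /ipc /= !mul0r addr0. Qed.

Lemma ipc_originr y : ipc y origin = 0.
Proof. by rewrite -ipcJ ipc_originl rmorph0. Qed.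

End ball.

Section multiplication.
Variables (R : realType) (W : lmodType R[i]).
Implicit Types F G : ball2 R -> W.

Definition zmul F : ball2 R -> W := fun x => (val x).1 *: F x.
Definition wmul F : ball2 R -> W := fun x => (val x).2 *: F x.

Lemma zmul_lin (a : R[i]) F G : zmul (a *: F + G) = a *: zmul F + zmul G.
Proof.
apply/funext => x.
change ((val x).1 *: (a *: F x + G x) =
  a *: ((val x).1 *: F x) + (val x).1 *: G x).
by rewrite scalerDr !scalerA mulrC.
Qed.

Lemma wmul_lin (a : R[i]) F G : wmul (a *: F + G) = a *: wmul F + wmul G.
Proof.
apply/funext => x.
change ((val x).2 *: (a *: F x + G x) =
  a *: ((val x).2 *: F x) + (val x).2 *: G x).
by rewrite scalerDr !scalerA mulrC.
Qed.

Definition hmul (h : ball2 R -> R[i]) F : ball2 R -> W := fun x => h x *: F x.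

Lemma hmul_lin (h : ball2 R -> R[i]) (a : R[i]) F G :
  hmul h (a *: F + G) = a *: hmul h F + hmul h G.
Proof.
apply/funext => x; change (h x *: (a *: F x + G x) = a *: (h x *: F x) + h x *: G x).
by rewrite scalerDr !scalerA mulrC.
Qed.

Lemma zmulE F : zmul F = hmul (fun x => (val x).1) F. Proof. by []. Qed.
Lemma wmulE F : wmul F = hmul (fun x => (val x).2) F. Proof. by []. Qed.

Lemma hmulA h h' F : hmul h (hmul h' F) = hmul (fun x => h x * h' x) F.
Proof. by apply/funext => x; exact: scalerA. Qed.

Lemma hmulC h h' F : hmul h (hmul h' F) = hmul h' (hmul h F).
Proof. by rewrite !hmulA; congr hmul; apply/funext => x; rewrite mulrC. Qed.

Lemma hmulDl h h' F : hmul (fun x => h x + h' x) F = hmul h F + hmul h' F.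
Proof. by apply/funext => x; exact: scalerDl. Qed.

Lemma hmulBl h h' F : hmul (fun x => h x - h' x) F = hmul h F - hmul h' F.
Proof. by apply/funext => x; exact: scalerBl. Qed.

Lemma hmul0 h : hmul h 0 = 0.
Proof. by apply/funext => x; exact: scaler0. Qed.

Lemma hmulDr h F G : hmul h (F + G) = hmul h F + hmul h G.
Proof. by rewrite -[F]scale1r hmul_lin !scale1r. Qed.

Lemma hmulZr h (a : R[i]) F : hmul h (a *: F) = a *: hmul h F.
Proof. by rewrite -[a *: F]addr0 hmul_lin hmul0 addr0. Qed.

Lemma hmulBr h F G : hmul h (F - G) = hmul h F - hmul h G.
Proof. by rewrite hmulDr -scaleN1r hmulZr scaleN1r. Qed.

Lemma hmul_sumr (I : Type) (r : seq I) h (f : I -> ball2 R -> W) :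
  hmul h (\sum_(i <- r) f i) = \sum_(i <- r) hmul h (f i).
Proof.
elim: r => [|i r IH]; first by rewrite !big_nil hmul0.
by rewrite !big_cons hmulDr IH.
Qed.

End multiplication.

Section fock_space.
Variables (R : realType) (H : symmetric_fock R).
Local Notation FH := (fock_hilbert H).
Local Notation V := (ball2 R -> (R[i])^o).
Implicit Types (f g h : V) (y : ball2 R).

Definition kf y : V := fun x => fock_kernel x y.

Lemma kfH y : hset FH (kf y). Proof. exact: hfs_kernel. Qed.
Hint Resolve kfH : core.

Lemma reproducing f y : hset FH f -> hip FH f (kf y) = f y.
Proof. by move=> Hf; rewrite [in RHS](hfs_reproducing _ Hf). Qed.

Lemma kf_origin : kf (origin R) = (fun=> 1).
Proof. by apply/funext => x; rewrite /kf fock_kernelE ipc_originr subr0 invr1. Qed.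

Lemma oneH : hset FH (fun=> 1 : R[i]).
Proof. by rewrite -kf_origin. Qed.
Hint Resolve oneH : core.

Lemma ip_one f : hset FH f -> hip FH f (fun=> 1) = f (origin R).
Proof. by move=> Hf; rewrite -kf_origin reproducing. Qed.

Definition kcomb (s : seq (R[i] * ball2 R)) : V := \sum_(p <- s) p.1 *: kf p.2.
(** The adjoint of z sends k_y to conj y1 k_y. On formal combinations this makes sense before
    multiplication by z is known to preserve H. *)
Definition shift1 (p : R[i] * ball2 R) := (p.1 * Num.conj (val p.2).1, p.2).
Definition shift2 (p : R[i] * ball2 R) := (p.1 * Num.conj (val p.2).2, p.2).

Lemma kcombH s : hset FH (kcomb s).
Proof. by apply: (subspace_sum (hsub FH)) => p _; exact: (hsetZ _ (kfH _)). Qed.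

Lemma kcomb_ip s s' : hip FH (kcomb s) (kcomb s') =
  \sum_(p <- s) \sum_(q <- s') p.1 * Num.conj q.1 * fock_kernel q.2 p.2.
Proof.
rewrite /kcomb ip_suml; last exact: kcombH; last by move=> p; exact: (hsetZ _ (kfH _)).
apply: eq_bigr => p _; rewrite ip_sumr; last exact: (hsetZ _ (kfH _));
  last by move=> q; exact: (hsetZ _ (kfH _)).
apply: eq_bigr => q _; rewrite ipZl; [|exact: kfH|exact: (hsetZ _ (kfH _))].
by rewrite ipZr // reproducing // mulrA.
Qed.

(** This is [kernel_step] summed over pairs; the sum of the coefficients is the value at the origin,
    where every k_y is 1. *)
Lemma kcomb_polar s s' : hip FH (kcomb s) (kcomb s') =
  (\sum_(p <- s) p.1) * Num.conj (\sum_(p <- s') p.1)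
  + hip FH (kcomb (map shift1 s)) (kcomb (map shift1 s'))
  + hip FH (kcomb (map shift2 s)) (kcomb (map shift2 s')).
Proof.
rewrite !kcomb_ip !big_map conj_sum mulr_suml -!big_split /=.
apply: eq_bigr => p _; rewrite !big_map mulr_sumr -!big_split /=.
apply: eq_bigr => q _; rewrite [in LHS]kernel_step /ipc !conjM !conjCK; ring.
Qed.

(** A graph instead of operators: two lists may have the same sum, and that their shifted sums then
    agree is not known at this point. *)
Definition kgraph : set (V * V * V) :=
  [set t | exists s, t = (kcomb s, kcomb (map shift1 s), kcomb (map shift2 s))].

Lemma kcomb_lin (a : R[i]) s s' :
  kcomb (map (fun p => (a * p.1, p.2)) s ++ s') = a *: kcomb s + kcomb s'.
Proof.
rewrite /kcomb big_cat big_map /= scaler_sumr; congr (_ + _).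
by apply: eq_bigr => p _; rewrite scalerA.
Qed.

Lemma kgraph_subspace : subspace kgraph.
Proof.
split; first by exists [::]; rewrite /= /kcomb !big_nil.
move=> a _ _ [s ->] [s' ->].
exists (map (fun p => (a * p.1, p.2)) s ++ s').
rewrite !map_cat -!map_comp kcomb_lin.
congr (_, _, _); rewrite -kcomb_lin -map_comp; congr (kcomb (_ ++ _));
  by apply: eq_map => p; rewrite /shift1 /shift2 /= mulrA.
Qed.

Lemma triple_lin (A : pzRingType) (U : lmodType A) (a : A) (t t' : U * U * U) :
  [/\ (a *: t + t').1.1 = a *: t.1.1 + t'.1.1,
      (a *: t + t').1.2 = a *: t.1.2 + t'.1.2 &
      (a *: t + t').2 = a *: t.2 + t'.2].
Proof. by []. Qed.

(** Dual to [kcomb_polar], by which the pair of adjoints is contractive on combinations of kernels.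
    [riesz] turns the functional <t2, f> + <t3, g> on triples (t1, t2, t3) of the graph into a
    vector, and testing on a single kernel identifies it with z f + w g. *)
Lemma row_contraction f g : hset FH f -> hset FH g ->
  hset FH (zmul f + wmul g) /\
  hnsq FH (zmul f + wmul g) <= hnsq FH f + hnsq FH g.
Proof.
move=> Hf Hg.
pose L (t : V * V * V) := hip FH t.1.2 f + hip FH t.2 g.
have GH t : kgraph t -> [/\ hset FH t.1.1, hset FH t.1.2 & hset FH t.2].
  by case=> s ->; split; exact: kcombH.
have [||||F [[HF _] nF hF]] := @riesz _ _ FH _ kgraph (fun t => t.1.1) L
    (hnsq FH f + hnsq FH g) kgraph_subspace (fun t Gt => let: And3 h _ _ := GH t Gt in h).
- by move=> a t t' _ _; case: (triple_lin a t t').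
- move=> a t t' /GH[_ h1 h2] /GH[_ h3 h4]; rewrite /L.
  have [_ -> ->] := triple_lin a t t'.
  rewrite (ipDl (hsetZ a h1) h3 Hf) (ipZl a h1 Hf).
  by rewrite (ipDl (hsetZ a h2) h4 Hg) (ipZl a h2 Hg) addrACA -mulrDr.
- by rewrite addr_ge0 // nsq_ge0.
- move=> t Gt; case: (GH t Gt) => h0 h1 h2; rewrite mulrC.
  apply: le_trans (_ : (hnsq FH t.1.2 + hnsq FH t.2) * (hnsq FH f + hnsq FH g) <= _).
    by apply: sqmod_add_le; rewrite ?nsq_ge0 //; apply: cauchy_schwarz.
  apply: ler_wpM2r; first by rewrite addr_ge0 // nsq_ge0.
  case: Gt => s -> /=; rewrite /hnsq [in leRHS]kcomb_polar !ReD mulJ_sqmod -addrA.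
  by rewrite lerDr /= sqmod_ge0.
suff <- : F = zmul f + wmul g by [].
apply/funext => y.
have e : hip FH (Num.conj (val y).1 *: kf y) f +
    hip FH (Num.conj (val y).2 *: kf y) g = hip FH (kf y) F.
  have := hF _ (ex_intro _ [:: (1, y)] erefl).
  by rewrite /L /kcomb /shift1 /shift2 /= !big_seq1 /= scale1r !mul1r.
have := congr1 Num.conj e.
rewrite conjD -(hip_conj (hsetZ _ (kfH y)) Hf) -(hip_conj (hsetZ _ (kfH y)) Hg).
rewrite -(hip_conj (kfH y) HF) (ipZr _ (kfH y) Hf) (ipZr _ (kfH y) Hg).
by rewrite !reproducing // !conjCK => <-.
Qed.

Lemma zmulH f : hset FH f -> hset FH (zmul f).
Proof.
move=> Hf; have [h _] := row_contraction Hf (hset0 FH); suff <- : zmul f + wmul 0 = zmul f by [].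
by apply/funext => x; rewrite /zmul /wmul; apply: (etrans (congr1 _ (scaler0 _ _))); rewrite addr0.
Qed.

Lemma wmulH f : hset FH f -> hset FH (wmul f).
Proof.
move=> Hf; have [h _] := row_contraction (hset0 FH) Hf; suff <- : zmul 0 + wmul f = wmul f by [].
by apply/funext => x; rewrite /zmul /wmul; apply: (etrans (congr1 (fun u => u + _) (scaler0 _ _))); rewrite add0r.
Qed.

End fock_space.

(** * Taylor expansion along rays *)

Section taylor.
Variable R : realType.

Lemma poly_sqmod_bound (P : {poly R[i]}) : exists2 B : R, 0 <= B &
  forall t : R, 0 <= t <= 1 -> sqmod P.[t%:C] <= B.
Proof.
elim/poly_ind: P => [|P c [B B0 hB]].
  by exists 0 => // t _; rewrite horner0 sqmod0.
exists (2 * B + 2 * sqmod c); first by rewrite addr_ge0 // mulr_ge0 // sqmod_ge0.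
move=> t ht; rewrite hornerMXaddC; apply: le_trans (sqmodD _ _) _.
rewrite sqmodM sqmodC; have := hB t ht; have := sqmod_ge0 P.[t%:C].
move: (sqmod c) (sqmod _) ht => a b /andP[t0 t1] b0 h.
have t2 : t ^+ 2 <= 1 by rewrite expr_le1.
by have := sqr_ge0 t; nra.
Qed.

Lemma poly_asymptotic (P : {poly R[i]}) (m : nat) (B : R) :
  (forall t : R, 0 < t <= 1 -> sqmod P.[t%:C] <= B * (t ^+ m) ^+ 2) ->
  forall i, (i < m)%N -> P`_i = 0.
Proof.
elim: m P B => [//|m IH] P B h.
have [Q [c eP]] : exists Q c, P = Q * 'X + c%:P.
  by elim/poly_ind: P {h} => [|Q c _]; [exists 0, 0; rewrite mul0r add0r|exists Q, c].
have [D D0 hD] := poly_sqmod_bound Q.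
have c0 : c = 0.
  apply: sqmod_eq0; apply/ler_addgt0Pr => e e0; rewrite add0r.
  (* Since t^2 and t^(2m+2) are at most t on [0, 1], |c|^2 is at most t times the bounds 2 |B| from
     the hypothesis and 2 D from the quotient Q. *)
  pose E := 2 * `|B| + 2 * D + 1.
  have E0 : 0 < E by rewrite ltr_wpDl // addr_ge0 // mulr_ge0.
  pose t := Num.min 1 (e / E).
  have t0 : 0 < t by rewrite lt_min ltr01 divr_gt0.
  have t1 : t <= 1 by rewrite /t ge_min lexx.
  have te : t * E <= e by rewrite -ler_pdivlMr // /t ge_min lexx orbT.
  have tt : 0 < t <= 1 by rewrite t0.
  have hP := h t tt; have hQ := hD t ltac:(by rewrite (ltW t0)).
  have -> : c = P.[t%:C] + - (Q.[t%:C] * t%:C) by rewrite eP hornerMXaddC addrAC subrr add0r.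
  apply: le_trans (sqmodD _ _) _; rewrite sqmodN sqmodM sqmodC.
  have tm : (t ^+ m.+1) ^+ 2 <= t.
    rewrite -exprM muln2 doubleS -[leRHS]expr1.
    by apply: ler_wiXn2l => //; exact: ltW.
  have tm0 : 0 <= (t ^+ m.+1) ^+ 2 by apply: sqr_ge0.
  have t2 : t ^+ 2 <= t by rewrite expr2 ler_piMr // ltW.
  have nB : B <= `|B| by apply: ler_norm.
  have nB0 : 0 <= `|B| by apply: normr_ge0.
  have q0 := sqmod_ge0 Q.[t%:C].
  apply: (@le_trans _ _ (2 * (`|B| * t) + 2 * (D * t))).
    apply: lerD; rewrite ler_wpM2l //.
      apply: le_trans hP _; apply: le_trans (_ : `|B| * (t ^+ m.+1) ^+ 2 <= _).
        by rewrite ler_wpM2r.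
      by rewrite ler_wpM2l.
    by apply: ler_pM => //; apply: sqr_ge0.
  by apply: le_trans te; rewrite /E; nra.
move=> i im; rewrite eP c0 addr0 coefMX.
case: i im => [//|i im] /=; apply: (IH Q B) => // t /andP[t0 t1].
have := h t ltac:(by rewrite t0).
rewrite eP c0 addr0 hornerMX sqmodM sqmodC (exprS t m) exprMn [leRHS]mulrCA [leLHS]mulrC.
by rewrite ler_pM2l // exprn_gt0.
Qed.

End taylor.

Section fock_taylor.
Variables (R : realType) (H : symmetric_fock R).
Local Notation FH := (fock_hilbert H).
Local Notation V := (ball2 R -> (R[i])^o).
Implicit Types (f g h : V) (y : ball2 R).
Hint Resolve kfH oneH : core.

Lemma nsq_zmul f : hset FH f -> hnsq FH (zmul f) <= hnsq FH f.
Proof.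
move=> Hf; have [_] := row_contraction Hf (hset0 FH).
rewrite nsq0 addr0; suff -> : zmul f + wmul 0 = zmul f by [].
by apply/funext => x; rewrite /zmul /wmul; apply: (etrans (congr1 _ (scaler0 _ _))); rewrite addr0.
Qed.

Lemma nsq_wmul f : hset FH f -> hnsq FH (wmul f) <= hnsq FH f.
Proof.
move=> Hf; have [_] := row_contraction (hset0 FH) Hf.
rewrite nsq0 add0r; suff -> : zmul 0 + wmul f = wmul f by [].
by apply/funext => x; rewrite /zmul /wmul; apply: (etrans (congr1 (fun u => u + _) (scaler0 _ _))); rewrite add0r.
Qed.

(** Take for a and b the adjoints of z and w applied to h; the decomposition is then [kernel_step]
    paired with h, and the norm identity is the decomposition paired with h. *)
Lemma gleason h : hset FH h -> exists a b, [/\ hset FH a, hset FH b,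
  h = h (origin R) *: (fun=> 1) + (zmul a + wmul b) &
  hnsq FH h = sqmod (h (origin R)) + hnsq FH a + hnsq FH b].
Proof.
move=> Hh.
have adj (T : V -> V) : (forall (c : R[i]) f g, T (c *: f + g) = c *: T f + T g) ->
    (forall f, hset FH f -> hset FH (T f)) ->
    (forall f, hset FH f -> hnsq FH (T f) <= hnsq FH f) ->
    exists2 a, hset FH a & forall f, hset FH f -> hip FH (T f) h = hip FH f a.
  move=> Tl TH Tc.
  have [||||a [[Ha _] _ ha]] := @riesz _ _ FH V (hset FH) id (fun f => hip FH (T f) h)
    (hnsq FH h) (hsub FH) (fun f Hf => Hf).
  - by [].
  - move=> c f g Hf Hg; have TF := TH f Hf; have TG := TH g Hg.
    by rewrite Tl ipDl // ipZl.
  - exact: nsq_ge0.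
  - move=> f Hf; apply: le_trans (cauchy_schwarz (TH f Hf) Hh) _.
    by rewrite mulrC; apply: ler_wpM2l; [apply: nsq_ge0|apply: Tc].
  by exists a.
have [a Ha ha] := adj _ (@zmul_lin R _) (@zmulH R H) nsq_zmul.
have [b Hb hb] := adj _ (@wmul_lin R _) (@wmulH R H) nsq_wmul.
have Hz := zmulH Ha; have Hw := wmulH Hb.
have eh : h = h (origin R) *: (fun=> 1) + (zmul a + wmul b).
  apply/funext => y.
  change (h y = h (origin R) * 1 + ((val y).1 * a y + (val y).2 * b y)).
  rewrite mulr1 -(reproducing y Ha) -(reproducing y Hb).
  have Hk := kfH H y; have Hzk := zmulH Hk; have Hwk := wmulH Hk.
  rewrite (hip_conj Hk Ha) (hip_conj Hk Hb) -(ha _ Hk) -(hb _ Hk).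
  rewrite -(hip_conj Hzk Hh) -(hip_conj Hwk Hh).
  rewrite -{1}[(val y).1]conjCK -(ipZr _ Hzk Hh) -{1}[(val y).2]conjCK -(ipZr _ Hwk Hh).
  have H1 := hsetZ (Num.conj (val y).1) Hzk.
  have H2 := hsetZ (Num.conj (val y).2) Hwk.
  rewrite -(ip_one Hh) -(ipDr H1 H2 Hh) -(ipDr (oneH H) (hsetD H1 H2) Hh).
  rewrite -(reproducing y Hh); congr (hip _ _ _); apply/funext => x.
  change (fock_kernel x y = 1 + (Num.conj (val y).1 * ((val x).1 * fock_kernel x y)
    + Num.conj (val y).2 * ((val x).2 * fock_kernel x y))).
  rewrite [LHS]kernel_step /ipc; ring.
exists a, b; split=> //.
have Hone := oneH H.
rewrite {1}/hnsq {1}eh ipDl; [|exact: hsetZ|exact: hsetD|by []].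
rewrite ipZl // (hip_conj Hh Hone) ip_one // mulJ_sqmod.
by rewrite ipDl // ha // hb // !ip_nsq // !ReImE addrA.
Qed.

(** The part of degree n of k_y. For real t, k at ty is sum t^n <., y>^n, so <f, qf y n> is the n-th
    Taylor coefficient of f along the ray through y. *)
Definition qf y n : V := fun x => ipc x y ^+ n.

Definition qmul y n f : V := fun x => ipc x y ^+ n * f x.

(** Since <., y> f = z (conj y1 f) + w (conj y2 f), [row_contraction] gives a factor |y|^2 for each
    power. *)
Lemma qmulH y n f : hset FH f ->
  hset FH (qmul y n f) /\ hnsq FH (qmul y n f) <= bnsq y ^+ n * hnsq FH f.
Proof.
move=> Hf; elim: n => [|n [IH1 IH2]].
  have -> : qmul y 0 f = f by apply/funext => x; rewrite /qmul expr0 mul1r.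
  by rewrite expr0 mul1r.
have -> : qmul y n.+1 f =
   zmul (Num.conj (val y).1 *: qmul y n f) + wmul (Num.conj (val y).2 *: qmul y n f).
  apply/funext => x.
  change (ipc x y ^+ n.+1 * f x = (val x).1 * (Num.conj (val y).1 * (ipc x y ^+ n * f x))
    + (val x).2 * (Num.conj (val y).2 * (ipc x y ^+ n * f x))).
  by rewrite exprS /ipc; ring.
have Hz := hsetZ (Num.conj (val y).1) IH1; have Hw := hsetZ (Num.conj (val y).2) IH1.
have [h1 h2] := row_contraction Hz Hw.
split=> //; apply: le_trans h2 _.
rewrite !nsqZ // !sqmodJ -mulrDl -/(bnsq y) exprS -mulrA.
by apply: ler_wpM2l; first exact: bnsq_ge0.
Qed.

Lemma qfH y n : hset FH (qf y n).
Proof.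
have [h _] := qmulH y n (oneH H); suff -> : qf y n = qmul y n (fun=> 1) by [].
by apply/funext => x; rewrite /qmul mulr1.
Qed.
Hint Resolve qfH : core.

Lemma kf_nsq y : hnsq FH (kf y) = (1 - bnsq y)^-1.
Proof.
rewrite /hnsq reproducing // /kf fock_kernelE ipc_xx.
by rewrite -[1]/(1%:C) -rmorphB -fmorphV.
Qed.

Lemma kf_expand y m (t : R) : 0 <= t <= 1 ->
  kf (bscale t y) = \sum_(n < m) (t ^+ n)%:C *: qf y n
    + (t ^+ m)%:C *: qmul y m (kf (bscale t y)).
Proof.
move=> ht; apply/funext => x.
change (fock_kernel x (bscale t y) = (\sum_(n < m) (t ^+ n)%:C *: qf y n) x
   + (t ^+ m)%:C * (ipc x y ^+ m * fock_kernel x (bscale t y))).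
have -> : (\sum_(n < m) (t ^+ n)%:C *: qf y n) x = \sum_(n < m) (t%:C * ipc x y) ^+ n.
  rewrite fct_sumE; apply: eq_bigr => n _; rewrite exprMn -rmorphXn; exact: erefl.
rewrite rmorphXn mulrA -exprMn.
elim: m => [|m IH]; first by rewrite big_ord0 expr0 mul1r add0r.
rewrite big_ord_recr /= {1}IH {1}kernel_step ipc_scale // exprSr; ring.
Qed.

Lemma bnsq_scale y t : 0 <= t <= 1 -> bnsq (bscale t y) <= bnsq y.
Proof.
move=> ht; rewrite /bnsq val_bscale //= !sqmodM -mulrDr sqmodC ler_piMl //.
  exact: bnsq_ge0.
by case/andP: ht => t0 t1; rewrite expr_le1.
Qed.

(** Pair f with [kf_expand]. The remainder is bounded uniformly in t because |y| < 1 and the norm of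
    k at ty does not exceed that of k_y. *)
Lemma taylor_expansion f y m : hset FH f -> exists2 B : R, 0 <= B &
  forall t, 0 <= t <= 1 -> sqmod (f (bscale t y) -
    (\poly_(n < m) hip FH f (qf y n)).[t%:C]) <= B * (t ^+ m) ^+ 2.
Proof.
move=> Hf; have y1 := bnsq_lt1 y; have y0 := bnsq_ge0 y.
exists (hnsq FH f * (1 - bnsq y)^-1).
  by rewrite mulr_ge0 ?nsq_ge0 // invr_ge0 subr_ge0 ltW.
move=> t ht; have [t0 t1] := andP ht.
have [Hq nq] := qmulH y m (kfH H (bscale t y)).
have Hs : hset FH (\sum_(n < m) (t ^+ n)%:C *: qf y n).
  by apply: (subspace_sum (hsub FH)) => n _; exact: (hsetZ _ (qfH _ _)).
rewrite -(reproducing _ Hf) {1}(kf_expand y m ht) (ipDr Hs (hsetZ _ Hq) Hf).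
rewrite ip_sumr //; last by move=> n; exact: (hsetZ _ (qfH _ _)).
have -> : \sum_(n < m) hip FH f ((t ^+ n)%:C *: qf y n)
   = (\poly_(n < m) hip FH f (qf y n)).[t%:C].
  rewrite horner_poly; apply: eq_bigr => n _.
  by rewrite (ipZr _ (qfH y n) Hf) conj_real mulrC rmorphXn.
rewrite addrC addKr ipZr // conj_real sqmodM sqmodC mulrC.
rewrite ler_wpM2r ?sqr_ge0 //.
apply: le_trans (cauchy_schwarz Hf Hq) _; apply: ler_wpM2l; first exact: nsq_ge0.
apply: le_trans nq _; rewrite kf_nsq.
have hs := bnsq_scale y ht.
apply: (@le_trans _ _ (1 * (1 - bnsq (bscale t y))^-1)).
  rewrite ler_wpM2r ?invr_ge0 ?subr_ge0; [by []|by apply: ltW; apply: bnsq_lt1|].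
  by rewrite exprn_ile1 // ltW.
rewrite mul1r lef_pV2 ?posrE ?subr_gt0 ?bnsq_lt1 //.
by rewrite lerD2l lerN2.
Qed.

(** Order of vanishing at the origin, ray by ray, with a bound that may depend on the ray. In this
    form sums and products are immediate, and on H it amounts to membership in I^k H ([ordge_ipow],
    [ipow_ordge]). *)
Definition ordge k f : Prop := forall y, exists2 B : R, 0 <= B &
  forall t, 0 <= t <= 1 -> sqmod (f (bscale t y)) <= B * (t ^+ k) ^+ 2.

Lemma ordge_ip k f y n : hset FH f -> ordge k f -> (n < k)%N ->
  hip FH f (qf y n) = 0.
Proof.
move=> Hf ok nk; have [B1 B10 h1] := ok y; have [B2 B20 h2] := taylor_expansion y k Hf.
have := @poly_asymptotic R (\poly_(n < k) hip FH f (qf y n)) k (2 * B1 + 2 * B2) _ n nk.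
rewrite coef_poly nk; apply=> t /andP[t0 t1].
have ht : 0 <= t <= 1 by rewrite (ltW t0).
set P := _.[_].
have -> : P = f (bscale t y) + - (f (bscale t y) - P) by rewrite opprB addrCA subrr addr0.
apply: le_trans (sqmodD _ _) _; rewrite sqmodN.
have -> : (2 * B1 + 2 * B2) * (t ^+ k) ^+ 2 =
  2 * (B1 * (t ^+ k) ^+ 2) + 2 * (B2 * (t ^+ k) ^+ 2) by ring.
by apply: lerD; apply: ler_wpM2l => //; [apply: h1|apply: h2].
Qed.

(** Expanding k_y to degree m leaves f(y) = <f, <., y>^m k_y>, which tends to 0 like |y|^m. *)
Lemma ip_qf_eq0 f : hset FH f -> (forall y n, hip FH f (qf y n) = 0) -> f = 0.
Proof.
move=> Hf h; apply/funext => y; apply: sqmod_eq0.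
have y0 := bnsq_ge0 y; have y1 := bnsq_lt1 y.
have key m : sqmod (f y) <= bnsq y ^+ m * (hnsq FH f * hnsq FH (kf y)).
  have [Hq nq] := qmulH y m (kfH H y).
  have -> : f y = hip FH f (qmul y m (kf y)).
    have y11 : bscale 1 y = y.
      by apply: val_inj; rewrite val_bscale ?ler01 ?lexx // !mul1r -surjective_pairing.
    have := kf_expand y m (t := 1) ltac:(by rewrite ler01 lexx).
    rewrite y11 -{1}(reproducing y Hf) => {1}->.
    rewrite ipDr //; last first.
      by apply: (subspace_sum (hsub FH)) => n _; exact: (hsetZ _ (qfH _ _)).
    rewrite ip_sumr //; last by move=> n; exact: (hsetZ _ (qfH _ _)).
    rewrite big1 ?add0r; last by move=> n _; rewrite (ipZr _ (qfH y n) Hf) h mulr0.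
    by rewrite expr1n scale1r.
  apply: le_trans (cauchy_schwarz Hf Hq) _; rewrite mulrCA.
  by apply: ler_wpM2l; first exact: nsq_ge0.
set C := hnsq FH f * _ in key.
have C0 : 0 <= C by rewrite mulr_ge0 ?nsq_ge0.
apply/ler_addgt0Pr => e e0; rewrite add0r.
have cv : (fun m => bnsq y ^+ m * C) @ \oo --> (0 * C).
  by apply: cvgMl; apply: cvg_expr; rewrite ger0_norm.
rewrite mul0r in cv.
have [n0 hn0] := (cvg0P _).1 cv e e0.
apply: le_trans (key n0) _; apply: le_trans (ler_norm _) _.
by apply: ltW; apply: hn0.
Qed.

(** Along the ray through y' the function <., y>^n is the monomial <y', y>^n t^n; comparing it with
    its Taylor polynomial yields all the pairings. *)
Lemma ip_qf y n y' n' :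
  hip FH (qf y n) (qf y' n') = if n == n' then ipc y' y ^+ n else 0.
Proof.
have [B B0 hB] := taylor_expansion y' (maxn n n').+1 (qfH y n).
set m := (maxn n n').+1 in hB.
have nm : (n < m)%N by rewrite ltnS leq_maxl.
have n'm : (n' < m)%N by rewrite ltnS leq_maxr.
pose P := (ipc y' y ^+ n)%:P * 'X^n - \poly_(k < m) hip FH (qf y n) (qf y' k).
have := @poly_asymptotic R P m B _ n' n'm.
rewrite /P coefB coefCM coefXn coef_poly n'm => h.
have /eqP : ipc y' y ^+ n * (n' == n)%:R - hip FH (qf y n) (qf y' n') = 0.
  apply: h => t /andP[t0 t1]; have ht : 0 <= t <= 1 by rewrite (ltW t0).
  rewrite hornerD hornerN hornerM hornerC hornerXn.
  suff -> : ipc y' y ^+ n * t%:C ^+ n = qf y n (bscale t y') by apply: hB.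
  by rewrite /qf ipc_scalel // exprMn mulrC.
rewrite subr_eq0 eq_sym => /eqP ->; rewrite eq_sym.
by case: eqP => _; rewrite ?mulr1 ?mulr0.
Qed.

End fock_taylor.

(** * Combinations of homogeneous kernels, dense in H *)

Section homogeneous_combinations.
Variables (R : realType) (H : symmetric_fock R).
Local Notation FH := (fock_hilbert H).
Local Notation V := (ball2 R -> (R[i])^o).
Local Notation T := (R[i] * ball2 R * nat)%type.
Implicit Types (s : seq T) (p q : T).
Hint Resolve kfH oneH qfH : core.

Definition qcomb s : V := \sum_(p <- s) p.1.1 *: qf p.1.2 p.2.

(** The adjoint of z sends <., y>^(n+1) to conj y1 <., y>^n and kills constants. Constants stay in
    the list with coefficient 0, so that the shift is a [map]. *)
Definition qshift1 p : T :=
  (if p.2 == 0%N then 0 else p.1.1 * Num.conj (val p.1.2).1, p.1.2, p.2.-1).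
Definition qshift2 p : T :=
  (if p.2 == 0%N then 0 else p.1.1 * Num.conj (val p.1.2).2, p.1.2, p.2.-1).
Definition qconst p : R[i] := if p.2 == 0%N then p.1.1 else 0.

Lemma qcombH s : hset FH (qcomb s).
Proof. by apply: (subspace_sum (hsub FH)) => p _; exact: (hsetZ _ (qfH _ _ _)). Qed.

Lemma qcombE s x : qcomb s x = \sum_(p <- s) p.1.1 * ipc x p.1.2 ^+ p.2.
Proof. by rewrite /qcomb fct_sumE. Qed.

Lemma qcomb_decomp s : qcomb s = (\sum_(p <- s) qconst p) *: (fun=> 1)
  + (zmul (qcomb (map qshift1 s)) + wmul (qcomb (map qshift2 s))).
Proof.
apply/funext => x.
change (qcomb s x = (\sum_(p <- s) qconst p) * 1 +
  ((val x).1 * qcomb (map qshift1 s) x + (val x).2 * qcomb (map qshift2 s) x)).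
rewrite !qcombE !big_map mulr1 !mulr_sumr -!big_split /=; apply: eq_bigr => p _.
rewrite /qconst; case: p => [[c y] [|d]] /=; first by rewrite expr0; ring.
by rewrite exprS /ipc; ring.
Qed.

Lemma shift_pairing (c c' a1 a2 b1 b2 t : R[i]) :
  c * Num.conj c' * ((b1 * Num.conj a1 + b2 * Num.conj a2) * t) =
  c * Num.conj a1 * Num.conj (c' * Num.conj b1) * t
  + c * Num.conj a2 * Num.conj (c' * Num.conj b2) * t.
Proof. by rewrite !conjM !conjCK; ring. Qed.

(** By [ip_qf] only pairs of equal degree count, and one factor <y', y> of each splits into its two
    coordinates. Equality matters: it keeps the multiplier bound of [hmul_qcomb] from growing with
    the degree. *)
Lemma qcomb_nsq s : hnsq FH (qcomb s) = sqmod (\sum_(p <- s) qconst p)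
  + hnsq FH (qcomb (map qshift1 s)) + hnsq FH (qcomb (map qshift2 s)).
Proof.
have ipE s1 s2 : hip FH (qcomb s1) (qcomb s2) = \sum_(p <- s1) \sum_(q <- s2)
    p.1.1 * Num.conj q.1.1 * (if p.2 == q.2 then ipc q.1.2 p.1.2 ^+ p.2 else 0).
  rewrite {1}/qcomb ip_suml; last exact: qcombH;
    last by move=> p; exact: (hsetZ _ (qfH _ _ _)).
  apply: eq_bigr => p _; rewrite ip_sumr; last exact: (hsetZ _ (qfH _ _ _));
    last by move=> q; exact: (hsetZ _ (qfH _ _ _)).
  apply: eq_bigr => q _; rewrite ipZl; [|exact: qfH|exact: (hsetZ _ (qfH _ _ _))].
  by rewrite ipZr // ip_qf mulrA.
rewrite /hnsq !ipE -[sqmod _]/(complex.Re (sqmod _)%:C) -!ReD; congr complex.Re.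
rewrite -mulJ_sqmod !big_map conj_sum mulr_suml -!big_split /=.
apply: eq_bigr => p _; rewrite !big_map mulr_sumr -!big_split /=.
apply: eq_bigr => q _; rewrite /qconst.
case: p q => [[c y] [|d]] [[c' y'] [|d']] /=.
- by rewrite !mul0r !addr0 expr0 mulr1.
- by rewrite !mul0r !addr0 mulr0 rmorph0 mulr0.
- by rewrite !mul0r add0r rmorph0 !mulr0 !mul0r addr0.
- rewrite eqSS; case: eqP => _; last by rewrite !mulr0 rmorph0 !mul0r !addr0.
  by rewrite exprS mul0r add0r; exact: shift_pairing.
Qed.

Lemma qcomb_cat s s' : qcomb (s ++ s') = qcomb s + qcomb s'.
Proof. by rewrite /qcomb big_cat. Qed.

Lemma qcomb_scale (a : R[i]) s :
  qcomb (map (fun p => (a * p.1.1, p.1.2, p.2)) s) = a *: qcomb s.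
Proof.
rewrite /qcomb big_map scaler_sumr; apply: eq_bigr => p _.
by rewrite scalerA.
Qed.

Lemma qcomb_dense : hset FH `<=` hcl FH (range qcomb).
Proof.
apply: dense_orthogonal => //.
- split; first by exists [::] => //; rewrite /qcomb big_nil.
  move=> a _ _ [s _ <-] [s' _ <-].
  exists (map (fun p => (a * p.1.1, p.1.2, p.2)) s ++ s') => //.
  by rewrite qcomb_cat qcomb_scale.
- by move=> _ [s _ <-]; exact: qcombH.
- exact: hcl_sub.
- move=> g Hg h; apply: (ip_qf_eq0 Hg) => y n; rewrite (hip_conj (qfH H y n) Hg) h ?rmorph0 //.
  by exists [:: (1, y, n)] => //; rewrite /qcomb big_seq1 scale1r.
Qed.

End homogeneous_combinations.

(** * Column multipliers from representing functions *)

Lemma row_vector_identity (A : comNzRingType) (W : lmodType A)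
    (x z1 z2 l1 l2 : A) (k u w : W) :
  x *: ((1 - (z1 * l1 + z2 * l2)) *: k) + (z1 *: u + z2 *: w) =
  x *: k + (z1 *: (u - (x * l1) *: k) + z2 *: (w - (x * l2) *: k)).
Proof.
have -> : x *: ((1 - (z1 * l1 + z2 * l2)) *: k) =
    x *: k - ((z1 * (x * l1)) *: k + (z2 * (x * l2)) *: k).
  by rewrite -scalerDl -scalerBl scalerA; congr (_ *: k); ring.
by rewrite !scalerBr !scalerA -addrA [X in _ = _ + X]addrACA -opprD
  [X in _ + X = _]addrC.
Qed.

Lemma scaler_decomp (A : pzRingType) (W : lmodType A) (t z1 z2 q1 q2 : A) (v : W) :
  (t * 1 + (z1 * q1 + z2 * q2)) *: v =
  t *: v + (z1 *: (q1 *: v) + z2 *: (q2 *: v)).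
Proof. by rewrite mulr1 !scalerDl !scalerA. Qed.

Lemma row_norm_identity (R : realType) (x l1 l2 u w : R[i]) (nk nu nw : R) :
  (1 - (sqmod l1 + sqmod l2)) * nk * sqmod x
  + (nu + sqmod (x * Num.conj l1) * nk + 2 * complex.Re (Num.conj (x * Num.conj l1) * u))
  + (nw + sqmod (x * Num.conj l2) * nk + 2 * complex.Re (Num.conj (x * Num.conj l2) * w))
  = sqmod x * nk + (nu + nw) + 2 * complex.Re (x * Num.conj (l1 * u + l2 * w)).
Proof.
rewrite !sqmodM !sqmodJ !ReImE /sqmod.
by case: x l1 l2 u w => [x1 x2] [a1 a2] [b1 b2] [u1 u2] [w1 w2] /=; ring.
Qed.

Section vector_valued.
Variables (R : realType) (H : symmetric_fock R) (N : nat).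
Local Notation FH := (fock_hilbert H).
Local Notation VH := (vfock_hilbert H N).
Local Notation VF := (ball2 R -> 'rV[R[i]]_N).
Implicit Types (F G U W : VF).

Lemma poly_actX F : poly_act 'X F = zmul F.
Proof. by apply/funext => x; rewrite /poly_act /zmul hornerX hornerC. Qed.

Lemma poly_actY F : poly_act 'Y F = wmul F.
Proof. by apply/funext => x; rewrite /poly_act /wmul hornerC hornerX. Qed.

Lemma entry_zmul i F : entry i (zmul F) = zmul (entry i F).
Proof. by apply/funext => x; rewrite /entry /zmul mxE. Qed.

Lemma entry_wmul i F : entry i (wmul F) = wmul (entry i F).
Proof. by apply/funext => x; rewrite /entry /wmul mxE. Qed.

Lemma vrow_contraction U W : hset VH U -> hset VH W ->
  hset VH (zmul U + wmul W) /\
  hnsq VH (zmul U + wmul W) <= hnsq VH U + hnsq VH W.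
Proof.
move=> HU HW.
have e i : entry i (zmul U + wmul W) = zmul (entry i U) + wmul (entry i W).
  by rewrite -[zmul U]scale1r entry_lin scale1r entry_zmul entry_wmul.
have h i := row_contraction (HU i) (HW i).
split; first by move=> i; rewrite e; case: (h i).
rewrite !vfock_nsq -big_split /=; apply: ler_sum => i _.
by rewrite e; case: (h i).
Qed.

Lemma point_bound f x : hset FH f -> sqmod (f x) <= hnsq FH f * hnsq FH (kf x).
Proof.
by move=> Hf; rewrite -(reproducing x Hf); apply: cauchy_schwarz => //; exact: kfH.
Qed.

Lemma entry_nsq_le i F : vfock H F -> hnsq FH (entry i F) <= hnsq VH F.
Proof.
move=> HF; rewrite vfock_nsq (bigD1 i) //= lerDl; apply: sumr_ge0 => j _.
by apply: nsq_ge0; exact: HF.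
Qed.

Variable M : set VF.
Hypothesis iM : invariant_subspace H M.

Let MS : M `<=` hset VH := inv_sub iM.
Let sM : subspace M := inv_subspace iM.

Lemma inv_zmul F : M F -> M (zmul F).
Proof. by move=> MF; rewrite -poly_actX; exact: (inv_mulz iM). Qed.

Lemma inv_wmul F : M F -> M (wmul F).
Proof. by move=> MF; rewrite -poly_actY; exact: (inv_mulw iM). Qed.

Variables (lam : ball2 R) (K : VF).
Hypotheses (MK : M K)
  (Kz : forall U, M U -> hip VH (zmul U) K = (val lam).1 * hip VH U K)
  (Kw : forall U, M U -> hip VH (wmul U) K = (val lam).2 * hip VH U K).

(** K divided by the kernel k_lam. When M is the whole space, the representer is k_lam times a
    constant vector, and the quotient is that constant. *)
Definition quotient_fun : VF := hmul (fun x => 1 - ipc x lam) K.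
Let phi := quotient_fun.
Let D := (1 - bnsq lam) * hnsq VH K.

Let D0 : 0 <= D.
Proof.
apply: mulr_ge0; last by apply: nsq_ge0; exact: MS.
by rewrite subr_ge0; apply: ltW; apply: bnsq_lt1.
Qed.

(** With U' = U - x conj(lam1) K and W' likewise, x phi + zU + wW = xK + zU' + wW'. After expansion,
    [Kz] and [Kw] make the cross terms on both sides equal, and what remains is |zU' + wW'|^2 <=
    |U'|^2 + |W'|^2. *)
Lemma quotient_fun_row (x : R[i]) U W : M U -> M W ->
  M (x *: phi + (zmul U + wmul W)) /\
  hnsq VH (x *: phi + (zmul U + wmul W))
    <= D * sqmod x + hnsq VH U + hnsq VH W.
Proof.
move=> MU MW.
set a := x * Num.conj (val lam).1; set b := x * Num.conj (val lam).2.
pose U' := U - a *: K; pose W' := W - b *: K.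
have MU' : M U' by apply: subspaceB => //; apply: subspaceZ.
have MW' : M W' by apply: subspaceB => //; apply: subspaceZ.
have -> : x *: phi + (zmul U + wmul W) = x *: K + (zmul U' + wmul W').
  apply/funext => t.
  exact: (row_vector_identity x (val t).1 (val t).2 (Num.conj (val lam).1)
    (Num.conj (val lam).2) (K t) (U t) (W t)).
have HK := MS MK; have HU := MS MU; have HW := MS MW.
have HU' := MS MU'; have HW' := MS MW'.
have [HT nT] := vrow_contraction HU' HW'.
have HZ := MS (inv_zmul MU'); have HWW := MS (inv_wmul MW').
split.
  by apply: subspaceD; [|apply: subspaceZ|apply: subspaceD => //; [apply: inv_zmul|apply: inv_wmul]].
have eU : hnsq VH U = hnsq VH (U' + a *: K) by rewrite subrK.
have eW : hnsq VH W = hnsq VH (W' + b *: K) by rewrite subrK.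
have ea : a = x * Num.conj (val lam).1 by [].
have eb : b = x * Num.conj (val lam).2 by [].
clearbody U' W' a b.
rewrite eU eW.
rewrite (nsqD HU' (hsetZ a HK)) (nsqD HW' (hsetZ b HK)) (nsqD (hsetZ x HK) HT).
rewrite (nsqZ a HK) (nsqZ b HK) (nsqZ x HK).
have e1 : hip VH (x *: K) (zmul U' + wmul W') =
    x * Num.conj ((val lam).1 * hip VH U' K + (val lam).2 * hip VH W' K).
  by rewrite (ipZl _ HK HT) (hip_conj HT HK) (ipDl HZ HWW HK) (Kz MU') (Kw MW').
have e2 := row_norm_identity x (val lam).1 (val lam).2 (hip VH U' K) (hip VH W' K)
  (hnsq VH K) (hnsq VH U') (hnsq VH W').
have eD : D = (1 - (sqmod (val lam).1 + sqmod (val lam).2)) * hnsq VH K by [].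
rewrite -ea -eb in e2; rewrite e1.
have e3 := ipZr a HK HU'; have e4 := ipZr b HK HW'.
rewrite e3 e4 eD e2.
by rewrite lerD2r lerD2l.
Qed.

(** Induction on the degree: with h = t + z a + w b, the row estimate gives D |t|^2 + |a phi|^2 + |b
    phi|^2, and by induction this is at most D (|t|^2 + |a|^2 + |b|^2) = D |h|^2. *)
Lemma hmul_qcomb s : M (hmul (qcomb s) phi) /\
  hnsq VH (hmul (qcomb s) phi) <= D * hnsq FH (qcomb s).
Proof.
have [n hn] : exists n, all (fun p => p.2 <= n)%N s.
  exists (\max_(p <- s) p.2)%N; apply/allP => p ps.
  by rewrite (big_rem p) //= leq_maxl.
have dec s' : hmul (qcomb s') phi = (\sum_(p <- s') qconst p) *: phi
   + (zmul (hmul (qcomb (map (@qshift1 R) s')) phi)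
      + wmul (hmul (qcomb (map (@qshift2 R) s')) phi)).
  apply/funext => x; rewrite {1}/hmul {1}qcomb_decomp.
  change (((\sum_(p <- s') qconst p) * 1 + ((val x).1 * qcomb (map (@qshift1 R) s') x
     + (val x).2 * qcomb (map (@qshift2 R) s') x)) *: phi x =
    (\sum_(p <- s') qconst p) *: phi x +
    ((val x).1 *: (qcomb (map (@qshift1 R) s') x *: phi x)
     + (val x).2 *: (qcomb (map (@qshift2 R) s') x *: phi x))).
  exact: scaler_decomp.
elim: n s hn => [|n IH] s hs.
  have z1 : qcomb (map (@qshift1 R) s) = 0.
    apply/funext => x; rewrite qcombE big_map big1_seq // => p /andP[_ ps].
    by have /allP/(_ p ps) := hs; rewrite leqn0 /qshift1 => /eqP -> /=; rewrite mul0r.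
  have z2 : qcomb (map (@qshift2 R) s) = 0.
    apply/funext => x; rewrite qcombE big_map big1_seq // => p /andP[_ ps].
    by have /allP/(_ p ps) := hs; rewrite leqn0 /qshift2 => /eqP -> /=; rewrite mul0r.
  have z : hmul 0 phi = 0 by apply/funext => x; exact: scale0r.
  rewrite dec qcomb_nsq z1 z2 z nsq0 !addr0.
  have [h1 h2] := quotient_fun_row (\sum_(p <- s) qconst p) (subspace0 sM) (subspace0 sM).
  by rewrite !nsq0 !addr0 in h2.
have hs1 : all (fun p => p.2 <= n)%N (map (@qshift1 R) s).
  rewrite all_map; apply/allP => p ps; have /allP/(_ p ps) := hs.
  by rewrite /= /qshift1 /=; case: (p.2).
have hs2 : all (fun p => p.2 <= n)%N (map (@qshift2 R) s).
  rewrite all_map; apply/allP => p ps; have /allP/(_ p ps) := hs.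
  by rewrite /= /qshift2 /=; case: (p.2).
have [m1 b1] := IH _ hs1; have [m2 b2] := IH _ hs2.
rewrite dec qcomb_nsq.
have [h1 h2] := quotient_fun_row (\sum_(p <- s) qconst p) m1 m2.
split=> //; apply: le_trans h2 _; rewrite !mulrDr.
by apply: lerD => //; apply: lerD.
Qed.

Lemma quotient_fun_multiplier h : hset FH h ->
  M (hmul h phi) /\ hnsq VH (hmul h phi) <= D * hnsq FH h.
Proof.
move=> Hh.
have [u Qu cu] := hcl_cvg (A := range (@qcomb R)) (fun f '(ex_intro2 s _ e) =>
   ltac:(rewrite -e; exact: (qcombH H s))) (qcomb_dense Hh).
have Hu n : hset FH (u n) by case: (Qu n) => s _ <-; exact: qcombH.
have hu n : M (hmul (u n) phi) by case: (Qu n) => s _ <-; case: (hmul_qcomb s).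
have hub n m : hnsq VH (hmul (u n) phi - hmul (u m) phi) <= D * hnsq FH (u n - u m).
  have [s _ es] := Qu n; have [s' _ es'] := Qu m.
  pose s'' := s ++ map (fun p => (-1 * p.1.1, p.1.2, p.2)) s'.
  have e : qcomb s'' = u n - u m by rewrite qcomb_cat qcomb_scale scaleN1r es es'.
  have [_] := hmul_qcomb s''; rewrite e.
  suff -> : hmul (u n - u m) phi = hmul (u n) phi - hmul (u m) phi by [].
  by apply/funext => x; exact: scalerBl.
have Sn n := MS (hu n).
have d1 : 0 < D + 1 by rewrite ltr_wpDl.
have [F HF cF] : exists2 F, hset VH F & hcvg VH (fun n => hmul (u n) phi) F.
  apply: hcauchy_cvg => // e e0.
  (* Using D < (D + 1)^2 avoids the square root of D. *)
  pose e' := e / (2 * (D + 1)).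
  have e'0 : 0 < e' by rewrite divr_gt0 // mulr_gt0.
  have ee : e = e' * (2 * (D + 1)) by rewrite /e' divfK // lt0r_neq0 // mulr_gt0.
  have [n0 hn0] := cu e' e'0; exists n0 => m n hm hn.
  rewrite nrm_lt //.
  apply: le_lt_trans (hub m n) _.
  have := nrm_triangle (Hu m) Hh (Hu n).
  rewrite [hnrm _ (h - u n)]nrm_distC // -nrm_sqr //.
  have := hn0 m hm; have := hn0 n hn; have := nrm_ge0 FH (u m - u n).
  move: (hnrm _ _) (hnrm _ _) (hnrm _ _) => A B C C0 hB hC hA.
  have h1 : C <= 2 * e' by lra.
  have h2 : C ^+ 2 <= (2 * e') ^+ 2 by nra.
  rewrite ee; apply: le_lt_trans (ler_wpM2l D0 h2) _.
  have -> : (e' * (2 * (D + 1))) ^+ 2 = D * (2 * e') ^+ 2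
     + (D ^+ 2 + D + 1) * (2 * e') ^+ 2 by ring.
  have e2 : 0 < (2 * e') ^+ 2 by rewrite exprn_gt0 // mulr_gt0.
  rewrite ltrDl; apply: mulr_gt0 => //.
  by have := sqr_ge0 D; have := D0; move: (D) => dd d0 d2; nra.
have MF : M F by apply: (inv_hcl iM); apply: hcvg_cl cF.
(* Point evaluations are bounded, so both u n -> h and (u n) phi -> F hold pointwise; B below
   collects the two evaluation errors. *)
have FE : F = hmul h phi.
  apply/funext => x; apply/rowP => i; apply/eqP; rewrite -subr_eq0; apply/eqP.
  apply: sqmod_eq0; apply/ler_addgt0Pr => e e0; rewrite add0r.
  pose k := hnsq FH (kf x); have k0 : 0 <= k by apply: nsq_ge0; exact: kfH.
  pose c := sqmod (phi x 0 i); have c0 : 0 <= c by exact: sqmod_ge0.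
  pose B := 2 * k + 2 * k * c + 1.
  have B0 : 0 < B by rewrite ltr_wpDl // addr_ge0 ?mulr_ge0.
  pose d := Num.sqrt (e / B).
  have d0 : 0 < d by rewrite sqrtr_gt0 divr_gt0.
  have dd : d ^+ 2 * B = e.
    by rewrite sqr_sqrtr ?divfK ?lt0r_neq0 // divr_ge0 // ltW.
  have [n1 hn1] := cF d d0; have [n2 hn2] := cu d d0.
  pose n := maxn n1 n2.
  have g1 := hn1 n (leq_maxl _ _); have g2 := hn2 n (leq_maxr _ _).
  rewrite nrm_lt // in g1.
  rewrite nrm_lt // in g2.
  have HE : vfock H (hmul (u n) phi - F) by exact: (hsetB (Sn n) HF).
  have b1 := point_bound x (HE i).
  have b2 := point_bound x (hsetB (Hu n) Hh).
  have b3 := entry_nsq_le i HE.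
  have -> : F x 0 i - hmul h phi x 0 i =
     - entry i (hmul (u n) phi - F) x + (u n - h) x * phi x 0 i.
    rewrite entryB.
    change (F x 0 i - (h x *: phi x) 0 i = - ((u n x *: phi x) 0 i - F x 0 i)
      + (u n x - h x) * phi x 0 i).
    by rewrite !mxE; ring.
  apply: le_trans (sqmodD _ _) _; rewrite sqmodN sqmodM -dd -/c.
  rewrite -/k in b1 b2.
  have b4 : sqmod (entry i (hmul (u n) phi - F) x) <= d ^+ 2 * k.
    apply: le_trans b1 _; apply: ler_wpM2r => //; apply: le_trans b3 _; exact: ltW.
  have b5 : sqmod ((u n - h) x) <= d ^+ 2 * k.
    by apply: le_trans b2 _; apply: ler_wpM2r => //; exact: ltW.
  have b6 : sqmod ((u n - h) x) * c <= d ^+ 2 * k * c by rewrite ler_wpM2r.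
  have d2 := sqr_ge0 d.
  rewrite /B; move: b4 b6 d2; move: (sqmod _) (sqmod _ * c) (d ^+ 2) => A1 A2 A3; nra.
rewrite -FE; split=> //.
apply/ler_addgt0Pr => e e0.
pose sD := Num.sqrt D; have sD0 : 0 <= sD by rewrite sqrtr_ge0.
have sD2 : sD ^+ 2 = D by rewrite sqr_sqrtr.
pose A := sD * hnrm FH h; have A0 : 0 <= A by rewrite mulr_ge0 ?nrm_ge0.
have nA : hnrm VH F <= A.
  apply/ler_addgt0Pr => d d0.
  pose d' := d / (1 + sD).
  have s1 : 0 < 1 + sD by rewrite ltr_pwDl.
  have d'0 : 0 < d' by rewrite divr_gt0.
  have dd : d = d' * (1 + sD) by rewrite /d' divfK // lt0r_neq0.
  have [n1 hn1] := cF d' d'0; have [n2 hn2] := cu d' d'0.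
  pose n := maxn n1 n2.
  have g1 := hn1 n (leq_maxl _ _); have g2 := hn2 n (leq_maxr _ _).
  have b1 : hnrm VH (hmul (u n) phi) <= sD * hnrm FH (u n).
    have [s _ es] := Qu n; have [_] := hmul_qcomb s; rewrite es.
    rewrite -nrm_sqr // -[hnsq FH (u n)]nrm_sqr // -sD2 -exprMn.
    by apply: sqr_leW; rewrite mulr_ge0 ?nrm_ge0.
  have b2 := nrmD (Hu n) (hsetN (Hu n)).
  have b3 : hnrm FH (u n) <= hnrm FH h + d'.
    have -> : u n = h + (u n - h) by rewrite addrCA subrr addr0.
    by apply: le_trans (nrmD Hh (hsetB (Hu n) Hh)) _; rewrite lerD2l ltW.
  have b4 : hnrm VH F <= hnrm VH (hmul (u n) phi) + d'.
    have -> : F = hmul (u n) phi + (F - hmul (u n) phi) by rewrite addrCA subrr addr0.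
    apply: le_trans (nrmD (Sn n) (hsetB HF (Sn n))) _.
    by rewrite lerD2l nrm_distC // ltW.
  by rewrite dd /A; nra.
rewrite -nrm_sqr // -[hnsq FH h]nrm_sqr // -sD2 -exprMn -/A.
apply: ler_wpDr; first exact: ltW.
by rewrite ler_pXn2r ?nnegrE ?nrm_ge0.
Qed.

End vector_valued.

(** * Powers of the maximal ideal *)

Section powers.
Variables (R : realType) (W : lmodType R[i]).
Local Notation F := (ball2 R -> W).
Implicit Types (M : set F) (f g : F) (p q : {poly {poly R[i]}}).

(** I^k M obtained by iterating M -> zM + wM, so that each power is the range of (z, w) on the
    previous one, the shape required by [closed_range]. Agreement with the definition by ideals is
    [ideal_act_ipow]. *)
Fixpoint ipow k M : set F :=
  if k is k'.+1 then
    [set v | exists f g, [/\ ipow k' M f, ipow k' M g & v = zmul f + wmul g]]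
  else M.

Definition stable M := (forall f, M f -> M (zmul f)) /\ (forall f, M f -> M (wmul f)).

Definition pf p : ball2 R -> R[i] := fun x => p.[(val x).1, (val x).2].

Lemma ipow_subspace k M : subspace M -> subspace (ipow k M).
Proof.
move=> sM; elim: k => [//|k IH] /=; split.
  by exists 0, 0; split; rewrite ?(zmulE 0) ?(wmulE 0) ?hmul0 ?addr0 //; exact: subspace0.
move=> a _ _ [f [g [Mf Mg ->]]] [f' [g' [Mf' Mg' ->]]].
exists (a *: f + f'), (a *: g + g'); split; try exact: subspaceP.
by rewrite zmul_lin wmul_lin scalerDr addrACA.
Qed.

Lemma zmul_wmul f : zmul (wmul f) = wmul (zmul f).
Proof. exact: hmulC. Qed.

Lemma ipow_stable k M : stable M -> stable (ipow k M).
Proof.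
move=> [sz sw]; elim: k => [//|k [IHz IHw]]; split=> _ [f [g [Mf Mg ->]]] /=.
  exists (zmul f), (zmul g); split; [exact: IHz|exact: IHz|].
  by rewrite (zmulE (_ + _)) hmulDr -!zmulE zmul_wmul.
exists (wmul f), (wmul g); split; [exact: IHw|exact: IHw|].
by rewrite (wmulE (_ + _)) hmulDr -!wmulE zmul_wmul.
Qed.

Lemma ipow_subS k M : subspace M -> stable M -> ipow k.+1 M `<=` ipow k M.
Proof.
move=> sM tM _ [f [g [Mf Mg ->]]].
have [hz hw] := ipow_stable k tM.
by apply: (subspaceD (ipow_subspace k sM)); [exact: hz|exact: hw].
Qed.

Lemma ipow_sub k M : subspace M -> stable M -> ipow k M `<=` M.
Proof.
move=> sM tM; elim: k => [//|k IH].
by apply: subset_trans IH; exact: ipow_subS.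
Qed.

Lemma pfD p q x : pf (p + q) x = pf p x + pf q x.
Proof. by rewrite /pf !hornerD. Qed.
Lemma pfB p q x : pf (p - q) x = pf p x - pf q x.
Proof. by rewrite /pf !hornerD !hornerN. Qed.
Lemma pfM p q x : pf (p * q) x = pf p x * pf q x.
Proof. by rewrite /pf !hornerM. Qed.
Lemma pfC c x : pf c%:P%:P x = c.
Proof. by rewrite /pf !hornerC. Qed.
Lemma pfX x : pf 'X x = (val x).1.
Proof. by rewrite /pf hornerX hornerC. Qed.
Lemma pfY x : pf 'Y x = (val x).2.
Proof. by rewrite /pf hornerC hornerX. Qed.
Lemma pf0 x : pf 0 x = 0.
Proof. by rewrite /pf !horner0. Qed.

Lemma hmul_pfD p q f : hmul (pf (p + q)) f = hmul (pf p) f + hmul (pf q) f.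
Proof. by rewrite -hmulDl; congr (hmul _ f); apply/funext => x; rewrite pfD. Qed.
Lemma hmul_pfM p q f : hmul (pf (p * q)) f = hmul (pf p) (hmul (pf q) f).
Proof. by rewrite hmulA; congr (hmul _ f); apply/funext => x; rewrite pfM. Qed.
Lemma hmul_pfC c f : hmul (pf c%:P%:P) f = c *: f.
Proof. by apply/funext => x; rewrite /hmul pfC. Qed.
Lemma hmul_pfX f : hmul (pf 'X) f = zmul f.
Proof. by apply/funext => x; rewrite /hmul pfX. Qed.
Lemma hmul_pfY f : hmul (pf 'Y) f = wmul f.
Proof. by apply/funext => x; rewrite /hmul pfY. Qed.
Lemma hmul_pf0 f : hmul (pf 0) f = 0.
Proof. by apply/funext => x; rewrite /hmul pf0; exact: scale0r. Qed.
Lemma hmul_pf_sum (I : Type) (r : seq I) (P : I -> {poly {poly R[i]}}) f :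
  hmul (pf (\sum_(i <- r) P i)) f = \sum_(i <- r) hmul (pf (P i)) f.
Proof.
elim: r => [|i r IH]; first by rewrite !big_nil hmul_pf0.
by rewrite !big_cons hmul_pfD IH.
Qed.

Lemma stable_pf M p f : subspace M -> stable M -> M f -> M (hmul (pf p) f).
Proof.
move=> sM [tz tw] Mf.
have hC (c : {poly R[i]}) : M (hmul (pf c%:P) f).
  elim/poly_ind: c => [|c a IH]; first by rewrite hmul_pf0; exact: subspace0.
  rewrite polyCD polyCM hmul_pfD mulrC hmul_pfM hmul_pfY hmul_pfC.
  by apply: subspaceD; [|exact: tw|exact: subspaceZ].
elim/poly_ind: p => [|p c IH]; first by rewrite hmul_pf0; exact: subspace0.
rewrite hmul_pfD mulrC hmul_pfM hmul_pfX.
by apply: subspaceD => //; exact: tz.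
Qed.

Lemma jet0_ipow k M p f : subspace M -> stable M -> M f -> jet0 k p ->
  ipow k M (hmul (pf p) f).
Proof.
move=> sM tM Mf; elim: k p => [|k IH] p jp; first exact: stable_pf.
have [a [b [ja jb ->]]] := jet0_step jp.
exists (hmul (pf a) f), (hmul (pf b) f); split; [exact: IH|exact: IH|].
by rewrite hmul_pfD !(mulrC _ 'X) (mulrC _ 'Y) !hmul_pfM hmul_pfX hmul_pfY.
Qed.

End powers.

Lemma bivariate_lin1 (A : comNzRingType) :
  exists a b : {poly {poly A}}, 'X = a * 'X + b * 'Y.
Proof. by exists 1, 0; rewrite mul1r mul0r addr0. Qed.

Lemma bivariate_lin2 (A : comNzRingType) :
  exists a b : {poly {poly A}}, 'Y = a * 'X + b * 'Y.
Proof. by exists 0, 1; rewrite mul1r mul0r add0r. Qed.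

Section ideal_powers.
Variables (R : realType) (N : nat).
Local Notation VF := (ball2 R -> 'rV[R[i]]_N).
Local Notation I := (maxideal R).
Implicit Types (M : set VF).

Lemma poly_actE (p : {poly {poly R[i]}}) (F : VF) : poly_act p F = hmul (pf p) F.
Proof. by []. Qed.

Lemma maxidealX : I 'X.
Proof. exact: bivariate_lin1. Qed.

Lemma maxidealY : I 'Y.
Proof. exact: bivariate_lin2. Qed.

Lemma maxideal_act M (p : {poly {poly R[i]}}) k F : subspace M -> stable M ->
  I p -> ipow k M F -> ipow k.+1 M (poly_act p F).
Proof.
move=> sM tM [a [b ->]] MF.
have sk := ipow_subspace k sM; have tk := ipow_stable k tM.
exists (poly_act a F), (poly_act b F); split.
- exact: (stable_pf a sk tk MF).
- exact: (stable_pf b sk tk MF).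
by rewrite !poly_actE hmul_pfD !(mulrC _ 'X) (mulrC _ 'Y) !hmul_pfM hmul_pfX hmul_pfY.
Qed.

Lemma ideal_exp_act M k (p : {poly {poly R[i]}}) F : subspace M -> stable M ->
  ideal_exp I k p -> M F -> ipow k M (poly_act p F).
Proof.
move=> sM tM; elim: k p F => [|k IH] p F; first by move=> _ MF; exact: (stable_pf p sM tM MF).
move=> [n [a [b [Ia Ib ->]]]] MF.
rewrite poly_actE hmul_pf_sum.
apply: (subspace_sum (ipow_subspace k.+1 sM)) => i _.
by rewrite hmul_pfM; exact: (maxideal_act sM tM (Ia i) (IH _ _ (Ib i) MF)).
Qed.

Lemma ideal_act_ipow M k : subspace M -> stable M ->
  ideal_act (@poly_act R N) (ideal_exp I k) M = ipow k M.
Proof.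
move=> sM tM; apply/seteqP; split.
  move=> _ [n [a [m [Ia Mm ->]]]].
  apply: (subspace_sum (ipow_subspace k sM)) => i _.
  exact: ideal_exp_act.
elim: k => [|k IH] F /=.
  move=> MF; exists 1%N, (fun=> 1), (fun=> F); split=> //.
  by rewrite big_ord1 poly_actE -[1]/(1%:P%:P) hmul_pfC scale1r.
move=> [f [g [/IH[n [a [m [Ia Mm ef]]]] /IH[n' [a' [m' [Ia' Mm' eg]]]] ->]]].
have step (q p : {poly {poly R[i]}}) : I q -> ideal_exp I k p -> ideal_exp I k.+1 (q * p).
  by move=> Iq Ip; exists 1%N, (fun=> q), (fun=> p); split=> //; rewrite big_ord1.
have IX := maxidealX; have IY := maxidealY.
(* The presentations of f and g are concatenated, their coefficients multiplied by z and by w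
   respectively. *)
exists (n + n')%N,
  (fun i => match fintype.split i with inl j => 'X * a j | inr j => 'Y * a' j end),
  (fun i => match fintype.split i with inl j => m j | inr j => m' j end); split.
- by move=> i; case: (fintype.split i) => j; apply: step.
- by move=> i; case: (fintype.split i).
- rewrite big_split_ord /=; congr (_ + _).
    rewrite ef zmulE hmul_sumr; apply: eq_bigr => i _.
    have -> : fintype.split (lshift n' i) = inl i := unsplitK (inl i).
    by rewrite !poly_actE hmul_pfM hmul_pfX.
  rewrite eg wmulE hmul_sumr; apply: eq_bigr => i _.
  have -> : fintype.split (rshift n i) = inr i := unsplitK (inr i).
  by rewrite !poly_actE hmul_pfM hmul_pfY.
Qed.

Lemma ideal_act_maxideal M : subspace M -> stable M ->
  ideal_act (@poly_act R N) I M = ipow 1 M.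
Proof.
move=> sM tM; apply/seteqP; split.
  move=> _ [n [a [m [Ia Mm ->]]]].
  apply: (subspace_sum (ipow_subspace 1 sM)) => i _.
  by apply: (@maxideal_act M _ 0).
move=> _ [f [g [Mf Mg ->]]].
exists 2%N, (fun i => if i == 0 then 'X else 'Y), (fun i => if i == 0 then f else g); split.
- by move=> i; case: ifP => _; [exact: maxidealX|exact: maxidealY].
- by move=> i; case: ifP.
- by rewrite big_ord_recl big_ord1 /= poly_actX poly_actY.
Qed.

End ideal_powers.

(** * Order of vanishing and powers of I in the Fock space *)

Section orders.
Variables (R : realType) (H : symmetric_fock R).
Local Notation FH := (fock_hilbert H).
Local Notation V := (ball2 R -> (R[i])^o).
Local Notation Hset := (hset (fock_hilbert H)).
Implicit Types (f g h : V) (p q : {poly {poly R[i]}}).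
Hint Resolve kfH oneH : core.

Lemma fock_stable : stable Hset.
Proof. by split=> f; [exact: zmulH|exact: wmulH]. Qed.

Let sH : subspace Hset := hsub FH.

Lemma ordgeD k f g : ordge k f -> ordge k g -> ordge k (f + g).
Proof.
move=> hf hg y; have [B1 B10 h1] := hf y; have [B2 B20 h2] := hg y.
exists (2 * B1 + 2 * B2); first by rewrite addr_ge0 // mulr_ge0.
move=> t ht; apply: le_trans (sqmodD _ _) _.
have := h1 t ht; have := h2 t ht; move: (_ ^+ 2) => T a b.
have -> : (2 * B1 + 2 * B2) * T = 2 * (B1 * T) + 2 * (B2 * T) by ring.
by lra.
Qed.

Lemma ordgeN k f : ordge k f -> ordge k (- f).
Proof.
move=> hf y; have [B B0 h] := hf y; exists B => // t ht.
by rewrite -[(- f) _]/(- f _) sqmodN; exact: h.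
Qed.

Lemma ordgeB k f g : ordge k f -> ordge k g -> ordge k (f - g).
Proof. by move=> hf hg; apply: ordgeD => //; exact: ordgeN. Qed.

Lemma ordge0_fock f : Hset f -> ordge 0 f.
Proof.
move=> Hf y; exists (hnsq FH f * (1 - bnsq y)^-1).
  by rewrite mulr_ge0 ?nsq_ge0 // invr_ge0 subr_ge0 ltW // bnsq_lt1.
move=> t ht; rewrite expr0 expr1n mulr1.
apply: le_trans (point_bound _ Hf) _; rewrite ler_wpM2l ?nsq_ge0 //.
rewrite kf_nsq lef_pV2 ?posrE ?subr_gt0 ?bnsq_lt1 //.
by rewrite lerD2l lerN2 bnsq_scale.
Qed.

Lemma ordgeM k l (a b : V) : ordge k a -> ordge l b ->
  ordge (k + l) (fun x => a x * b x : R[i]).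
Proof.
move=> ha hb y; have [B1 B10 h1] := ha y; have [B2 B20 h2] := hb y.
exists (B1 * B2); first by rewrite mulr_ge0.
move=> t ht; rewrite sqmodM exprD exprMn mulrACA.
by apply: ler_pM; rewrite ?sqmod_ge0 //; [exact: h1|exact: h2].
Qed.

Lemma ordge_coord (c : ball2 R -> R[i]) : (forall y t, 0 <= t <= 1 ->
  c (bscale t y) = t%:C * c y) -> ordge 1 (c : V).
Proof.
move=> hc y; exists (sqmod (c y)); first exact: sqmod_ge0.
by move=> t ht; rewrite hc // sqmodM sqmodC expr1 mulrC.
Qed.

Lemma ordge_ipow k f : ipow k Hset f -> ordge k f.
Proof.
elim: k f => [|k IH] f; first exact: ordge0_fock.
move=> [g [h [/IH og /IH oh ->]]]; apply: ordgeD.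
  apply: (@ordgeM 1 k (fun x => (val x).1 : R[i])) => //.
  by apply: ordge_coord => y t ht; rewrite val_bscale.
apply: (@ordgeM 1 k (fun x => (val x).2 : R[i])) => //.
by apply: ordge_coord => y t ht; rewrite val_bscale.
Qed.

Lemma pf_fock p : Hset (pf p).
Proof.
have := stable_pf p sH fock_stable (oneH H); suff <- : pf p = hmul (pf p) (fun=> 1 : (R[i])^o) by [].
by apply/funext => x; rewrite /hmul; exact: (esym (mulr1 _)).
Qed.

Lemma jet0_pf k p : jet0 k p -> ipow k Hset (pf p).
Proof.
move=> /(jet0_ipow sH fock_stable (oneH H)).
suff <- : pf p = hmul (pf p) (fun=> 1 : (R[i])^o) by [].
by apply/funext => x; rewrite /hmul; exact: (esym (mulr1 _)).
Qed.

Lemma poly_eq0_of_zeros (r : {poly R[i]}) : (forall u, r.[u] = 0) -> r = 0.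
Proof.
move=> h; apply: (@roots_geq_poly_eq0 _ _ [seq i%:R | i <- iota 0 (size r)]).
- by apply/allP => u _; rewrite /root h.
- rewrite map_inj_uniq ?iota_uniq // => i j /eqP.
  by rewrite eqr_nat => /eqP.
- by rewrite size_map size_iota.
Qed.

(** On the ray through (s, su), p becomes a polynomial in t whose m-th coefficient is s^m times that
    of [blowup p] at u; decay of order k kills it for m < k, at every u. *)
Lemma ordge_jet0 k p : ordge k (pf p : V) -> jet0 k p.
Proof.
move=> op; apply/jet0_blowup => m mk; apply: poly_eq0_of_zeros => u.
pose U := sqmod u; have U0 : 0 <= U := sqmod_ge0 u.
(* This puts (s, su) in the ball: s^2 (1 + |u|^2) = s / 2 < 1. *)
pose s : R := (2 * (1 + U))^-1.
have U1 : 0 < 2 * (1 + U) by rewrite mulr_gt0 // ltr_pwDl.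
have s0 : 0 < s by rewrite invr_gt0.
have sU : s * (2 * (1 + U)) = 1 by rewrite mulVf // lt0r_neq0.
have hb : `|(s%:C, s%:C * u).1| ^+ 2 + `|(s%:C, s%:C * u).2| ^+ 2 < 1.
  by rewrite in_ballE /= sqmodM sqmodC -/U; nra.
pose y : ball2 R := Sub (s%:C, s%:C * u) hb.
have [B B0 hB] := op y.
pose q := \poly_(i < size (blowup p)) (((blowup p)`_i).[u] * s%:C ^+ i).
have [ms|ms] := ltnP m (size (blowup p)); last by rewrite nth_default // horner0.
have := @poly_asymptotic R q k B _ m mk.
rewrite coef_poly ms => h.
have /eqP : ((blowup p)`_m).[u] * s%:C ^+ m = 0.
  apply: h => t /andP[t0 t1]; have ht : 0 <= t <= 1 by rewrite (ltW t0).
  suff -> : q.[t%:C] = pf p (bscale t y) by exact: hB.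
  rewrite /pf val_bscale //= mulrA -blowup_horner horner_poly.
  rewrite (horner_coef (blowup p)) horner_sum.
  apply: eq_bigr => i _; rewrite hornerM -mulrA; congr (_ * _).
  by rewrite -polyC_exp hornerC exprMn mulrC.
rewrite mulf_eq0 expf_eq0 -[s%:C == 0]/(s%:C == 0%:C) (inj_eq (@complexI R)).
by rewrite (gt_eqF s0) andbF orbF => /eqP.
Qed.

(** Applying [gleason] k times leaves a remainder that lies in the algebraic product I^k H by
    construction. *)
Lemma fock_jet k f : Hset f -> exists p, ipow k Hset (f - pf p).
Proof.
elim: k f => [|k IH] f Hf; first by exists 0; exact: (hsetB Hf (pf_fock 0)).
have [a [b [Ha Hb ef _]]] := gleason Hf.
have [p hp] := IH a Ha; have [q hq] := IH b Hb.
exists ((f (origin R))%:P%:P + ('X * p + 'Y * q)).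
exists (a - pf p), (b - pf q); split=> //.
apply/funext => x; rewrite {1}ef.
change (f (origin R) * 1 + ((val x).1 * a x + (val x).2 * b x)
  - pf ((f (origin R))%:P%:P + ('X * p + 'Y * q)) x =
  (val x).1 * (a x - pf p x) + (val x).2 * (b x - pf q x)).
by rewrite !pfD !pfM pfC pfX pfY; ring.
Qed.

(** The jet p of f also has order k, so its terms of degree below k vanish and p itself lies in I^k
    H. *)
Lemma ipow_ordge k f : Hset f -> ordge k f -> ipow k Hset f.
Proof.
move=> Hf of'; have [p hp] := fock_jet k Hf.
have op : ordge k (pf p : V).
  have -> : (pf p : V) = f - (f - pf p) by rewrite opprB addrC subrK.
  by apply: ordgeB => //; exact: ordge_ipow.
have -> : f = (f - pf p) + pf p by rewrite subrK.
apply: (subspaceD (ipow_subspace k sH)) => //.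
by apply: jet0_pf; exact: ordge_jet0.
Qed.

Lemma ordge_all_eq0 f : Hset f -> (forall k, ordge k f) -> f = 0.
Proof. by move=> Hf h; apply: (ip_qf_eq0 Hf) => y n; exact: (ordge_ip _ Hf (h n.+1)). Qed.

End orders.

(** * Minors and Cramer's rule *)

Section minors.
Variables (K : fieldType) (r n : nat).
Implicit Types (A : 'M[K]_(r, n)) (v : 'rV[K]_n) (g : 'I_r -> 'I_n).

Lemma row_free_minor A : row_free A -> exists g, colsub g A \in unitmx.
Proof.
move=> fA; have fT : row_full A^T by rewrite /row_full mxrank_tr.
exists (fullrankfun fT); rewrite -unitmx_tr.
suff -> : (colsub (fullrankfun fT) A)^T = rowsub (fullrankfun fT) A^T.
  exact: fullrowsub_unit.
by apply/matrixP => i j; rewrite !mxE.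
Qed.

Lemma colsub_mul m (u : 'M[K]_(m, r)) A g : colsub g (u *m A) = u *m colsub g A.
Proof. by apply/matrixP => i j; rewrite !mxE; apply: eq_bigr => k _; rewrite !mxE. Qed.

(* Cramer's rule, multiplied once more by the determinant so that it also
   holds where the minor vanishes. *)
Definition cramer A g v : 'rV[K]_r :=
  \det (colsub g A) *: (colsub g v *m \adj (colsub g A)).

Lemma cramerP A g v : (\det (colsub g A) != 0 -> (v <= A)%MS) ->
  cramer A g v *m A = \det (colsub g A) ^+ 2 *: v.
Proof.
move=> h; have [d0|dn] := eqVneq (\det (colsub g A)) 0.
  by rewrite /cramer d0 scale0r mul0mx expr0n scale0r.
have /submxP[u ->] := h dn.
rewrite /cramer colsub_mul -mulmxA mul_mx_adj mul_mx_scalar.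
by rewrite -!scalemxAl scalerA expr2.
Qed.

Lemma cramer_row A g i j :
  cramer A g (row i A) 0 j = \det (colsub g A) ^+ 2 * (i == j)%:R.
Proof.
rewrite /cramer rowE colsub_mul -mulmxA mul_mx_adj mul_mx_scalar scalerA -expr2.
by rewrite !mxE eqxx /= eq_sym.
Qed.

Lemma row_free_col_mx A v : row_free A -> ~~ (v <= A)%MS -> row_free (col_mx A v).
Proof.
move=> /eqP fA nv.
rewrite /row_free -addsmxE eqn_leq; apply/andP; split.
  by rewrite addsmxE rank_leq_row.
rewrite addn1; apply: (@leq_ltn_trans (\rank A)); first by rewrite fA.
apply: rank_ltmx; rewrite /ltmx addsmxSl /=.
by apply: contra nv => h; apply: submx_trans (addsmxSr _ _) h.
Qed.

Lemma row_freeP A : (forall u : 'rV[K]_r, u *m A = 0 -> u = 0) -> row_free A.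
Proof.
move=> h; rewrite -kermx_eq0; apply/eqP/row_matrixP => i.
by rewrite row0; apply: h; rewrite -row_mul mulmx_ker row0.
Qed.

Lemma row_free0 A (u : 'rV[K]_r) : row_free A -> u *m A = 0 -> u = 0.
Proof. by move=> fA h; apply: (row_free_inj fA); rewrite h mul0mx. Qed.

End minors.

Section combinations.
Variables (R : realType) (W : lmodType R[i]) (I : finType).
Implicit Types (f : ball2 R -> W) (e : I -> ball2 R -> W).

Lemma hmul_comb h f (c : I -> R[i]) e :
  hmul h (f - \sum_i c i *: e i) = hmul h f - \sum_i c i *: hmul h (e i).
Proof.
rewrite hmulBr hmul_sumr; congr (_ - _).
by apply: eq_bigr => i _; rewrite hmulZr.
Qed.

Lemma zmul_comb f (c : I -> R[i]) e :
  zmul (f - \sum_i c i *: e i) = zmul f - \sum_i c i *: zmul (e i).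
Proof. exact: hmul_comb. Qed.

Lemma wmul_comb f (c : I -> R[i]) e :
  wmul (f - \sum_i c i *: e i) = wmul f - \sum_i c i *: wmul (e i).
Proof. exact: hmul_comb. Qed.

Lemma zmul_pf_comb f (p : I -> {poly {poly R[i]}}) e :
  zmul (f - \sum_i hmul (pf (p i)) (e i)) =
  zmul f - \sum_i hmul (pf ('X * p i)) (e i).
Proof.
rewrite zmulE hmulBr hmul_sumr; congr (_ - _); apply: eq_bigr => i _.
by rewrite hmul_pfM hmul_pfX.
Qed.

Lemma wmul_pf_comb f (p : I -> {poly {poly R[i]}}) e :
  wmul (f - \sum_i hmul (pf (p i)) (e i)) =
  wmul f - \sum_i hmul (pf ('Y * p i)) (e i).
Proof.
rewrite wmulE hmulBr hmul_sumr; congr (_ - _); apply: eq_bigr => i _.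
by rewrite hmul_pfM hmul_pfY.
Qed.

Lemma pf_comb_decomp f f1 f2 (c : I -> R[i]) (p q : I -> {poly {poly R[i]}}) e :
  f - \sum_i c i *: e i = zmul f1 + wmul f2 ->
  f - \sum_i hmul (pf ((c i)%:P%:P + ('X * p i + 'Y * q i))) (e i) =
  zmul (f1 - \sum_i hmul (pf (p i)) (e i)) + wmul (f2 - \sum_i hmul (pf (q i)) (e i)).
Proof.
move=> h; rewrite zmul_pf_comb wmul_pf_comb addrACA -h -!opprD -addrA -opprD.
congr (_ - _); rewrite -!big_split /=; apply: eq_bigr => i _.
by rewrite !hmul_pfD hmul_pfC.
Qed.

End combinations.

(** * Multipliers and invariant subspaces *)

Section multipliers.
Variables (R : realType) (H : symmetric_fock R).
Local Notation FH := (fock_hilbert H).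
Local Notation Hset := (hset (fock_hilbert H)).
Local Notation V := (ball2 R -> (R[i])^o).
Implicit Types (a b : ball2 R -> R[i]) (h : V).
Hint Resolve kfH oneH : core.

Definition multiplier a : Prop := exists2 C : R, 0 <= C &
  forall h, Hset h -> Hset (hmul a h) /\ hnsq FH (hmul a h) <= C * hnsq FH h.

Lemma mult_fock a : multiplier a -> Hset a.
Proof.
case=> C _ /(_ _ (oneH H))[h _]; suff <- : hmul a (fun=> 1 : (R[i])^o) = a by [].
by apply/funext => x; exact: mulr1.
Qed.

Lemma multH a h : multiplier a -> Hset h -> Hset (hmul a h).
Proof. by case=> C _ ha /ha[]. Qed.

Lemma multC (c : R[i]) : multiplier (fun=> c).
Proof.
exists (sqmod c); first exact: sqmod_ge0.
move=> h Hh; have -> : hmul (fun=> c) h = c *: h by [].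
by rewrite nsqZ //; split => //; exact: hsetZ.
Qed.

Lemma multD a b : multiplier a -> multiplier b -> multiplier (fun x => a x + b x).
Proof.
move=> [C C0 ha] [D D0 hb]; exists (2 * C + 2 * D); first by rewrite addr_ge0 // mulr_ge0.
move=> h Hh; have [h1 h2] := ha h Hh; have [h3 h4] := hb h Hh.
rewrite hmulDl; split; first exact: hsetD.
have := nsq_ge0 (hsetB h1 h3); rewrite nsqB // nsqD //.
by move: (hnsq _ _) (hnsq _ _) (hnsq _ _) (complex.Re _) h2 h4 => x y z w; nra.
Qed.

Lemma multM a b : multiplier a -> multiplier b -> multiplier (fun x => a x * b x).
Proof.
move=> [C C0 ha] [D D0 hb]; exists (C * D); first by rewrite mulr_ge0.
move=> h Hh; have [h3 h4] := hb h Hh; have [h1 h2] := ha _ h3.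
rewrite -hmulA; split=> //; apply: le_trans h2 _; rewrite -mulrA.
exact: ler_wpM2l.
Qed.

Lemma multN a : multiplier a -> multiplier (fun x => - a x).
Proof.
move=> ha; have := multM (multC (-1)) ha.
by congr multiplier; apply/funext => x; rewrite mulN1r.
Qed.

Lemma mult_sum (I : Type) (s : seq I) (P : pred I) (F : I -> ball2 R -> R[i]) :
  (forall i, P i -> multiplier (F i)) -> multiplier (fun x => \sum_(i <- s | P i) F i x).
Proof.
move=> h; elim: s => [|i s IH].
  have := multC 0; congr multiplier; apply/funext => x; by rewrite big_nil.
have [Pi|nPi] := boolP (P i).
  have := multD (h i Pi) IH; congr multiplier; apply/funext => x.
  by rewrite big_cons Pi.
by move: IH; congr multiplier; apply/funext => x; rewrite big_cons (negPf nPi).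
Qed.

Lemma mult_prod (I : Type) (s : seq I) (P : pred I) (F : I -> ball2 R -> R[i]) :
  (forall i, P i -> multiplier (F i)) -> multiplier (fun x => \prod_(i <- s | P i) F i x).
Proof.
move=> h; elim: s => [|i s IH].
  have := multC 1; congr multiplier; apply/funext => x; by rewrite big_nil.
have [Pi|nPi] := boolP (P i).
  have := multM (h i Pi) IH; congr multiplier; apply/funext => x.
  by rewrite big_cons Pi.
by move: IH; congr multiplier; apply/funext => x; rewrite big_cons (negPf nPi).
Qed.

Lemma mult_det n (A : ball2 R -> 'M[R[i]]_n) :
  (forall i j, multiplier (fun x => A x i j)) -> multiplier (fun x => \det (A x)).
Proof.
move=> h; apply: mult_sum => s _; apply: multM; first exact: multC.
by apply: mult_prod.
Qed.

Lemma mult_adj n (A : ball2 R -> 'M[R[i]]_n) i j :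
  (forall i j, multiplier (fun x => A x i j)) -> multiplier (fun x => (\adj (A x)) i j).
Proof.
move=> h.
have -> : (fun x => (\adj (A x)) i j) =
    (fun x => (-1) ^+ (j + i) * \det (row' j (col' i (A x)))).
  by apply/funext => x; rewrite mxE.
apply: multM; first exact: multC.
apply: mult_det => i' j'; have := h (lift j i') (lift i j').
by congr multiplier; apply/funext => x; rewrite !mxE.
Qed.

Lemma mult_pf p : multiplier (pf p).
Proof.
have mz : multiplier (fun x => (val x).1).
  exists 1 => // h Hh; rewrite mul1r -zmulE; split; [exact: zmulH|exact: nsq_zmul].
have mw : multiplier (fun x => (val x).2).
  exists 1 => // h Hh; rewrite mul1r -wmulE; split; [exact: wmulH|exact: nsq_wmul].
have hC (c : {poly R[i]}) : multiplier (pf c%:P).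
  elim/poly_ind: c => [|c a IH].
    by have := multC 0; congr multiplier; apply/funext => x; rewrite pf0.
  have := multD (multM IH mw) (multC a); congr multiplier; apply/funext => x.
  by rewrite polyCD polyCM pfD pfM pfY pfC.
elim/poly_ind: p => [|p c IH].
  by have := multC 0; congr multiplier; apply/funext => x; rewrite pf0.
have := multD (multM IH mz) (hC c); congr multiplier; apply/funext => x.
by rewrite pfD pfM pfX.
Qed.

Lemma mult_vfock N a (F : ball2 R -> 'rV[R[i]]_N) C : 0 <= C ->
  (forall h, Hset h -> Hset (hmul a h) /\ hnsq FH (hmul a h) <= C * hnsq FH h) ->
  hset (vfock_hilbert H N) F -> hset (vfock_hilbert H N) (hmul a F) /\
  hnsq (vfock_hilbert H N) (hmul a F) <= C * hnsq (vfock_hilbert H N) F.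
Proof.
move=> C0 h HF.
have e i : entry i (hmul a F) = hmul a (entry i F).
  by apply/funext => x; rewrite /entry /hmul mxE.
have hi i := h _ (HF i).
split; first by move=> i; rewrite e; case: (hi i).
rewrite !vfock_nsq mulr_sumr; apply: ler_sum => i _.
by rewrite e; case: (hi i).
Qed.

End multipliers.

Section invariant_subspaces.
Variables (R : realType) (H : symmetric_fock R) (N : nat).
Local Notation FH := (fock_hilbert H).
Local Notation Hset := (hset (fock_hilbert H)).
Local Notation VH := (vfock_hilbert H N).
Local Notation V := (ball2 R -> (R[i])^o).
Local Notation VF := (ball2 R -> 'rV[R[i]]_N).
Implicit Types (F G U : VF) (h : V) (p : {poly {poly R[i]}}).
Hint Resolve kfH oneH : core.

Variable M : set VF.
Hypothesis iM : invariant_subspace H M.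

Let MS : M `<=` hset VH := inv_sub iM.
Let sM : subspace M := inv_subspace iM.
Let Mcl : hcl VH M `<=` M := inv_hcl iM.

Lemma inv_stable : stable M.
Proof. by split=> f; [exact: (inv_zmul iM)|exact: (inv_wmul iM)]. Qed.
Let tM := inv_stable.

Definition evc F (x : ball2 R) (c : 'rV[R[i]]_N) : R[i] :=
  \sum_i F x 0 i * Num.conj (c 0 i).

(** K is the orthogonal projection to M of k_x c, which represents the evaluation on the whole
    space. *)
Lemma point_repr (x : ball2 R) (c : 'rV[R[i]]_N) : exists2 K, M K &
  forall F, M F -> hip VH F K = evc F x c.
Proof.
pose kc : VF := fun y => fock_kernel y x *: c.
have ek i : entry i kc = c 0 i *: kf x.
  by apply/funext => y; rewrite /entry mxE mulrC.
have Hk : hset VH kc by move=> i; rewrite ek; exact: (hsetZ (H := FH)).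
have ipk F : M F -> hip VH F kc = evc F x c.
  move=> /MS HF; apply: eq_bigr => i _; rewrite ek.
  have HFi : Hset (entry i F) by exact: HF.
  by rewrite -[hfs_ip H]/(hip FH) ipZr // reproducing // mulrC.
have [||||K [clK _ hK]] := @riesz _ _ VH VF M id (fun F => hip VH F kc) (hnsq VH kc) sM MS.
- by [].
- by move=> a F G /MS HF /MS HG; rewrite ipDl ?ipZl //; exact: hsetZ.
- exact: nsq_ge0.
- by move=> F /MS HF; rewrite mulrC; exact: cauchy_schwarz.
rewrite image_id in clK.
by exists K => [|F MF]; [exact: Mcl|rewrite -hK // ipk].
Qed.

Lemma point_repr_zmul x c K : M K -> (forall F, M F -> hip VH F K = evc F x c) ->
  (forall U, M U -> hip VH (zmul U) K = (val x).1 * hip VH U K) /\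
  (forall U, M U -> hip VH (wmul U) K = (val x).2 * hip VH U K).
Proof.
move=> MK hK; split=> U MU.
  rewrite !hK //; last exact: (inv_zmul iM).
  by rewrite /evc mulr_sumr; apply: eq_bigr => i _; rewrite mxE mulrA.
rewrite !hK //; last exact: (inv_wmul iM).
by rewrite /evc mulr_sumr; apply: eq_bigr => i _; rewrite mxE mulrA.
Qed.

Lemma kernel_quotient x (K : VF) : hmul (kf x) (quotient_fun x K) = K.
Proof.
rewrite /quotient_fun hmulA; apply/funext => y; rewrite /hmul.
by rewrite /kf fock_kernelE mulVf ?ipc_neq1 // scale1r.
Qed.

Definition column_multiplier phi := exists2 C : R, 0 <= C & forall h, Hset h ->
  M (hmul h phi) /\ hnsq VH (hmul h phi) <= C * hnsq FH h.

Lemma point_repr_column x c K : M K ->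
  (forall F, M F -> hip VH F K = evc F x c) -> column_multiplier (quotient_fun x K).
Proof.
move=> MK hK; have [hz hw] := point_repr_zmul MK hK.
exists ((1 - bnsq x) * hnsq VH K).
  apply: mulr_ge0; last by apply: nsq_ge0; exact: MS.
  by rewrite subr_ge0; apply: ltW; apply: bnsq_lt1.
by move=> h Hh; exact: (quotient_fun_multiplier iM MK hz hw Hh).
Qed.

Lemma column_entry phi i : column_multiplier phi -> multiplier H (entry i phi).
Proof.
case=> C C0 hC; exists C => // h Hh; have [h1 h2] := hC h Hh.
have -> : hmul (entry i phi) h = entry i (hmul h phi).
  by apply/funext => x; rewrite /entry /hmul mxE; exact: mulrC.
have Hh1 := MS h1; split; first exact: Hh1.
by apply: le_trans (entry_nsq_le i Hh1) h2.
Qed.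

Lemma column_mem phi : column_multiplier phi -> M phi.
Proof.
case=> C _ /(_ _ (oneH H))[h _]; suff <- : hmul (fun=> 1 : (R[i])^o) phi = phi by [].
by apply/funext => x; exact: scale1r.
Qed.

Lemma column_ipow phi k h : column_multiplier phi -> ipow k Hset h -> ipow k M (hmul h phi).
Proof.
move=> cp; elim: k h => [|k IH] h; first by case: cp => C _ hC /hC[].
move=> [f [g [hf hg ->]]]; exists (hmul f phi), (hmul g phi).
split; [exact: IH|exact: IH|].
by apply/funext => x; rewrite /hmul; rewrite [LHS]scalerDl -!scalerA.
Qed.

(** An element of M orthogonal to all representers vanishes at every point, so a closed linear
    property of M need only be checked on representers. *)
Lemma point_dense (S : set VF) : subspace S -> S `<=` M -> hcl VH S `<=` S ->
  (forall x c K, M K -> (forall F, M F -> hip VH F K = evc F x c) -> S K) ->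
  M `<=` S.
Proof.
move=> sS SM Scl h; apply: subset_trans Scl.
apply: dense_orthogonal => // g Mg hg.
have Hg := MS Mg.
apply/funext => x; apply/rowP => i; rewrite [RHS]mxE.
have [K MK hK] := point_repr x (delta_mx 0 i).
have := hg K (h _ _ _ MK hK); rewrite (hip_conj Hg (MS MK)) hK //.
rewrite /evc (bigD1 i) //= big1 ?addr0; last first.
  by move=> j ji; rewrite mxE (negPf ji) andbF rmorph0 mulr0.
rewrite mxE !eqxx rmorph1 mulr1 => /eqP.
by rewrite conjC_eq0 => /eqP.
Qed.

(* By density it suffices to take F = k_x phi with phi a column multiplier, and
   then (a - p) k_x lies in H and vanishes to order k. *)
Lemma mult_taylor a p k : multiplier H a -> hcl VH (ipow k M) `<=` ipow k M ->
  (forall F, M F -> M (hmul a F)) -> ordge k ((fun x => a x - pf p x) : V) ->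
  forall F, M F -> ipow k M (hmul a F - hmul (pf p) F).
Proof.
move=> ma Kcl aM oa.
have sk := ipow_subspace k sM.
have mb : multiplier H (fun x => a x - pf p x) := multD ma (multN (mult_pf H p)).
pose S := [set F | M F /\ ipow k M (hmul (fun x => a x - pf p x) F)].
suff hS : M `<=` S by move=> F /hS[_]; rewrite hmulBl.
have kS : ipow k M `<=` hset VH.
  by apply: subset_trans MS; apply: ipow_sub.
have SM : S `<=` M by move=> F [].
apply: point_dense => //.
- split; first by split; [exact: subspace0|rewrite hmul0; exact: subspace0].
  move=> c F G [MF kF] [MG kG]; split; first exact: subspaceP.
  by rewrite hmul_lin; exact: subspaceP.
(* S is closed because multiplication by a - p is bounded and I^k M is closed. *)
- move=> F clF; have MF : M F by apply: Mcl; exact: hcl_mono clF.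
  split=> //; apply: Kcl.
  case: (mb) => C C0 hC; have HF := MS MF.
  have [Hb nb] := mult_vfock C0 hC HF.
  split=> // e e0.
  pose d := e / (C + 1).
  have C1 : 0 < C + 1 by rewrite ltr_wpDl.
  have d0 : 0 < d by rewrite divr_gt0.
  have ed : e = d * (C + 1) by rewrite /d divfK // lt0r_neq0.
  have [_ /(_ d d0)[G SG hG]] := clF.
  exists (hmul (fun x => a x - pf p x) G); first by case: SG.
  have HG := MS (SM _ SG).
  rewrite -hmulBr; have [Hb' nb'] := mult_vfock C0 hC (hsetB HF HG).
  rewrite nrm_lt //; apply: le_lt_trans nb' _.
  rewrite nrm_lt // in hG.
  rewrite ed exprMn mulrC; apply: (@le_lt_trans _ _ (d ^+ 2 * C)).
    by rewrite ler_wpM2r // ltW.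
  by rewrite ltr_pM2l ?exprn_gt0 //; nra.
- move=> x c K MK hK; split=> //.
  have cp := point_repr_column MK hK.
  rewrite -{1}(kernel_quotient x K) hmulA; apply: column_ipow => //.
  apply: ipow_ordge; first exact: (multH mb (kfH H x)).
  rewrite -[k]addn0; apply: ordgeM => //.
  exact: (ordge0_fock (kfH H x)).
Qed.

Hypothesis finM : exists n (e : 'I_n -> VF), quotient_basis M (ipow 1 M) e.

(** Both properties are carried together: [closed_range] needs I^k M closed and I^(k+1) M of finite
    codimension in it, and the vectors z e_i, w e_i span the next quotient. *)
Lemma ipow_closed k : hcl VH (ipow k M) `<=` ipow k M /\
  exists n (e : 'I_n -> VF), quotient_basis (ipow k M) (ipow k.+1 M) e.
Proof.
elim: k => [|k [cl [n [e he]]]]; first by [].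
have sk := ipow_subspace k sM; have tk := ipow_stable k tM.
have kS : ipow k M `<=` hset VH by apply: subset_trans MS; apply: ipow_sub.
have zc F : ipow k M F -> hnrm VH (zmul F) <= hnrm VH F.
  move=> /kS HF; apply: ler_wsqrtr.
  have [_] := vrow_contraction HF (hset0 VH).
  by rewrite (wmulE 0) hmul0 nsq0 !addr0.
have wc F : ipow k M F -> hnrm VH (wmul F) <= hnrm VH F.
  move=> /kS HF; apply: ler_wsqrtr.
  have [_] := vrow_contraction (hset0 VH) HF.
  by rewrite (zmulE 0) hmul0 nsq0 !add0r.
split.
  exact: (closed_range kS cl sk (@zmul_lin R _) (@wmul_lin R _) tk.1 tk.2 zc wc he).
case: he => Me se _.
pose b (i : 'I_n + 'I_n) := match i with inl i => zmul (e i) | inr i => wmul (e i) end.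
have sk2 := ipow_subspace k.+2 sM.
have [||m [b' [_ hb']]] := @spans_mod_basis _ _ (ipow k.+1 M) (ipow k.+2 M) _ b sk2.
- move=> [i|i] /=.
    by exists (e i), 0; split; rewrite ?(wmulE 0) ?hmul0 ?addr0 //; exact: subspace0.
  by exists 0, (e i); split; rewrite ?(zmulE 0) ?hmul0 ?add0r //; exact: subspace0.
- move=> _ [f [g [kf kg ->]]].
  have [c hc] := se f kf; have [d hd] := se g kg.
  exists (fun i => match i with inl i => c i | inr i => d i end).
  rewrite big_sumType /=.
  exists (f - \sum_i c i *: e i), (g - \sum_i d i *: e i); split=> //.
  by rewrite zmul_comb wmul_comb opprD addrACA.
by exists m, b'.
Qed.

(** Write F = sum c_i e_i + z f + w g and repeat with f and g; each round gains one power of I. The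
    expansion need not terminate, hence the statement modulo I^k M. *)
Lemma poly_generators n (e : 'I_n -> VF) : quotient_basis M (ipow 1 M) e ->
  forall k F, M F -> exists p : 'I_n -> {poly {poly R[i]}},
    ipow k M (F - \sum_i hmul (pf (p i)) (e i)).
Proof.
move=> [Me se _]; elim=> [|k IH] F MF.
  exists (fun=> 0); rewrite big1 ?subr0 // => i _; exact: hmul_pf0.
have [c [f [g [Mf Mg efg]]]] := se F MF.
have [p hp] := IH f Mf; have [q hq] := IH g Mg.
exists (fun i => (c i)%:P%:P + ('X * p i + 'Y * q i)).
exists (f - \sum_i hmul (pf (p i)) (e i)), (g - \sum_i hmul (pf (q i)) (e i)).
by split=> //; exact: pf_comb_decomp.
Qed.

End invariant_subspaces.

(** * Fiber rank and columns of maximal rank *)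

Section fiber_rank.
Variables (R : realType) (N : nat).
Local Notation VF := (ball2 R -> 'rV[R[i]]_N).
Implicit Types (M : set VF).

Definition family_mx r (f : 'I_r -> VF) (x : ball2 R) : 'M[R[i]]_(r, N) :=
  \matrix_(j, i) f j x 0 i.

Lemma row_family_mx r (f : 'I_r -> VF) x j : row j (family_mx f x) = f j x.
Proof. by apply/rowP => i; rewrite !mxE. Qed.

Lemma mul_family_mx r (f : 'I_r -> VF) x (u : 'rV[R[i]]_r) :
  u *m family_mx f x = \sum_j u 0 j *: f j x.
Proof. by rewrite mulmx_sum_row; apply: eq_bigr => j _; rewrite row_family_mx. Qed.

Definition fiber_rank_ge M r : Prop := exists x (f : 'I_r -> VF),
  (forall j, M (f j)) /\ row_free (family_mx f x).

Lemma fiber_rank_ge_le M r : fiber_rank_ge M r -> (r <= N)%N.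
Proof. by case=> x [f [_ /eqP <-]]; exact: rank_leq_col. Qed.

Lemma fiber_rank_ge_mono M1 M2 r : M1 `<=` M2 ->
  fiber_rank_ge M1 r -> fiber_rank_ge M2 r.
Proof. by move=> h [x [f [Mf ff]]]; exists x, f; split=> // j; exact: h. Qed.

Definition fiber_rank M r : Prop :=
  fiber_rank_ge M r /\ forall r', fiber_rank_ge M r' -> (r' <= r)%N.

Lemma fiber_rank_exists M : exists r, fiber_rank M r.
Proof.
pose P r := `[< fiber_rank_ge M r >].
have P0 : exists r, P r.
  exists 0%N; apply/asboolP; exists (origin R), (fun=> 0); split; first by case.
  by rewrite /row_free -leqn0 rank_leq_row.
have ub r : P r -> (r <= N)%N by move/asboolP; exact: fiber_rank_ge_le.
have [r /asboolP Pr max] := ex_maxnP P0 ub.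
by exists r; split=> // r' hr'; apply: max; apply/asboolP.
Qed.

End fiber_rank.

Section columns.
Variables (R : realType) (H : symmetric_fock R) (N : nat).
Local Notation FH := (fock_hilbert H).
Local Notation Hset := (hset (fock_hilbert H)).
Local Notation VH := (vfock_hilbert H N).
Local Notation V := (ball2 R -> (R[i])^o).
Local Notation VF := (ball2 R -> 'rV[R[i]]_N).
Implicit Types (F G U : VF) (h : V) (p : {poly {poly R[i]}}).

Variable M : set VF.
Hypothesis iM : invariant_subspace H M.
Variable r : nat.
Hypothesis rM : fiber_rank M r.

Let MS : M `<=` hset VH := inv_sub iM.
Let sM : subspace M := inv_subspace iM.

Lemma evc_lin (I : finType) (c : I -> 'rV[R[i]]_N) (v : I -> R[i]) F x :
  evc F x (\sum_j v j *: c j) = \sum_j Num.conj (v j) * evc F x (c j).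
Proof.
rewrite /evc.
under [RHS]eq_bigr => j _ do rewrite mulr_sumr.
rewrite exchange_big /=; apply: eq_bigr => i _.
rewrite summxE conj_sum mulr_sumr; apply: eq_bigr => j _.
by rewrite mxE conjM mulrCA.
Qed.

(** Suppose sum v_j phi_j vanishes at x, and put G = sum v_j K_j, g = sum v_j f_j. Then G(x) = 0 and
    <F, G> = <F(x), g(x)> for F in M. Taking F = G gives G = 0, then F = g gives g(x) = 0, so v = 0
    since the f_j(x) are independent. *)
Lemma independent_columns : exists x (phi : 'I_r -> VF),
  (forall j, column_multiplier H M (phi j)) /\ row_free (family_mx phi x).
Proof.
case: rM => -[x [f [Mf ff]]] _.
have /choice[K hK] : forall j, exists K, M K /\
    forall F, M F -> hip VH F K = evc F x (f j x).
  by move=> j; have [K MK hK] := point_repr iM x (f j x); exists K.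
exists x, (fun j => quotient_fun x (K j)); split.
  by move=> j; have [MK hj] := hK j; exact: (point_repr_column iM MK hj).
apply: row_freeP => v hv.
have MK j : M (K j) by case: (hK j).
pose G := \sum_j v 0 j *: K j; pose g := \sum_j v 0 j *: f j.
have MG : M G by apply: (subspace_sum sM) => j _; exact: subspaceZ.
have Mg : M g by apply: (subspace_sum sM) => j _; exact: subspaceZ.
have gx : g x = \sum_j v 0 j *: f j x by rewrite /g fct_sumE.
have ipG F : M F -> hip VH F G = evc F x (g x).
  move=> MF; have HF := MS MF.
  rewrite /G ip_sumr //; last by move=> j; exact: (hsetZ _ (MS (MK j))).
  rewrite gx evc_lin; apply: eq_bigr => j _.
  by rewrite (ipZr _ (MS (MK j)) HF) (proj2 (hK j)).
have Gx : G x = 0.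
  have : (1 - ipc x x) *: G x = 0.
    rewrite -hv mul_family_mx /G fct_sumE scaler_sumr; apply: eq_bigr => j _.
    by rewrite /quotient_fun /hmul !scalerA mulrC.
  by move/eqP; rewrite scaler_eq0 (negPf (ipc_neq1 _ _)) => /eqP.
have G0 : G = 0.
  apply: (hip_eq0 (h0 := VH)); first exact: MS.
  by rewrite ipG // /evc big1 // => i _; rewrite Gx mxE mul0r.
have g0 : g x = 0.
  have := ipG g Mg; rewrite G0 ip0r; last exact: MS.
  move=> /esym/eqP; rewrite /evc psumr_eq0; last by move=> i _; exact: mul_conjC_ge0.
  move=> /allP h; apply/rowP => i; rewrite [RHS]mxE.
  by have := h i (mem_index_enum i); rewrite mul_conjC_eq0 => /eqP.
by apply: (row_free0 ff); rewrite mul_family_mx -gx.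
Qed.

Lemma cramer_data : exists (phi : 'I_r -> VF) (delta : ball2 R -> R[i])
    (D : 'I_r -> VF -> V),
  [/\ forall j, column_multiplier H M (phi j), multiplier H delta /\ exists x, delta x != 0,
      forall j F, M F -> Hset (D j F),
      forall F, M F -> hmul delta F = \sum_j hmul (D j F) (phi j) &
      (forall j F G, D j (F + G) = D j F + D j G) /\
      (forall j h F, D j (hmul h F) = hmul h (D j F)) /\
      (forall j i, D j (phi i) = fun x => delta x * (i == j)%:R)].
Proof.
have [x0 [phi [cphi fphi]]] := independent_columns.
have [g gu] := row_free_minor fphi.
pose A x := colsub g (family_mx phi x).
pose delta x := \det (A x) ^+ 2.
pose D j F : V := fun x => cramer (family_mx phi x) g (F x) 0 j.
have mA i j : multiplier H (fun x => A x i j).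
  have := column_entry iM (g j) (cphi i).
  by congr multiplier; apply/funext => x; rewrite !mxE.
have mdet : multiplier H (fun x => \det (A x)) by exact: mult_det.
(* D j F is a combination of entries of F with multiplier coefficients, hence lies in H. *)
have DE j F : D j F = \sum_i hmul (fun x => \det (A x) * (\adj (A x)) i j) (entry (g i) F).
  apply/funext => x; rewrite /D fct_sumE !mxE mulr_sumr; apply: eq_bigr => i _.
  have E (a b c : R[i]) : a * (b * c) = a * c * b by rewrite [b * c]mulrC mulrA.
  by rewrite [colsub _ _ _ _]mxE; exact: E.
exists phi, delta, D; split=> //.
- split; first by have := multM mdet mdet; congr multiplier; apply/funext => x; rewrite /delta expr2.
  exists x0; apply: expf_neq0.
  by move: gu; rewrite unitmxE unitfE.
- move=> j F MF; rewrite DE; apply: (subspace_sum (hsub FH)) => i _.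
  apply: multH; last exact: (MS MF).
  by apply: multM => //; exact: mult_adj.
- move=> F MF; apply/funext => x; rewrite fct_sumE.
  have := @cramerP _ _ _ (family_mx phi x) g (F x) _.
  rewrite mul_family_mx => h.
  suff d1 : \det (colsub g (family_mx phi x)) != 0 -> (F x <= family_mx phi x)%MS.
    exact: (esym (h d1)).
  (* Otherwise F(x) and the r independent vectors phi_j(x) would span a fiber of dimension r + 1. *)
  move=> d0; apply: contrapT => /negP nin.
  have fr : row_free (family_mx phi x).
    apply: row_freeP => u hu.
    have : u *m A x = 0 by rewrite -colsub_mul hu; apply/matrixP => i j; rewrite !mxE.
    move=> /(congr1 (fun w => w *m invmx (A x))).
    by rewrite mulmxK ?unitmxE ?unitfE // mul0mx.
  have := row_free_col_mx fr nin.
  pose f' (k : 'I_(r + 1)) := match fintype.split k with inl j => phi j | inr _ => F end.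
  have -> : col_mx (family_mx phi x) (F x) = family_mx f' x.
    apply/matrixP => k i; rewrite !mxE /f'; case: fintype.splitP => j' _.
      by rewrite mxE.
    by rewrite (ord1 j').
  move=> ff'; case: rM => _ /(_ (r + 1)%N) hmax.
  suff : (r + 1 <= r)%N by rewrite addn1 ltnn.
  apply: hmax; exists x, f'; split=> // k.
  rewrite /f'; case: fintype.split => // j'; exact: (column_mem (cphi j')).
- split; first move=> j F G.
    apply/funext => x; rewrite /D /cramer.
    have -> : (F + G) x = F x + G x by [].
    have -> : colsub g (F x + G x) = colsub g (F x) + colsub g (G x).
      by apply/matrixP => a b; rewrite !mxE.
    by rewrite mulmxDl scalerDr mxE.
  split; first move=> j h F.
    apply/funext => x; rewrite /D /cramer.
    have -> : hmul h F x = h x *: F x by [].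
    have -> : colsub g (h x *: F x) = h x *: colsub g (F x).
      by apply/matrixP => a b; rewrite !mxE.
    by rewrite -scalemxAl scalerA mulrC -scalerA mxE.
  move=> j i; apply/funext => x; rewrite /D -[phi i x]row_family_mx.
  exact: cramer_row.
Qed.

End columns.

(** * Counting dimensions *)

Section multiplier_order.
Variables (R : realType) (H : symmetric_fock R).
Local Notation Hset := (hset (fock_hilbert H)).
Local Notation V := (ball2 R -> (R[i])^o).
Implicit Types (f : V) (p q : {poly {poly R[i]}}).

Lemma ordge_le k l f : (k <= l)%N -> ordge l f -> ordge k f.
Proof.
move=> kl hf y; have [B B0 hB] := hf y; exists B => // t ht.
apply: le_trans (hB t ht) _; rewrite ler_wpM2l // -!exprM.
case/andP: ht => t0 t1; apply: ler_wiXn2l => //; lia.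
Qed.

Lemma ordge_pfM k l p f : ordge k (pf p : V) -> ordge l f ->
  ordge (k + l) (fun x => pf p x * f x : R[i]).
Proof. exact: ordgeM. Qed.

Lemma finite_order f : Hset f -> (exists x, f x != 0) ->
  exists s, ordge s f /\ ~ ordge s.+1 f.
Proof.
move=> Hf [x fx]; apply: contrapT => hn.
have h k : ordge k f.
  elim: k => [|k IH]; first exact: (ordge0_fock Hf).
  by apply: contrapT => nk; apply: hn; exists k.
by move: fx; rewrite (ordge_all_eq0 Hf h) eqxx.
Qed.

Variables (delta : V) (s k : nat) (P : {poly {poly R[i]}}).
Hypotheses (sk : (s < k)%N) (os : ordge s delta) (ns : ~ ordge s.+1 delta)
  (hP : ipow k Hset (delta - pf P)).

Let oP : ordge k (delta - (pf P : V)) := ordge_ipow hP.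

(** P agrees with delta to order k > s, so it has order exactly s: a larger order would pass to
    delta. *)
Let vP : vanish_poly s (blowup P) /\ (blowup P)`_s != 0.
Proof.
have js : jet0 s P.
  apply: ordge_jet0; have -> : (pf P : V) = delta - (delta - pf P) by rewrite opprB addrC subrK.
  by apply: ordgeB => //; apply: ordge_le oP; exact: ltnW.
split; first by apply/jet0_blowup.
apply/negP => /eqP bs; apply: ns.
have -> : delta = (delta - pf P) + pf P by rewrite subrK.
apply: ordgeD; first exact: ordge_le oP.
apply: (@ordge_ipow _ H); apply: jet0_pf; apply/jet0_blowup => m.
rewrite ltnS leq_eqVlt => /orP[/eqP -> //|]; exact: (jet0_blowup _ _).1 js _.
Qed.

Lemma jet0_mul_taylor q : jet0 k (q * P) -> jet0 (k - s) q.
Proof.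
move=> /jet0_blowup; rewrite blowupM => h; apply/jet0_blowup.
by case: vP => v1 v2; exact: (vanish_polyM v1 v2 h).
Qed.

Lemma jet0_mul_order q : ordge k (hmul (pf q) delta) -> jet0 (k - s) q.
Proof.
move=> oq; apply: jet0_mul_taylor; apply: (ordge_jet0 (k := k)).
have -> : (pf (q * P) : V) = hmul (pf q) delta - hmul (pf q) (delta - pf P).
  by rewrite -hmulBr opprB addrC subrK; apply/funext => x; exact: pfM.
apply: ordgeB => //.
rewrite -[k]add0n; apply: ordge_pfM => //.
exact: (ordge0_fock (pf_fock H q)).
Qed.

(** The products of P with the monomials of degree below k - s are independent modulo I^k because P
    has order s. [steinitz] then leaves a complement of size at most |tri k| - |tri (k - s)|, which
    is O(k) for fixed s. *)
Lemma poly_complement : exists n (b : 'I_n -> {poly {poly R[i]}}),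
  (n + #|{: tri (k - s)}| <= #|{: tri k}|)%N /\
  forall p, exists (c : 'I_n -> R[i]) q,
    jet0 k (p - (\sum_i (c i)%:P%:P * b i + q * P)).
Proof.
(* The exchange takes place among polynomial functions, a complex vector space, whereas [{poly {poly
   R[i]}}] has scalars [{poly R[i]}]; [pf_inj] recovers the coefficients. *)
pose Q : set V := [set f | exists p, f = pf p].
pose L : set V := [set f : V | exists2 p : {poly {poly R[i]}}, jet0 k p & f = pf p].
have pfE p (c : R[i]) (q : {poly {poly R[i]}}) :
    (pf (c%:P%:P * p + q) : V) = c *: (pf p : V) + pf q.
  by apply/funext => x; rewrite pfD pfM pfC.
have pf_sum (I : finType) (c : I -> R[i]) (b : I -> {poly {poly R[i]}}) :
    (pf (\sum_i (c i)%:P%:P * b i) : V) = \sum_i c i *: (pf (b i) : V).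
  elim/big_rec2: _ => [|i f q _ <-]; first by apply/funext => x; exact: pf0.
  exact: pfE.
have pf_sub p q : (pf (p - q) : V) = (pf p : V) - pf q.
  by apply/funext => x; exact: pfB.
have pf_inj p : (pf p : V) = 0 -> forall l, jet0 l p.
  move=> p0 l; apply: ordge_jet0; rewrite p0 => y; exists 0 => // t _.
  by rewrite -[X in sqmod X]/(0 : R[i]) sqmod0 mul0r.
have pf_jet p p' : (pf p : V) = pf p' -> jet0 k p' -> jet0 k p.
  move=> e jp' i j ij.
  have : jet0 k (p - p') by apply: pf_inj; rewrite pf_sub e subrr.
  by move=> /(_ i j ij); rewrite !coefB jp' // subr0.
have jet_lin p q (c : R[i]) : jet0 k p -> jet0 k q -> jet0 k (c%:P%:P * p + q).
  move=> jp jq i j ij.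
  by rewrite !coefD !coefCM jp // jq // mulr0 addr0.
have sL : subspace L.
  split; first by exists 0 => [i j _|]; [rewrite !coef0|apply/funext => x; rewrite pf0].
  move=> c _ _ [p jp ->] [q jq ->]; exists (c%:P%:P * p + q); first exact: jet_lin.
  by rewrite pfE.
have [||||n [b [hn hb hspan]]] := @steinitz _ _ Q L _ _ (fun t : tri k => pf (mono_of R[i] t) : V)
   (fun t : tri (k - s) => pf (mono_of R[i] t * P) : V) sL.
- by move=> t; exists (mono_of R[i] t).
- move=> _ [p ->]; have [c hc] := jet0_trunc k p; exists c.
  exists (p - \sum_y (c y)%:P%:P * mono_of R[i] y); first exact: hc.
  by rewrite pf_sub pf_sum.
- by move=> t; exists (mono_of R[i] t * P).
- move=> c; rewrite -pf_sum => -[p jp e] t.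
  have := pf_jet _ _ e jp.
  under eq_bigr => i _ do rewrite mulrA.
  rewrite -mulr_suml => /jet0_mul_taylor/(_ (val t).1 (val t).2 (valP t)).
  by rewrite coef_sum_mono.
have /choice[beta hbeta] : forall i, exists p, b i = pf p by exact: hb.
exists n, beta; split=> // p.
have [c [d [p' jp' e]]] := hspan (pf p) (ex_intro _ p erefl).
exists c, (\sum_j (d j)%:P%:P * mono_of R[i] j).
apply: (pf_jet _ _ _ jp'); rewrite -e pf_sub.
have -> (a b' : {poly {poly R[i]}}) : (pf (a + b') : V) = (pf a : V) + pf b'.
  by apply/funext => x; exact: pfD.
have -> : (\sum_j (d j)%:P%:P * mono_of R[i] j) * P =
    \sum_j (d j)%:P%:P * (mono_of R[i] j * P).
  by rewrite mulr_suml; apply: eq_bigr => j _; exact: (esym (mulrA _ _ _)).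
rewrite !pf_sum opprD addrA; congr (_ - _ - _).
by apply: eq_bigr => i _; rewrite hbeta.
Qed.

End multiplier_order.

Lemma zmod_cancel4 (U : zmodType) (f a b s x y : U) :
  f - (a + b) = (f - s) + (s - (b + x)) - (y - x) + (y - a).
Proof.
have -> : f - s + (s - (b + x)) = f - (b + x) by rewrite addrA subrK.
have e2 : - (y - x) + (y - a) = x - a by rewrite opprB addrA subrK.
by rewrite -addrA e2 !opprD !addrA subrK addrAC.
Qed.

Section counting.
Variables (R : realType) (H : symmetric_fock R) (N : nat).
Local Notation FH := (fock_hilbert H).
Local Notation Hset := (hset (fock_hilbert H)).
Local Notation VH := (vfock_hilbert H N).
Local Notation V := (ball2 R -> (R[i])^o).
Local Notation VF := (ball2 R -> 'rV[R[i]]_N).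
Implicit Types (F G U : VF) (h : V) (p : {poly {poly R[i]}}).

Variable M : set VF.
Hypothesis iM : invariant_subspace H M.
Variable r : nat.
Hypothesis rM : fiber_rank M r.
Variables (n : nat) (e : 'I_n -> VF).
Hypothesis he : quotient_basis M (ipow 1 M) e.

Let MS : M `<=` hset VH := inv_sub iM.
Let sM : subspace M := inv_subspace iM.
Let tM : stable M := inv_stable iM.

Lemma codim_bounds : exists s, forall k, (s < k)%N ->
  exists m (b : 'I_m -> VF), [/\ quotient_basis M (ipow k M) b,
    (r * #|{: tri (k - s)}| <= m)%N &
    (m + n * #|{: tri (k - s)}| <= r * #|{: tri k}| + n * #|{: tri k}|)%N].
Proof.
have [phi [delta [D [cphi [md dn0] DH Did [Dadd [Dmul Dphi]]]]]] := cramer_data iM rM.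
have [s [os ns]] := finite_order (mult_fock md) dn0.
exists s => k sk.
have [P hP] := fock_jet k (mult_fock md).
have sk' := ipow_subspace k sM.
have D0 j : D j 0 = 0 by have := Dmul j (fun=> 0) 0; rewrite !hmul0 => ->; apply/funext => x; exact: scale0r.
have Dipow j l F : ipow l M F -> ipow l Hset (D j F).
  elim: l F => [|l IH] F; first exact: DH.
  move=> [f [g [hf hg ->]]]; exists (D j f), (D j g).
  by split; [exact: IH|exact: IH|rewrite Dadd !Dmul].
have Dsum (I : finType) j (f : I -> VF) : D j (\sum_i f i) = \sum_i D j (f i).
  by elim/big_rec2: _ => [|i y1 y2 _ <-]; rewrite ?D0 ?Dadd.
pose u (x : 'I_r * tri (k - s)) := hmul (pf (mono_of R[i] x.2)) (phi x.1).
have Mu x : M (u x) by apply: (stable_pf _ sM tM); exact: (column_mem (cphi _)).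
have collapse l (c : 'I_r * tri l -> R[i]) :
    \sum_x c x *: hmul (pf (mono_of R[i] x.2)) (phi x.1) =
    \sum_j hmul (pf (\sum_t (c (j, t))%:P%:P * mono_of R[i] t)) (phi j).
  rewrite [RHS](eq_bigr (fun j => \sum_t c (j, t) *: hmul (pf (mono_of R[i] t)) (phi j))).
    by rewrite [RHS]pair_bigA; apply: eq_bigr => -[j t] _.
  move=> j _; rewrite hmul_pf_sum; apply: eq_bigr => t _.
  by rewrite hmul_pfM hmul_pfC.
(* [D j] kills every column but phi_j, which it sends to delta. A relation thus puts q_j delta in
   I^k H; delta having order s, q_j has no terms of degree below k - s, hence is 0. *)
have iu : indep_mod (ipow k M) u.
  move=> c; rewrite collapse => hc [j t].
  pose q j' := \sum_t' (c (j', t'))%:P%:P * mono_of R[i] t'.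
  have /ordge_ipow : ipow k Hset (D j (\sum_j' hmul (pf (q j')) (phi j'))) by exact: Dipow.
  have -> : D j (\sum_j' hmul (pf (q j')) (phi j')) = hmul (pf (q j)) delta.
    rewrite Dsum (bigD1 j) //= big1 ?addr0 => [|j' jj'].
      by rewrite Dmul Dphi eqxx; congr hmul; apply/funext => x; exact: mulr1.
    rewrite Dmul Dphi (negPf jj'); apply/funext => x.
    by rewrite /hmul mulr0; exact: mulr0.
  move=> /(jet0_mul_order sk os ns hP)/(_ (val t).1 (val t).2 (valP t)).
  by rewrite coef_sum_mono.
have [n' [b' [hn' comp]]] := poly_complement sk os ns hP.
have [hcl _] := ipow_closed iM (ex_intro _ n (ex_intro _ e he)) k.
have deltaM F : M F -> M (hmul delta F).
  move=> MF; rewrite Did //; apply: (subspace_sum sM) => j _.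
  by case: (cphi j) => C _ hC; case: (hC _ (DH j F MF)).
have tay := mult_taylor iM md hcl deltaM (ordge_ipow hP).
(* There are r |tri k| elements of the first kind and at most n (|tri k| - |tri (k - s)|) of the
   second. *)
pose b (x : 'I_r * tri k + 'I_n * 'I_n') : VF := match x with
  | inl x => hmul (pf (mono_of R[i] x.2)) (phi x.1)
  | inr x => hmul (pf (b' x.2)) (e x.1) end.
have Me i : M (e i) by case: he.
have Mb x : M (b x).
  by case: x => x; apply: (stable_pf _ sM tM); [exact: (column_mem (cphi _))|].
have spb : spans_mod M (ipow k M) b.
  move=> F MF.
  have [p hp] := poly_generators he k MF.
  have /choice[cq hcq] : forall i, exists cq : ('I_n' -> R[i]) * {poly {poly R[i]}},
      jet0 k (p i - (\sum_l (cq.1 l)%:P%:P * b' l + cq.2 * P)).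
    by move=> i; have [c [q hq]] := comp (p i); exists (c, q).
  pose l i := p i - (\sum_l ((cq i).1 l)%:P%:P * b' l + (cq i).2 * P).
  (* Modulo I^k M, F is sum p_i e_i, where p_i is a combination of b' plus q_i P. The multiples of P
     add up to P G, which by [tay] may be replaced by delta G = sum (D_j G) phi_j; truncating the
     D_j G leaves polynomials of degree below k. *)
  pose G := \sum_i hmul (pf (cq i).2) (e i).
  have MG : M G by apply: (subspace_sum sM) => i _; exact: (stable_pf _ sM tM).
  have /choice[w hw] : forall j, exists w, ipow k Hset (D j G - pf w).
    by move=> j; exact: (fock_jet k (DH j G MG)).
  have /choice[d hd] : forall j, exists d : tri k -> R[i],
      jet0 k (w j - \sum_t (d t)%:P%:P * mono_of R[i] t).
    by move=> j; exact: jet0_trunc.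
  pose w' j := \sum_t (d j t)%:P%:P * mono_of R[i] t.
  have hw' j : ipow k Hset (D j G - pf (w' j)).
    have -> : D j G - pf (w' j) = (D j G - pf (w j)) + (pf (w j - w' j) : V).
      have -> : (pf (w j - w' j) : V) = (pf (w j) : V) - pf (w' j).
        by apply/funext => x; exact: pfB.
      by rewrite addrA subrK.
    by apply: (subspaceD (ipow_subspace k (hsub FH))) => //; apply: jet0_pf; exact: hd.
  exists (fun x => match x with inl x => d x.1 x.2 | inr x => (cq x.1).1 x.2 end).
  rewrite big_sumType /= (collapse k (fun x => d x.1 x.2)) /=.
  have -> : \sum_(x : 'I_n * 'I_n') (cq x.1).1 x.2 *: hmul (pf (b' x.2)) (e x.1) =
     \sum_i hmul (pf (\sum_l ((cq i).1 l)%:P%:P * b' l)) (e i).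
    rewrite [RHS](eq_bigr (fun i => \sum_l (cq i).1 l *: hmul (pf (b' l)) (e i))).
      by rewrite [RHS]pair_bigA; apply: eq_bigr => -[i t] _.
    move=> i _; rewrite hmul_pf_sum; apply: eq_bigr => t _.
    by rewrite hmul_pfM hmul_pfC.
  set A := \sum_j _; set B := \sum_i _.
  have ePG : \sum_i hmul (pf ((cq i).2 * P)) (e i) = hmul (pf P) G.
    rewrite /G hmul_sumr; apply: eq_bigr => i _.
    by rewrite mulrC hmul_pfM.
  (* Four errors, each in I^k M: generation by the e_i, reduction modulo P, replacement of P by
     delta, and truncation of D_j G. *)
  have eF : F - (A + B) = (F - \sum_i hmul (pf (p i)) (e i))
      + \sum_i hmul (pf (l i)) (e i) - (hmul delta G - hmul (pf P) G)
      + \sum_j hmul (D j G - pf (w' j)) (phi j).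
    have -> : \sum_i hmul (pf (l i)) (e i) =
        \sum_i hmul (pf (p i)) (e i) - (B + hmul (pf P) G).
      rewrite -ePG -big_split -sumrB /=; apply: eq_bigr => i _.
      by rewrite -hmul_pfD; apply/funext => x; rewrite /hmul pfB; exact: scalerBl.
    have -> : \sum_j hmul (D j G - pf (w' j)) (phi j) = hmul delta G - A.
      rewrite Did // -sumrB; apply: eq_bigr => j _.
      by apply/funext => x; exact: scalerBl.
    exact: zmod_cancel4.
  rewrite eF; apply: (subspaceD sk').
    apply: (subspaceB sk'); last exact: tay.
    apply: (subspaceD sk') => //; apply: (subspace_sum sk') => i _.
    by apply: (jet0_ipow sM tM) => //; exact: hcq.
  apply: (subspace_sum sk') => j _.
  exact: (column_ipow (cphi j)).
have [m [b0 [hm hb0]]] := spans_mod_basis sk' Mb spb.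
exists m, b0; split=> //.
  have := quotient_basis_max sk' hb0 Mu iu.
  by rewrite card_prod card_ord.
move: hm; rewrite card_sum !card_prod !card_ord => hm.
move: hn' hm; move: #|_| #|_| => a1 a2 h1 h2.
have h3 : (n * n' + n * a2 <= n * a1)%N by rewrite -mulnDr leq_mul2l h1 orbT.
lia.
Qed.

End counting.

(** * Asymptotics and conclusion *)

Section limit.
Variable R : realType.

Lemma quadratic_growth_limit (d : nat -> \bar R) (m : nat -> nat) (r s K : nat) :
  (forall k, (s < k)%N -> [/\ d k = (m k)%:R%:E, (2 * m k <= r * k ^ 2 + K * k)%N &
     (r * k ^ 2 <= 2 * m k + K * k)%N]) ->
  ((2`!)%:R%:E * limn (fun k : nat => d k * ((k%:R ^+ 2)^-1)%:E) = r%:R%:E :> \bar R)%E.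
Proof.
move=> h.
have cv : (fun k : nat => (m k)%:R / k%:R ^+ 2 : R) @ \oo --> (r%:R / 2 : R).
  apply/cvgrPdist_lt => e e0.
  (* For k > K / e the error K k / (2 k^2) is below e; for k > s the bounds on m k apply. *)
  pose k0 := maxn s (Num.bound (K%:R / e : R)).
  exists k0.+1 => // k /= hk.
  have sk : (s < k)%N by apply: leq_ltn_trans hk; exact: leq_maxl.
  have [_ h1 h2] := h k sk.
  have kpos : 0 < k%:R :> R by rewrite ltr0n; lia.
  have Kk : K%:R < e * k%:R.
    rewrite mulrC -ltr_pdivrMr //; apply: lt_le_trans (archi_boundP _) _.
      by rewrite divr_ge0 // ltW.
    by rewrite ler_nat; apply: leq_trans (ltnW hk); exact: leq_maxr.
  have h1' : 2 * (m k)%:R <= r%:R * k%:R ^+ 2 + K%:R * k%:R :> R.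
    by rewrite -!natrX -!natrM -natrD ler_nat.
  have h2' : r%:R * k%:R ^+ 2 <= 2 * (m k)%:R + K%:R * k%:R :> R.
    by rewrite -!natrX -!natrM -natrD ler_nat.
  have -> : r%:R / 2 - (m k)%:R / k%:R ^+ 2 =
     (r%:R * k%:R ^+ 2 - 2 * (m k)%:R) / (2 * k%:R ^+ 2) :> R.
    by field; rewrite lt0r_neq0.
  have p2 : 0 < 2 * k%:R ^+ 2 :> R by rewrite mulr_gt0 // exprn_gt0.
  rewrite normrM normfV [`|2 * _|]gtr0_norm // ltr_pdivrMr //.
  apply: (@le_lt_trans _ _ (K%:R * k%:R)); first by rewrite ler_norml; lra.
  rewrite expr2 mulrA mulrA ltr_pM2r //; nra.
have -> : limn (fun k : nat => d k * ((k%:R ^+ 2)^-1)%:E)%E = (r%:R / 2)%:E.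
  apply/cvg_lim => //.
  apply: (@cvg_trans _ ((fun k : nat => ((m k)%:R / k%:R ^+ 2)%:E) @ \oo)); last first.
    by apply: cvg_EFin; [exact: nearW|exact: cv].
  apply: near_eq_cvg; exists s.+1 => // k /= sk.
  by have [-> _ _] := h k sk; rewrite EFinM.
rewrite -EFinM; congr (_%:E).
by rewrite (_ : (2`!)%:R = 2) //; field.
Qed.

End limit.

(** The slack r + 2 r s + 3 n s is shared with [triangular_lower]. With j = k - s, here r comes from
    k(k+1) - k^2 and 3 n s from k(k+1) - j(j+1) <= 3 s k; the lower bound uses k^2 - j(j+1) <= 2 s
    k. *)
Lemma triangular_upper (m n r s k a b : nat) : (s < k)%N ->
  (m + n * a <= r * b + n * b)%N -> (2 * b = k * k.+1)%N ->
  (2 * a = (k - s) * (k - s).+1)%N ->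
  (2 * m <= r * k ^ 2 + (r + 2 * r * s + 3 * n * s) * k)%N.
Proof.
move=> sk h tb ta; have [j ej] : exists j, (k = s + j)%N by exists (k - s)%N; lia.
rewrite ej addKn in ta.
have c : (k * k.+1 <= j * j.+1 + 3 * s * k)%N.
  have : (s <= s * s)%N by case: (s) => // s'; rewrite leq_pmulr.
  by rewrite ej; nia.
have e1 : (n * (2 * a) = n * (j * j.+1))%N by rewrite ta.
have e2 : (n * (2 * b) = n * (k * k.+1))%N by rewrite tb.
have e3 : (r * (2 * b) = r * (k * k.+1))%N by rewrite tb.
have e4 : (n * (k * k.+1) <= n * (j * j.+1) + n * (3 * s * k))%N.
  by rewrite -mulnDr leq_mul2l c orbT.
rewrite expnS expn1; move: h e1 e2 e3 e4; clear; lia.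
Qed.

Lemma triangular_lower (m n r s k a : nat) : (s < k)%N -> (r * a <= m)%N ->
  (2 * a = (k - s) * (k - s).+1)%N ->
  (r * k ^ 2 <= 2 * m + (r + 2 * r * s + 3 * n * s) * k)%N.
Proof.
move=> sk h ta; have [j ej] : exists j, (k = s + j)%N by exists (k - s)%N; lia.
rewrite ej addKn in ta.
have c : (k * k <= j * j.+1 + 2 * s * k)%N by rewrite ej; nia.
have e1 : (r * (2 * a) = r * (j * j.+1))%N by rewrite ta.
have e4 : (r * (k * k) <= r * (j * j.+1) + r * (2 * s * k))%N.
  by rewrite -mulnDr leq_mul2l c orbT.
rewrite expnS expn1; move: h e1 e4; clear; lia.
Qed.

Theorem samuel_multiplicity_fiber_rank (R : realType) (H : symmetric_fock R)
    (N r : nat) (M : set (ball2 R -> 'rV[R[i]]_N)) :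
  invariant_subspace H M -> fiber_rank M r ->
  (codim_ideal (maxideal R) M < +oo)%E ->
  samuel_multiplicity (maxideal R) M = r%:R%:E.
Proof.
move=> iM rM finM.
have sM := inv_subspace iM; have tM := inv_stable iM.
have [n [e]] := quotient_dim_fin finM.
rewrite ideal_act_maxideal // => he.
have [s hs] := codim_bounds iM rM he.
have /choice[m hm] : forall k, exists m : nat, (s < k)%N ->
    [/\ codim_ideal (ideal_exp (maxideal R) k) M = m%:R%:E,
      (r * #|{: tri (k - s)}| <= m)%N &
      (m + n * #|{: tri (k - s)}| <= r * #|{: tri k}| + n * #|{: tri k}|)%N].
  (* m is 0 for k <= s, where nothing is claimed. *)
  move=> k; have [sk|ks] := boolP (s < k)%N; last by exists 0%N => sk; case/negP: ks.
  have [m [b [hb h1 h2]]] := hs k sk; exists m => _; split=> //.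
  rewrite /codim_ideal ideal_act_ipow //.
  exact: (quotient_dim_basis R (ipow_subspace k sM) hb).
apply: (@quadratic_growth_limit _ _ m r s (r + 2 * r * s + 3 * n * s)) => k sk.
have [-> h1 h2] := hm k sk.
have t1 := card_tri k; have t2 := card_tri (k - s).
split=> //; first exact: triangular_upper sk h2 t1 t2.
exact: triangular_lower sk h1 t2.
Qed.

Theorem corollary16 (R : realType) (H : symmetric_fock R) (N : nat) :
  (forall M1 M2 : set (ball2 R -> 'rV[R[i]]_N),
     invariant_subspace H M1 -> invariant_subspace H M2 ->
     M1 `<=` M2 ->
     (codim_ideal (maxideal R) M1 < +oo)%E ->
     (codim_ideal (maxideal R) M2 < +oo)%E ->
     (samuel_multiplicity (maxideal R) M1
        <= samuel_multiplicity (maxideal R) M2)%E)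
  /\
  (forall M : set (ball2 R -> 'rV[R[i]]_N),
     invariant_subspace H M ->
     (codim_ideal (maxideal R) M < +oo)%E ->
     (samuel_multiplicity (maxideal R) M <= N%:R%:E)%E).
Proof.
split=> [M1 M2 i1 i2 M12 f1 f2|M iM fM].
  have [r1 h1] := fiber_rank_exists M1; have [r2 h2] := fiber_rank_exists M2.
  rewrite (samuel_multiplicity_fiber_rank i1 h1 f1).
  rewrite (samuel_multiplicity_fiber_rank i2 h2 f2) lee_fin ler_nat.
  by case: h2 => _; apply; case: h1 => h1 _; exact: fiber_rank_ge_mono h1.
have [r h] := fiber_rank_exists M.
rewrite (samuel_multiplicity_fiber_rank iM h fM) lee_fin ler_nat.
by case: h => h _; exact: fiber_rank_ge_le h.
Qed.
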